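(* Let $n,k,j$ be integers with $0\leq j\leq n-k-1\leq n-1$ and let $K$ be a centered convex body in $\mathbb{R}^n$. Then $$\alpha_{n,k,j}\left(\frac{n-k-j+1}{n+1}\right)^{n-k-j}W_j(K)\leq \int_{G_{n,n-k}}|P_{F^{\perp}}(K)|\,W_j(K\cap F)\,d\nu_{n,n-k}(F)\leq \alpha_{n,k,j}\binom{n-j}{k}W_j(K),$$ where $\alpha_{n,k,j}=\dfrac{\omega_{n-k}\,\omega_{n-j}}{\omega_{n-k-j}\,\omega_n}$.
   Context: A convex body in $\mathbb{R}^n$ is a compact convex set with non-empty interior; it is centered if its barycenter $\frac{1}{|K|}\int_K x\,dx$ is the origin. $|\cdot|$ denotes volume in the appropriate dimension (the $0$-dimensional volume of a point is $1$), $B_2^m$ is the Euclidean unit ball of $\mathbb{R}^m$ and $\omega_m=|B_2^m|$ ($\omega_0=1$). $G_{n,m}$ is the Grassmann manifold of $m$-dimensional linear subspaces of $\mathbb{R}^n$ with its rotation-invariant (Haar) probability measure $\nu_{n,m}$. $P_E$ is the orthogonal projection onto the subspace $E$. For a convex body $L$ in an $m$-dimensional Euclidean space, the quermassintegrals $W_0(L),\ldots,W_m(L)$ are defined by Steiner's formula $|L+\lambda B|=\sum_{i=0}^m\binom{m}{i}W_i(L)\lambda^i$ for $\lambda\geq 0$, where $B$ is the Euclidean unit ball of that space; equivalently $W_i(L)$ is the mixed volume of $m-i$ copies of $L$ and $i$ copies of $B$. Here $W_j(K)$ is taken in dimension $n$, and for $F\in G_{n,n-k}$ the quantity $W_j(K\cap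 F)$ is taken in the $(n-k)$-dimensional space $F$. *)

(* Defs.v *)
From HB Require Import structures.
From mathcomp Require Import all_boot all_order all_algebra.
From mathcomp Require Import all_classical all_reals all_analysis measurable_realfun.

Set Implicit Arguments.
Unset Strict Implicit.
Unset Printing Implicit Defensive.

Import Order.TTheory GRing.Theory Num.Theory.
Import numFieldNormedType.Exports.

Local Open Scope classical_set_scope.
Local Open Scope ring_scope.

Fact mx_borel_display : measure_display.
Proof. exact: default_measure_display. Qed.

Section BorelMatrix.
Variables (R : realType) (m n : nat).

HB.instance Definition _ := @isMeasurable.Build mx_borel_display
  'M[R]_(m, n) <<s @open 'M[R]_(m, n) >> (@sigma_algebra0 _ setT _)
  (@sigma_algebraC _ _) (@sigma_algebra_bigcup _ setT _).

Lemma open_measurable_mx (A : set 'M[R]_(m, n)) : open A -> measurable A.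
Proof. exact: sub_sigma_algebra. Qed.

Lemma measurable_fun_mx d (T : measurableType d) (f : T -> 'M[R]_(m, n)) :
  (forall i j, measurable_fun [set: T] (fun x => f x i j)) ->
  measurable_fun [set: T] f.
Proof.
move=> mf; apply: (measurability (@open 'M[R]_(m, n))) => //.
move=> _ [A oA <-]; rewrite setTI.
pose box (p : 'M[rat]_(m, n) * nat) := [set M : 'M[R]_(m, n) |
  forall i j, ball (ratr (p.1 i j) : R) p.2.+1%:R^-1 (M i j)].
have -> : A = \bigcup_(p in [set p | box p `<=` A]) box p.
  apply/seteqP; split => [M AM|M [p pA pM]]; last exact: pA.
  have /nbhs_ballP[e /= e0 eA] : nbhs M A by exact: open_nbhs_nbhs.
  have [k ke] : exists k : nat, k.+1%:R^-1 < e / 2.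
    have e20 : 0 < e / 2 by rewrite divr_gt0.
    by have [k] := @ltr_add_invr R 0 _ e20; rewrite add0r => ?; exists k.
  have k0 : 0 < k.+1%:R^-1 :> R by rewrite invr_gt0.
  have /fin_all_exists2[q _ qM] : forall i, exists2 q : {ffun 'I_n -> rat},
      True & forall j, ball (ratr (q j) : R) k.+1%:R^-1 (M i j).
    move=> i.
    have /fin_all_exists2[q _ qM] : forall j, exists2 q : rat,
        True & ball (ratr q : R) k.+1%:R^-1 (M i j).
      move=> j; have Mlt : M i j - k.+1%:R^-1 < M i j by rewrite ltrBlDr ltrDl.
      have [q /[!in_itv]/= /andP[q1 q2]] := rat_in_itvoo Mlt.
      exists q => //; rewrite /ball/= distrC ltr_distlC q1/=.
      by rewrite (lt_trans q2)// ltrDl.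
    by exists [ffun j => q j] => // j; rewrite ffunE.
  exists (\matrix_(i, j) q i j, k) => /=; last by move=> i j; rewrite mxE.
  move=> N /= qN; apply: eA; split => // i j.
  rewrite (splitr e); apply: (@ball_triangle _ _ (ratr (q i j) : R)).
    by apply: ball_sym; apply: le_ball (qM i j); exact: ltW.
  by have := qN i j; rewrite mxE; apply: le_ball; exact: ltW.
rewrite preimage_bigcup bigcup_mkcond; apply: countable_bigcupT_measurable.
  exact: countableP.
move=> p; case: ifP => // _.
rewrite (_ : f @^-1` box p =
  \bigcap_(i in [set: 'I_m]) \bigcap_(j in [set: 'I_n])
   ((fun x => f x i j) @^-1` ball (ratr (p.1 i j) : R) p.2.+1%:R^-1)); last first.
  by apply/seteqP; split => x /= H => [i _ j _|i j]; apply: H.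
apply: fin_bigcap_measurable => // i _; apply: fin_bigcap_measurable => // j _.
by rewrite -[X in measurable X]setTI; apply: mf => //; exact: measurable_ball.
Qed.

Lemma measurable_mx_coord i j :
  measurable_fun [set: 'M[R]_(m, n)] (fun M : 'M[R]_(m, n) => M i j).
Proof.
apply: (measurability _ (RGenOpens.measurableE R)) => //.
move=> _ [A [a [b ->]] <-]; rewrite setTI; apply: open_measurable_mx.
apply: open_comp; last exact: interval_open.
by move=> M _; exact: coord_continuous.
Qed.

End BorelMatrix.

Section LebesgueRn.
Variable R : realType.

Definition rV_cons n (p : measurableTypeR R * 'rV[R]_n) : 'rV[R]_n.+1 :=
  row_mx (const_mx p.1 : 'rV[R]_1) p.2.

Definition rV_uncons n (v : 'rV[R]_n.+1) : measurableTypeR R * 'rV[R]_n :=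
  (v ord0 ord0, rsubmx (v : 'rV[R]_(1 + n))).

Lemma rV_consK n : cancel (@rV_cons n) (@rV_uncons n).
Proof.
case=> a v; rewrite /rV_uncons /rV_cons /= row_mxKr; congr pair.
by rewrite mxE; case: splitP => [k _|k //]; rewrite mxE.
Qed.

Lemma rV_unconsK n : cancel (@rV_uncons n) (@rV_cons n).
Proof.
move=> v; rewrite /rV_uncons /rV_cons /=.
rewrite (_ : const_mx _ = lsubmx (v : 'rV[R]_(1 + n))); first exact: (@hsubmxK R 1 1 n v).
by apply/rowP => i; rewrite !mxE; congr (v _ _); apply/val_inj; rewrite /= ord1.
Qed.

Lemma measurable_rV_cons n : measurable_fun [set: _] (@rV_cons n).
Proof.
apply: measurable_fun_mx => i j; case: (@splitP 1 n j) => k jk.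
  rewrite (_ : (fun=> _) = fst); first exact: measurable_fst.
  apply/funext => x; rewrite (_ : j = lshift n k); last exact/val_inj.
  by rewrite [LHS](@row_mxEl R 1 1 n) mxE.
rewrite (_ : (fun=> _) = (fun M : 'rV[R]_n => M i k) \o snd).
  by apply: measurableT_comp => //; exact: measurable_mx_coord.
apply/funext => x; rewrite (_ : j = rshift 1 k); last exact/val_inj.
by rewrite [LHS](@row_mxEr R 1 1 n).
Qed.

Lemma measurable_rV_uncons n : measurable_fun [set: _] (@rV_uncons n).
Proof.
apply/measurable_fun_pairP; split; first exact: measurable_mx_coord.
apply: measurable_fun_mx => i j.
rewrite (_ : (fun=> _) = (fun M : 'rV[R]_n.+1 => M i (rshift 1 j))).
  exact: measurable_mx_coord.
by apply/funext => x /=; rewrite mxE.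
Qed.

Section step.
Variables (n : nat) (mu : {sigma_finite_measure set 'rV[R]_n -> \bar R}).

Definition lebesgue_step : set 'rV[R]_n.+1 -> \bar R :=
  pushforward (lebesgue_measure \x mu)%E (@rV_cons n).

HB.instance Definition _ := Measure.copy lebesgue_step
  (measure_function_pushforward__canonical__measure_function_Measure
    (lebesgue_measure \x mu)%E (@measurable_rV_cons n)).

Let lebesgue_step_sigma_finite : sigma_finite [set: _] lebesgue_step.
Proof.
have /sigma_finiteP[F [FT ndF Foo]] := sigma_finiteT (@lebesgue_measure R).
have /sigma_finiteP[G [GT ndG Goo]] := sigma_finiteT mu.
exists (fun k => @rV_uncons n @^-1` (F k `*` G k)).
  apply/seteqP; split => // v _.
  have [i _ Fi] : (\bigcup_k F k) (rV_uncons v).1 by rewrite -FT.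
  have [j _ Gj] : (\bigcup_k G k) (rV_uncons v).2 by rewrite -GT.
  exists (maxn i j) => //; split.
    by move: Fi; apply/subsetPset/ndF/leq_maxl.
  by move: Gj; apply/subsetPset/ndG/leq_maxr.
move=> k; have [mF Fk] := Foo k; have [mG Gk] := Goo k; split.
  by rewrite -[X in measurable X]setTI; apply: measurable_rV_uncons => //;
    exact: measurableX.
rewrite /lebesgue_step /pushforward -comp_preimage.
rewrite (_ : _ \o _ = id); last by apply/funext => x /=; rewrite rV_consK.
by rewrite preimage_id product_measure1E// lte_mul_pinfty// ge0_fin_numE.
Qed.

HB.instance Definition _ := Measure_isSigmaFinite.Build _ _ _ lebesgue_step
  lebesgue_step_sigma_finite.

End step.

Fixpoint lebesgue_rV n : {sigma_finite_measure set 'rV[R]_n -> \bar R} :=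
  match n with
  | 0 => \d_(0 : 'rV[R]_0)
  | n'.+1 => lebesgue_step (lebesgue_rV n')
  end.

Lemma rV_cons0 n (p : measurableTypeR R * 'rV[R]_n) :
  rV_cons p ord0 ord0 = p.1.
Proof. exact: (congr1 fst (rV_consK p)). Qed.

Lemma rV_consS n (p : measurableTypeR R * 'rV[R]_n) i :
  rV_cons p ord0 (lift ord0 i) = p.2 ord0 i.
Proof.
rewrite (_ : lift ord0 i = rshift 1 i); last exact/val_inj.
exact: (@row_mxEr R 1 1 n).
Qed.

Lemma measurable_rV_box n (A : 'I_n -> set R) :
  (forall i, measurable (A i)) ->
  measurable [set x : 'rV[R]_n | forall i, A i (x ord0 i)].
Proof.
move=> mA; rewrite (_ : [set _ | _] = \bigcap_(i in [set: 'I_n])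
    ((fun x : 'rV[R]_n => x ord0 i) @^-1` A i)); last first.
  by apply/seteqP; split => x /= H => [i _|i]; apply: H.
apply: fin_bigcap_measurable => [|i _]; first exact: finite_finset.
rewrite -[X in measurable X]setTI; exact: (measurable_mx_coord ord0 i measurableT (mA i)).
Qed.

Lemma lebesgue_rV_box n (A : 'I_n -> set R) :
  (forall i, measurable (A i)) ->
  lebesgue_rV n [set x | forall i, A i (x ord0 i)] =
  (\prod_(i < n) lebesgue_measure (A i))%E.
Proof.
elim: n A => [|n IH] A mA /=.
  by rewrite big_ord0 diracE mem_set// => -[].
rewrite /lebesgue_step /pushforward big_ord_recl -IH//.
rewrite -product_measure1E; [|exact: mA|]; last first.
  exact: (measurable_rV_box (fun i => mA (lift ord0 i))).
congr (_ _); apply/seteqP; split => [[a v]|[a v] [/= Aa Av] i].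
  move=> /= H; split => /= [|i]; first by have := H ord0; rewrite rV_cons0.
  by have := H (lift ord0 i); rewrite rV_consS.
by case: (unliftP ord0 i) => [j ->|->]; rewrite ?rV_consS ?rV_cons0.
Qed.

End LebesgueRn.

Section Convex.
Variables (R : realType) (n : nat).
Implicit Types (K L : set 'rV[R]_n) (x y : 'rV[R]_n).

Definition dot x y : R := \sum_i x ord0 i * y ord0 i.

(* The topology of ['rV[R]_n] comes from the sup norm; the Euclidean ball is
   therefore written out. *)
Definition eball : set 'rV[R]_n := [set x | dot x x <= 1].

Definition minkowski_sum K L : set 'rV[R]_n := [set x + y | x in K & y in L].

Definition dilate (a : R) K : set 'rV[R]_n := [set a *: x | x in K].

Definition convex_body K := [/\ compact K, convex_set K & interior K !=set0].

Definition barycenter K : 'rV[R]_n := \row_i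
  ((fine (lebesgue_rV R n K))^-1 * (\int[lebesgue_rV R n]_(x in K) x ord0 i)%R).

Definition centered K := barycenter K = 0.

Definition steiner K (W : nat -> R) := forall a : R, 0 <= a ->
  lebesgue_rV R n (minkowski_sum K (dilate a eball)) =
  (\sum_(i < n.+1) 'C(n, i)%:R * W i * a ^+ i)%:E.

(* [quermass K i] is only meaningful for [i <= n]; it is determined by
   [steiner] there. *)
Definition quermass K : nat -> R := xget (fun=> 0) (steiner K).

End Convex.

Definition omega (R : realType) (m : nat) : R :=
  fine (lebesgue_rV R m (@eball R m)).

Section Grassmann.
Variables (R : realType) (n : nat).
Implicit Types (F P U : 'M[R]_n) (A K : set 'rV[R]_n).

(* A linear subspace of R^n is represented by the matrix of the orthogonal
   projection onto it, acting on row vectors on the right; the subspace is the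
   row space of that matrix (see [grassmannian_uniq]). *)
Definition grassmannian (m : nat) : set 'M[R]_n :=
  [set F | [/\ F^T = F, F *m F = F & \rank F = m]].

Definition rowspace F : set 'rV[R]_n := [set x | (x <= F)%MS].

Definition orthocompl F : 'M[R]_n := 1%:M - F.

Definition orthoproj F K : set 'rV[R]_n := [set x *m F | x in K].

(* Rotation by [U] maps the row space of [F] to the row space of [F *m U],
   whose orthogonal projection is [U^T *m F *m U]. *)
Definition grassmann_haar (m : nat) (nu : probability 'M[R]_n R) :=
  nu (grassmannian m) = 1%E /\
  forall U, U *m U^T = 1%:M -> \det U = 1 ->
    forall B : set 'M[R]_n, measurable B ->
      nu [set F | B (U^T *m F *m U)] = nu B.

Definition onb F : 'M[R]_(\rank F, n) :=
  xget 0 [set B | B *m B^T = 1%:M /\ (B == F)%MS].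

(* Coordinates, in an orthonormal basis of the subspace, of the points of [A]
   lying in it. *)
Definition coords F A : set 'rV[R]_(\rank F) := [set x | A (x *m onb F)].
Arguments coords : clear implicits.

Definition vol_in F A : \bar R := lebesgue_rV R (\rank F) (coords F A).

Definition quermass_in F A : nat -> R := quermass (coords F A).

Lemma dotE (x y : 'rV[R]_n) : dot x y = (x *m y^T) ord0 ord0.
Proof. by rewrite mxE; apply: eq_bigr => i _; rewrite mxE. Qed.

Lemma dot_eq0 (x : 'rV[R]_n) : dot x x = 0 -> x = 0.
Proof.
move=> /eqP; rewrite psumr_eq0 => [/allP x0|i _]; last by rewrite -expr2 sqr_ge0.
apply/rowP => i; rewrite mxE; apply/eqP.
by have := x0 i (mem_index_enum _); rewrite /= -expr2 sqrf_eq0.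
Qed.

Lemma gram_unitmx p (B : 'M[R]_(p, n)) : row_free B -> B *m B^T \in unitmx.
Proof.
move=> Bfree; rewrite -row_free_unit -kermx_eq0; apply/eqP.
apply/row_matrixP => i; rewrite row0; set u := row i _.
have uG : u *m (B *m B^T) = 0 by rewrite -row_mul mulmx_ker row0.
have uB0 : u *m B = 0.
  by apply: dot_eq0; rewrite dotE trmx_mul mulmxA -(mulmxA u) uG mul0mx mxE.
by apply: (row_free_inj Bfree); rewrite uB0 mul0mx.
Qed.

Lemma grassmannian_uniq p (A : 'M[R]_(p, n)) :
  exists! F, grassmannian (\rank A) F /\ (F == A)%MS.
Proof.
pose B := row_base A; pose G := B *m B^T; pose F := B^T *m invmx G *m B.
have Gu : G \in unitmx by apply: gram_unitmx; exact: row_base_free.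
have GT : G^T = G by rewrite /G (trmx_mul B) trmxK.
have BF : B *m F = B by rewrite /F !mulmxA mulmxV// mul1mx.
have FB : (F == B)%MS.
  by apply/andP; split; [exact: submxMl|rewrite -{1}BF; exact: submxMl].
have FA : (F == A)%MS by apply/eqmxP/(eqmx_trans (eqmxP FB)); exact: eq_row_base.
have FT : F^T = F by rewrite /F trmx_mul (trmx_mul B^T) trmxK trmx_inv GT mulmxA.
have FF : F *m F = F by rewrite -[LHS](mulmxA _ B F) BF.
exists F; split=> [|F' [[F'T F'F' _] F'A]].
  by split=> //; split=> //; rewrite (eqmxP FA).
have /andP[FF' F'F] : (F == F')%MS.
  by apply/eqmxP/(eqmx_trans (eqmxP FA))/eqmx_sym/eqmxP.
have E1 : F *m F' = F by have /submxP[D ->] := FF'; rewrite -mulmxA F'F'.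
have E2 : F' *m F = F' by have /submxP[D ->] := F'F; rewrite -mulmxA FF.
by rewrite -[RHS]E2 -[LHS]FT -[in LHS]E1 trmx_mul F'T FT.
Qed.

Lemma sub_orthocompl F (x : 'rV[R]_n) : F^T = F -> F *m F = F ->
  rowspace (orthocompl F) x <-> (forall y, rowspace F y -> dot x y = 0).
Proof.
move=> FT FF; split=> [/submxP[u ->] y /submxP[v ->]|xF].
  rewrite dotE trmx_mul FT mulmxA -(mulmxA u) mulmxBl mul1mx FF subrr.
  by rewrite mulmx0 mul0mx mxE.
suff xF0 : x *m F = 0.
  apply/submxP; exists x; rewrite /orthocompl mulmxBr mulmx1 xF0 subr0 //.
apply: dot_eq0; rewrite dotE trmx_mul FT mulmxA -(mulmxA x) FF.
by rewrite -FT -mulmxA -trmx_mul -dotE; apply: xF; exact: submxMl.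
Qed.

Lemma proj_orthogonal F (x y : 'rV[R]_n) : F^T = F -> F *m F = F ->
  rowspace F y -> dot (x - x *m F) y = 0.
Proof.
move=> FT FF; apply: (sub_orthocompl _ FT FF).1.
by rewrite -{1}(mulmx1 x) -mulmxBr; exact: submxMl.
Qed.

End Grassmann.
Arguments coords {R n} F A _ /.

Definition alpha (R : realType) (n k j : nat) : R :=
  omega R (n - k) * omega R (n - j) / (omega R (n - k - j) * omega R n).

(* Main.v *)
(* Kubota's formula writes W_j as a constant times the average volume of random
   (n - j)-dimensional projections. It is applied to K n F inside F and to K itself;
   since a rotation of F changes neither K nor P_{F^perp}, the integral becomes a
   constant times the average over rotations U of |P_Y L| |L n E|, where L is the
   projection of the rotated body UK to E + Y, with dim E = d = n - k - j and
   dim Y = k, and the average of |L| is a multiple of W_j(K).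

   For fixed U, both bounds compare |P_Y L| |L n E| with |L|. The function
   a(y) = |L n (E + y)|^(1/d) is concave on P_Y L by Brunn-Minkowski. The moment
   inequality (m + p) int_C a^p >= p a(z) int_C a^(p-1) for concave a >= 0 on an
   m-dimensional convex set C, iterated, gives the upper bound (Rogers-Shephard).
   For the lower bound, replace the fibres of UK over L by cubes of the same
   volume: the moment inequality then shows that the average of a over UK is at
   least (d + 1) / (n + 1) times any value of a, and by Jensen's inequality it is
   at most a(0), because UK is centered.

   Steiner's and Kubota's formulas are proved by induction on the dimension: a
   Minkowski sum with a segment changes the volume by its length times the volume
   of a projection, and the ball is squeezed between zonotopes whose segments are
   distributed almost uniformly. *)
Require Import Defs.
From HB Require Import structures.
From mathcomp Require Import all_boot all_order all_algebra.
From mathcomp Require Import all_classical all_reals all_analysis measurable_realfun.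
From mathcomp Require Import ring lra zify.

Set Implicit Arguments.
Unset Strict Implicit.
Unset Printing Implicit Defensive.

Import Order.TTheory GRing.Theory Num.Theory.
Import numFieldNormedType.Exports.

Local Open Scope classical_set_scope.
Local Open Scope ring_scope.

(** * Measure-preserving maps and invariance of Lebesgue measure *)

(** [quermass] is only some solution of Steiner's formula, so nothing is known about it until a
    solution is exhibited. [kubota] is that solution, for every nonempty compact convex set, since
    the shadows and sections that occur come with no control on their interiors.

    Three obstacles shape the rest. The spaces F and its complement vary, so volumes in them are
    read off from cylinders in R^n. The Haar measure constructed here lives on the full orthogonal
    group, while the measure on the Grassmannian is only assumed invariant under rotations: a
    reflection inside the reference subspace, available since d >= 1, bridges the two. Fibre volumes
    are used only through upper semicontinuity, which makes the region under their root compact, and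
    separation then gives Jensen's inequality.

    As to constants, alpha is the product of omega_(n-k) / omega_d, from Kubota's formula inside F,
    and omega_(n-j) / omega_n, from the formula for K. The binomial C(d+k, k) comes from d moment
    inequalities in dimension k, and (d+1) / (n+1) from a single one of order d + 1 in dimension j +
    k. *)

Section MatrixContinuity.
Variable R : realType.

Lemma continuous_mx (T : topologicalType) m n (f : T -> 'M[R]_(m, n)) :
  (forall i j, continuous (fun x => f x i j)) -> continuous f.
Proof.
move=> cf x; apply/cvg_ballP => e e0.
have : \forall y \near x, forall ij : 'I_m * 'I_n,
    ball (f x ij.1 ij.2) e (f y ij.1 ij.2).
  apply: filter_forall => -[i j] /=.
  by have /cvg_ballP/(_ _ e0) := cf i j x.
by apply: filterS => y H; split => // i j; exact: (H (i, j)).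
Qed.

Lemma continuous_sumr (T : topologicalType) (I : Type) (s : seq I) (f : I -> T -> R) :
  (forall i, continuous (f i)) -> continuous (fun x => \sum_(i <- s) f i x).
Proof.
move=> cf x; elim: s => [|i s IH].
  by under eq_fun do rewrite big_nil; exact: cst_continuous.
under eq_fun do rewrite big_cons.
by apply: continuousD => //; exact: cf.
Qed.

Lemma continuous_mxE (T : topologicalType) m n (f : T -> 'M[R]_(m, n)) i j :
  continuous f -> continuous (fun x => f x i j).
Proof.
move=> cf x; apply: (@continuous_comp _ _ _ f (fun M : 'M[R]_(m, n) => M i j)).
  exact: cf.
exact: coord_continuous.
Qed.

Lemma continuous_mulmx (T : topologicalType) m n p (f : T -> 'M[R]_(m, n))
    (g : T -> 'M[R]_(n, p)) :
  continuous f -> continuous g -> continuous (fun x => f x *m g x).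
Proof.
move=> cf cg; apply: continuous_mx => i j.
under eq_fun do rewrite mxE.
apply: continuous_sumr => k x.
by apply: cvgM; [exact: continuous_mxE|exact: continuous_mxE].
Qed.

Lemma continuous_trmx (T : topologicalType) m n (f : T -> 'M[R]_(m, n)) :
  continuous f -> continuous (fun x => (f x)^T).
Proof.
move=> cf; apply: continuous_mx => i j.
by under eq_fun do rewrite mxE; exact: continuous_mxE.
Qed.

Lemma continuous_addmx (T : topologicalType) m n (f g : T -> 'M[R]_(m, n)) :
  continuous f -> continuous g -> continuous (fun x => f x + g x).
Proof. by move=> cf cg x; apply: cvgD; [exact: cf|exact: cg]. Qed.

Lemma continuous_submx (T : topologicalType) m n (f g : T -> 'M[R]_(m, n)) :
  continuous f -> continuous g -> continuous (fun x => f x - g x).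
Proof. by move=> cf cg x; apply: cvgB; [exact: cf|exact: cg]. Qed.

Lemma continuous_comp_rsubmx (T : topologicalType) m n p (f : T -> 'M[R]_(m, n + p)) :
  continuous f -> continuous (fun x => rsubmx (f x)).
Proof.
move=> cf; apply: continuous_mx => i j.
by under eq_fun do rewrite mxE; exact: continuous_mxE.
Qed.

Lemma continuous_comp_lsubmx (T : topologicalType) m n p (f : T -> 'M[R]_(m, n + p)) :
  continuous f -> continuous (fun x => lsubmx (f x)).
Proof.
move=> cf; apply: continuous_mx => i j.
by under eq_fun do rewrite mxE; exact: continuous_mxE.
Qed.

Lemma continuous_row_mx (T : topologicalType) m n p (f : T -> 'M[R]_(m, n))
    (g : T -> 'M[R]_(m, p)) :
  continuous f -> continuous g -> continuous (fun x => row_mx (f x) (g x)).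
Proof.
move=> cf cg; apply: continuous_mx => i j; under eq_fun do rewrite mxE.
by case: (fintype.split j) => k; exact: continuous_mxE.
Qed.

Lemma continuous_vec_mx (T : topologicalType) m n (f : T -> 'rV[R]_(m * n)) :
  continuous f -> continuous (fun x => vec_mx (f x)).
Proof.
move=> cf; apply: continuous_mx => i j.
by under eq_fun do rewrite mxE; exact: continuous_mxE.
Qed.

Lemma continuous_dot (T : topologicalType) n (f g : T -> 'rV[R]_n) :
  continuous f -> continuous g -> continuous (fun x => dot (f x) (g x)).
Proof.
move=> cf cg; apply: continuous_sumr => i x.
by apply: cvgM; exact: continuous_mxE.
Qed.

Lemma continuous_pair (T X Y : topologicalType) (f : T -> X) (g : T -> Y) :
  continuous f -> continuous g -> continuous (fun x => (f x, g x)).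
Proof. by move=> cf cg x; exact: (cvg_pair (cf x) (cg x)). Qed.

Lemma closed_measurable_mx m n (A : set 'M[R]_(m, n)) : closed A -> measurable A.
Proof.
move=> cA; rewrite -[A]setCK; apply: measurableC; apply: open_measurable_mx.
exact: closed_openC.
Qed.

Lemma continuous_measurable_mx m n p q (f : 'M[R]_(m, n) -> 'M[R]_(p, q)) :
  continuous f -> measurable_fun setT f.
Proof.
move=> cf; apply: measurable_fun_mx => i j.
apply: (measurability _ (RGenOpens.measurableE R)) => //.
move=> _ [A [a [b ->]] <-]; rewrite setTI; apply: open_measurable_mx.
apply: open_comp; last exact: interval_open.
by move=> M _; exact: continuous_mxE.
Qed.

Lemma measurable_mx_coordfun d (T : measurableType d) m n (f : T -> 'M[R]_(m, n)) i j :
  measurable_fun setT f -> measurable_fun setT (fun x => f x i j).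
Proof.
by move=> mf; exact: (measurableT_comp (measurable_mx_coord i j) mf).
Qed.

Lemma measurable_fun_row_mx d (T : measurableType d) m n p (f : T -> 'M[R]_(m, n))
    (g : T -> 'M[R]_(m, p)) :
  measurable_fun setT f -> measurable_fun setT g ->
  measurable_fun setT (fun x => row_mx (f x) (g x)).
Proof.
move=> mf mg; apply: measurable_fun_mx => i j; under eq_fun do rewrite mxE.
by case: (fintype.split j) => k; exact: measurable_mx_coordfun.
Qed.

Lemma measurable_fun_mulmx d (T : measurableType d) m n p (f : T -> 'M[R]_(m, n))
    (g : T -> 'M[R]_(n, p)) :
  measurable_fun setT f -> measurable_fun setT g ->
  measurable_fun setT (fun x => f x *m g x).
Proof.
move=> mf mg; apply: measurable_fun_mx => i j; under eq_fun do rewrite mxE.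
apply: measurable_sum => k; apply: measurable_funM; exact: measurable_mx_coordfun.
Qed.

(** Pairs carry the product sigma-algebra, while closedness refers to the product topology. Packing
    a pair into one row vector is measurable and has a continuous inverse, so [D] is the measurable
    preimage of a closed set of row vectors. *)
Lemma closed_measurable_prod m n p (D : set ('M[R]_(m, n) * 'rV[R]_p)) :
  closed D -> measurable D.
Proof.
move=> cD; pose h (z : 'rV[R]_(m * n + p)) : 'M[R]_(m, n) * 'rV[R]_p :=
  (vec_mx (lsubmx z), rsubmx z).
pose g (q : 'M[R]_(m, n) * 'rV[R]_p) : 'rV[R]_(m * n + p) := row_mx (mxvec q.1) q.2.
have gK q : h (g q) = q by case: q => U x; rewrite /h /g row_mxKl row_mxKr mxvecK.
have -> : D = g @^-1` (h @^-1` D).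
  by apply/seteqP; split => q /=; rewrite gK.
rewrite -[X in measurable X]setTI.
have mg : measurable_fun setT g.
  apply: measurable_fun_row_mx; last exact: measurable_snd.
  apply: measurable_fun_mx => i j; case/mxvec_indexP: j => a b.
  rewrite ord1; under eq_fun do rewrite mxvecE.
  by apply: measurable_mx_coordfun; exact: measurable_fst.
apply: mg => //; apply: closed_measurable_mx.
have ch : continuous h.
  have id_c : continuous (fun z : 'rV[R]_(m * n + p) => z) by move=> z; exact: cvg_id.
  apply: continuous_pair.
    by apply: continuous_vec_mx; exact: continuous_comp_lsubmx.
  exact: continuous_comp_rsubmx.
by move/continuous_closedP: ch; apply.
Qed.

End MatrixContinuity.

Lemma measurable_preim d1 d2 (X : measurableType d1) (Y : measurableType d2)
    (f : X -> Y) (A : set Y) :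
  measurable_fun setT f -> measurable A -> measurable (f @^-1` A).
Proof. by move=> mf mA; rewrite -[X in measurable X]setTI; exact: mf. Qed.

Section MeasurePreserving.
Context d1 d2 (X : measurableType d1) (Y : measurableType d2) (R : realType).

Definition preserves (mu : set X -> \bar R) (nu : set Y -> \bar R) (phi : X -> Y) :=
  measurable_fun setT phi /\ forall A, measurable A -> mu (phi @^-1` A) = nu A.

Lemma preserves_integral_in (mu : {measure set X -> \bar R})
    (nu : {measure set Y -> \bar R}) (phi : X -> Y) (D : set Y) (f : Y -> \bar R) :
  preserves mu nu phi -> measurable D -> measurable_fun D f ->
  (forall y, D y -> 0 <= f y)%E ->
  (\int[mu]_(x in phi @^-1` D) f (phi x) = \int[nu]_(y in D) f y)%E.
Proof.
move=> [mphi H] mD mf f0.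
have f0' : {in D, forall y, (0 <= f y)%E} by move=> y; rewrite inE; exact: f0.
rewrite -(ge0_integral_pushforward mphi mu mD mf f0').
by apply: eq_measure_integral => /= A mA _; rewrite /pushforward H.
Qed.

Lemma preserves_integral (mu : {measure set X -> \bar R})
    (nu : {measure set Y -> \bar R}) (phi : X -> Y) (f : Y -> \bar R) :
  preserves mu nu phi -> measurable_fun setT f -> (forall y, 0 <= f y)%E ->
  (\int[mu]_x f (phi x) = \int[nu]_y f y)%E.
Proof.
by move=> pphi mf f0; rewrite -(preserves_integral_in pphi measurableT)// preimage_setT.
Qed.

End MeasurePreserving.

Lemma preserves_comp d1 d2 d3 (X : measurableType d1) (Y : measurableType d2)
    (Z : measurableType d3) (R : realType) (mu : set X -> \bar R)
    (nu : set Y -> \bar R) (ka : set Z -> \bar R) (f : X -> Y) (g : Y -> Z) :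
  preserves mu nu f -> preserves nu ka g -> preserves mu ka (g \o f).
Proof.
move=> [mf Hf] [mg Hg]; split; first exact: measurableT_comp.
move=> A mA; rewrite comp_preimage Hf ?Hg//.
by rewrite -[X in measurable X]setTI; exact: mg.
Qed.

Section ProductSections.
Context d1 d2 (X : measurableType d1) (Y : measurableType d2) (R : realType).
Variables (mu : {sigma_finite_measure set X -> \bar R})
  (nu : {sigma_finite_measure set Y -> \bar R}).

Lemma measurable_slice1 (A : set (X * Y)) x :
  measurable A -> measurable [set y | A (x, y)].
Proof.
move=> mA; have := measurable_xsection x mA; congr (measurable _).
by apply/seteqP; split => y; rewrite /xsection /= ?inE.
Qed.

Lemma measurable_slice2 (A : set (X * Y)) y :
  measurable A -> measurable [set x | A (x, y)].
Proof.
move=> mA; have := measurable_ysection y mA; congr (measurable _).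
by apply/seteqP; split => x; rewrite /ysection /= ?inE.
Qed.

Lemma measurable_vol1 (A : set (X * Y)) :
  measurable A -> measurable_fun setT (fun x => nu [set y | A (x, y)]).
Proof.
move=> mA; have := measurable_fun_xsection nu mA; congr (measurable_fun _ _).
apply/funext => x; congr (nu _).
by apply/seteqP; split => y; rewrite /xsection /= ?inE.
Qed.

Lemma measurable_vol2 (A : set (X * Y)) :
  measurable A -> measurable_fun setT (fun y => mu [set x | A (x, y)]).
Proof.
move=> mA; have := measurable_fun_ysection mu mA; congr (measurable_fun _ _).
apply/funext => y; congr (mu _).
by apply/seteqP; split => x; rewrite /ysection /= ?inE.
Qed.

Lemma prod_vol1 (A : set (X * Y)) : measurable A ->
  ((mu \x nu) A = \int[mu]_x nu [set y | A (x, y)])%E.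
Proof.
move=> mA; rewrite [LHS]/product_measure1; apply: eq_integral => x _ /=; congr (nu _).
by apply/seteqP; split => y; rewrite /xsection /= ?inE.
Qed.

Lemma prod_vol2 (A : set (X * Y)) : measurable A ->
  ((mu \x nu) A = \int[nu]_y mu [set x | A (x, y)])%E.
Proof.
move=> mA; have <- : (mu \x^ nu)%E A = (mu \x nu)%E A.
  apply/esym; apply: product_measure_unique => // B C mB mC; exact: product_measure2E.
rewrite /product_measure2; apply: eq_integral => y _ /=; congr (mu _).
by apply/seteqP; split => x; rewrite /ysection /= ?inE.
Qed.

End ProductSections.

Lemma preserves_prod d1 d2 d3 d4 (X : measurableType d1) (Y : measurableType d2)
   (X' : measurableType d3) (Y' : measurableType d4) (R : realType)
  (mu : {sigma_finite_measure set X -> \bar R})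
  (nu : {sigma_finite_measure set Y -> \bar R})
  (mu' : {sigma_finite_measure set X' -> \bar R})
  (nu' : {sigma_finite_measure set Y' -> \bar R}) (f : X -> X') (g : Y -> Y') :
  preserves mu mu' f -> preserves nu nu' g ->
  preserves (mu \x nu)%E (mu' \x nu')%E (fun p => (f p.1, g p.2)).
Proof.
move=> pf pg; have [[mf Hf] [mg Hg]] := (pf, pg).
have mfg : measurable_fun setT (fun p : X * Y => (f p.1, g p.2)).
  by apply: measurable_fun_pair; apply: measurableT_comp.
split => // A mA; rewrite !prod_vol1//; last first.
  by rewrite -[X in measurable X]setTI; exact: mfg.
rewrite -(preserves_integral pf (measurable_vol1 nu' mA))//.
by apply: eq_integral => x _ /=; rewrite -Hg//; exact: measurable_slice1.
Qed.

(** * Translations, reflections and uniqueness of Lebesgue measure *)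

Section LebesgueInvariance.
Variable R : realType.
Local Notation mu n := (lebesgue_rV R n).

Lemma preserves_translate1 (a : R) :
  preserves (@lebesgue_measure R) (@lebesgue_measure R)
    (fun x : measurableTypeR R => x + a : measurableTypeR R).
Proof.
have mt : measurable_fun setT (fun x : measurableTypeR R => x + a : measurableTypeR R).
  exact: measurable_funD.
split => // A mA.
have /(_ mt) uniq := @lebesgue_measure_unique R
  (pushforward lebesgue_measure (fun x : measurableTypeR R => x + a : measurableTypeR R)).
apply/esym/uniq => //= _ [[b c]] _ <-.
rewrite /pushforward.
have -> : (fun x : measurableTypeR R => x + a : measurableTypeR R) @^-1` [set` `]b, c]] =
   [set` `]b - a, c - a]].
  by apply/seteqP; split => x /=; rewrite !in_itv/= ltrBlDr lerBrDr.
rewrite !lebesgue_measure_itv/= !lte_fin ltrD2r; case: ifP => // _.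
by rewrite -!EFinD; congr EFin; ring.
Qed.

Lemma preserves_opp1 :
  preserves (@lebesgue_measure R) (@lebesgue_measure R)
    (fun x : measurableTypeR R => - x : measurableTypeR R).
Proof.
split; first exact: oppr_measurable.
exact: lebesgue_measureN.
Qed.

Lemma preserves_cons n :
  preserves (lebesgue_measure \x mu n)%E (mu n.+1) (@rV_cons R n).
Proof. by split => //; exact: measurable_rV_cons. Qed.

Lemma preserves_uncons n :
  preserves (mu n.+1) (lebesgue_measure \x mu n)%E (@rV_uncons R n).
Proof.
split; first exact: measurable_rV_uncons.
move=> A mA; rewrite /= /lebesgue_step /pushforward; congr (_ _).
by apply/seteqP; split => p /=; rewrite rV_consK.
Qed.

Lemma preserves_step n (f : measurableTypeR R -> measurableTypeR R)
    (g : 'rV[R]_n -> 'rV[R]_n) :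
  preserves (@lebesgue_measure R) (@lebesgue_measure R) f ->
  preserves (mu n) (mu n) g ->
  preserves (mu n.+1) (mu n.+1)
    (fun x => rV_cons (f (rV_uncons x).1, g (rV_uncons x).2)).
Proof.
move=> pf pg.
apply: (preserves_comp (preserves_uncons n)
  (preserves_comp (preserves_prod pf pg) (preserves_cons n))).
Qed.

Lemma preserves_translate n (a : 'rV[R]_n) :
  preserves (mu n) (mu n) (fun x => x + a).
Proof.
elim: n a => [|n IH] a.
  have -> : (fun x : 'rV[R]_0 => x + a) = id by apply/funext => x; rewrite [LHS]thinmx0 [RHS]thinmx0.
  by split => //; exact: measurable_id.
have := preserves_step (preserves_translate1 (a ord0 ord0)) (IH (rsubmx (a : 'rV[R]_(1 + n)))).
congr (preserves _ _ _); apply/funext => x.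
apply/rowP => i; case: (unliftP ord0 i) => [j ->|->]; rewrite ?rV_consS ?rV_cons0 !mxE//=.
by congr (x _ _ + a _ _); apply/val_inj.
Qed.

Lemma preserves_opp n : preserves (mu n) (mu n) (fun x => - x).
Proof.
elim: n => [|n IH].
  have -> : (fun x : 'rV[R]_0 => - x) = id by apply/funext => x; rewrite [LHS]thinmx0 [RHS]thinmx0.
  by split => //; exact: measurable_id.
have := preserves_step preserves_opp1 IH.
congr (preserves _ _ _); apply/funext => x.
apply/rowP => i; case: (unliftP ord0 i) => [j ->|->]; rewrite ?rV_consS ?rV_cons0 !mxE//=.
by congr (- x _ _); apply/val_inj.
Qed.

Lemma preserves_reflect n (a : 'rV[R]_n) :
  preserves (mu n) (mu n) (fun x => a - x).
Proof.
have := preserves_comp (preserves_opp n) (preserves_translate a).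
by congr (preserves _ _ _); apply/funext => x /=; rewrite addrC.
Qed.

Lemma measurable_translate n (a : 'rV[R]_n) (A : set 'rV[R]_n) :
  measurable A -> measurable [set x | A (x + a)].
Proof.
by move=> mA; rewrite -[X in measurable X]setTI; exact: (preserves_translate a).1.
Qed.

(* Fubini applied to [1_A(x) * 1_B(y - x)]. *)
Lemma translation_invariant_uniq n (nu : {sigma_finite_measure set 'rV[R]_n -> \bar R})
    (A B : set 'rV[R]_n) :
  (forall (a : 'rV[R]_n) (D : set 'rV[R]_n), measurable D ->
    nu [set x | D (x + a)] = nu D) ->
  measurable A -> measurable B -> (mu n A * nu B = mu n B * nu A)%E.
Proof.
move=> nuT mA mB.
pose E := [set p : 'rV[R]_n * 'rV[R]_n | A p.1 /\ B (p.2 - p.1)].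
have msub : measurable_fun setT (fun p : 'rV[R]_n * 'rV[R]_n => p.2 - p.1).
  apply: measurable_fun_mx => i j; under eq_fun do rewrite !mxE.
  apply: measurable_funB; apply: measurable_mx_coordfun;
    [exact: measurable_snd|exact: measurable_fst].
have mE : measurable E.
  rewrite (_ : E = fst @^-1` A `&` (fun p => p.2 - p.1) @^-1` B)//.
  apply: measurableI; rewrite -[X in measurable X]setTI; last exact: msub.
  exact: measurable_fst.
pose E' := [set p : 'rV[R]_n * 'rV[R]_n | B p.1 /\ A (p.2 - p.1)].
have mE' : measurable E'.
  rewrite (_ : E' = fst @^-1` B `&` (fun p => p.2 - p.1) @^-1` A)//.
  apply: measurableI; rewrite -[X in measurable X]setTI; last exact: msub.
  exact: measurable_fst.
have side (C D : set 'rV[R]_n) : measurable C -> measurable D ->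
    (\int[mu n]_x nu [set y : 'rV[R]_n | C x /\ D (y - x)%R] = mu n C * nu D)%E.
  move=> mC mD.
  transitivity (\int[mu n]_x (nu D * (\1_C x)%:E))%E.
    apply: eq_integral => x _; rewrite indicE; have [xC|xC] := boolP (x \in C).
      rewrite mule1 -(nuT (- x) D mD); congr (nu _); apply/seteqP; split => y //=.
        by case.
      by split => //; rewrite inE in xC.
    rewrite mule0 (_ : [set y | _] = set0) ?measure0//.
    by apply/seteqP; split => y //= -[Cx _]; move: xC; rewrite notin_setE.
  rewrite ge0_integralZl//; last by apply/measurable_EFinP; exact: measurable_indic.
  by rewrite integral_indic// setIT muleC.
(* For fixed [y] the two inner sets correspond under the reflection of [x] to [y - x], which
   preserves Lebesgue measure. *)
rewrite -(side A B)// -(side B A)//.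
rewrite -(prod_vol1 (mu n) nu mE) -(prod_vol1 (mu n) nu mE') !prod_vol2//.
apply: eq_integral => y _ /=.
have mS : measurable [set x | A x /\ B (y - x)] by exact: measurable_slice2 mE.
rewrite -((preserves_reflect y).2 _ mS); congr (mu n _).
by apply/seteqP; split => x /=; rewrite subKr => -[? ?]; split.
Qed.

End LebesgueInvariance.

Section SigmaFinitePush.
Context d1 d2 (X : measurableType d1) (Y : measurableType d2) (R : realType).
Variables (mu : {sigma_finite_measure set X -> \bar R}) (f : X -> Y) (g : Y -> X).
Hypotheses (mf : measurable_fun setT f) (mg : measurable_fun setT g)
  (fK : cancel f g).

(** The uniqueness argument needs sigma-finite measures; the left inverse [g] carries an exhausting
    sequence of [mu] over to the pushforward. *)
Definition sfpush : set Y -> \bar R := pushforward mu f.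

HB.instance Definition _ := Measure.copy sfpush
  (measure_function_pushforward__canonical__measure_function_Measure mu mf).

Let sfpush_sigma_finite : sigma_finite [set: _] sfpush.
Proof.
have /sigma_finiteP[F [FT ndF Foo]] := sigma_finiteT mu.
exists (fun k => g @^-1` F k).
  apply/seteqP; split => // y _.
  by have [i _ Fi] : (\bigcup_k F k) (g y); [rewrite -FT|exists i].
move=> k; have [mF Fk] := Foo k; split.
  exact: measurable_preim.
rewrite /sfpush /pushforward -comp_preimage (_ : g \o f = id)//.
by apply/funext => x /=; rewrite fK.
Qed.

HB.instance Definition _ := Measure_isSigmaFinite.Build _ _ _ sfpush
  sfpush_sigma_finite.

Definition sigma_finite_push : {sigma_finite_measure set Y -> \bar R} := sfpush.

End SigmaFinitePush.

(* The canonical sigma-finite structure on products found by inference is the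
   one for finite factors. *)
Section SigmaFiniteProd.
Context d1 d2 (X : measurableType d1) (Y : measurableType d2) (R : realType).
Variables (mu : {sigma_finite_measure set X -> \bar R})
  (nu : {sigma_finite_measure set Y -> \bar R}).

Definition sfprod : set (X * Y) -> \bar R := (mu \x nu)%E.

HB.instance Definition _ := Measure.on sfprod.

Let sfprod_sigma_finite : sigma_finite [set: _] sfprod.
Proof.
have /sigma_finiteP[F [FT ndF Foo]] := sigma_finiteT mu.
have /sigma_finiteP[G [GT ndG Goo]] := sigma_finiteT nu.
exists (fun k => F k `*` G k).
  apply/seteqP; split => // -[x y] _.
  have [i _ Fi] : (\bigcup_k F k) x by rewrite -FT.
  have [j _ Gj] : (\bigcup_k G k) y by rewrite -GT.
  exists (maxn i j) => //; split.
    by move: Fi; apply/subsetPset/ndF/leq_maxl.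
  by move: Gj; apply/subsetPset/ndG/leq_maxr.
move=> k; have [mF Fk] := Foo k; have [mG Gk] := Goo k.
split; first exact: measurableX.
by rewrite /sfprod product_measure1E// lte_mul_pinfty// ge0_fin_numE.
Qed.

HB.instance Definition _ := Measure_isSigmaFinite.Build _ _ _ sfprod
  sfprod_sigma_finite.

End SigmaFiniteProd.

(** * Lebesgue measure under orthogonal maps, dilations and splittings of coordinates *)

Section LebesgueLinear.
Variable R : realType.
Local Notation mu n := (lebesgue_rV R n).

Lemma continuous_mulmxr m n p (M : 'M[R]_(n, p)) :
  continuous (fun x : 'M[R]_(m, n) => x *m M).
Proof.
have := @continuous_mulmx R 'M[R]_(m, n) m n p id (fun=> M).
by apply; [move=> x; exact: cvg_id|exact: cst_continuous].
Qed.

Lemma measurable_mulmxr m n p (M : 'M[R]_(n, p)) :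
  measurable_fun setT (fun x : 'M[R]_(m, n) => x *m M).
Proof. by apply: continuous_measurable_mx; exact: continuous_mulmxr. Qed.

Lemma measurable_scalemx n (a : R) :
  measurable_fun setT (fun x : 'rV[R]_n => a *: x).
Proof.
under eq_fun do rewrite -mul_mx_scalar; exact: measurable_mulmxr.
Qed.

Definition cube n (a : R) : set 'rV[R]_n := [set x | forall i, `[0, a]%classic (x ord0 i)].

Lemma measurable_cube n a : measurable (@cube n a).
Proof. by apply: (measurable_rV_box (A := fun=> `[0, a]%classic)) => i; exact: measurable_itv. Qed.

Lemma lebesgue_cube n a : 0 <= a -> mu n (cube a) = (a ^+ n)%:E.
Proof.
move=> a0; rewrite (lebesgue_rV_box (A := fun=> `[0, a]%classic)); last by move=> i; exact: measurable_itv.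
rewrite (eq_bigr (fun=> a%:E)); last first.
  move=> i _; rewrite lebesgue_measure_itv/= lte_fin oppr0 adde0.
  by case: ltgtP a0 => // <-.
elim: n => [|n IH]; first by rewrite big_ord0.
by rewrite big_ord_recl IH -EFinM exprS.
Qed.

(** Uniqueness of Haar measure on R^n, normalised on the unit cube, whose Lebesgue measure is 1. *)
Lemma preserves_uniq_cube n (nu : {sigma_finite_measure set 'rV[R]_n -> \bar R}) :
  (forall (a : 'rV[R]_n) (D : set 'rV[R]_n), measurable D ->
    nu [set x | D (x + a)] = nu D) ->
  forall A, measurable A -> nu A = (nu (cube 1) * mu n A)%E.
Proof.
move=> nuT A mA.
have := translation_invariant_uniq nuT mA (@measurable_cube n 1).
by rewrite lebesgue_cube// expr1n mul1e => <-; rewrite muleC.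
Qed.

Definition ortho_mx n (U : 'M[R]_n) := U *m U^T = 1%:M.

Lemma ortho_mxT n (U : 'M[R]_n) : ortho_mx U -> ortho_mx U^T.
Proof. by rewrite /ortho_mx trmxK => /mulmx1C. Qed.

Lemma ortho_mxM n (U V : 'M[R]_n) : ortho_mx U -> ortho_mx V -> ortho_mx (U *m V).
Proof.
by move=> oU oV; rewrite /ortho_mx trmx_mul mulmxA -(mulmxA U) oV mulmx1.
Qed.

Lemma ortho_mx1 n : ortho_mx (1%:M : 'M[R]_n).
Proof. by rewrite /ortho_mx trmx1 mulmx1. Qed.

Lemma dot_orthogonal n (U : 'M[R]_n) x y : ortho_mx U -> dot (x *m U) (y *m U) = dot x y.
Proof. by move=> oU; rewrite !dotE trmx_mul mulmxA -(mulmxA x) oU mulmx1. Qed.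

Lemma dotC n (x y : 'rV[R]_n) : dot x y = dot y x.
Proof. by apply: eq_bigr => i _; rewrite mulrC. Qed.

Lemma dotDl n (x y z : 'rV[R]_n) : dot (x + y) z = dot x z + dot y z.
Proof. by rewrite -big_split; apply: eq_bigr => i _ /=; rewrite mxE mulrDl. Qed.

Lemma dotZl n a (x z : 'rV[R]_n) : dot (a *: x) z = a * dot x z.
Proof. by rewrite mulr_sumr; apply: eq_bigr => i _ /=; rewrite mxE mulrA. Qed.

Lemma dotDr n (x y z : 'rV[R]_n) : dot z (x + y) = dot z x + dot z y.
Proof. by rewrite !(dotC z) dotDl. Qed.

Lemma dotZr n a (x z : 'rV[R]_n) : dot z (a *: x) = a * dot z x.
Proof. by rewrite !(dotC z) dotZl. Qed.

Lemma dotNl n (x z : 'rV[R]_n) : dot (- x) z = - dot x z.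
Proof. by rewrite -scaleN1r dotZl mulN1r. Qed.

Lemma dotNr n (x z : 'rV[R]_n) : dot z (- x) = - dot z x.
Proof. by rewrite !(dotC z) dotNl. Qed.

Lemma dot0l n (z : 'rV[R]_n) : dot 0 z = 0.
Proof. by rewrite -(scale0r 0) dotZl mul0r. Qed.

Lemma dot0r n (z : 'rV[R]_n) : dot z 0 = 0.
Proof. by rewrite dotC dot0l. Qed.

Lemma dot_ge0 n (x : 'rV[R]_n) : 0 <= dot x x.
Proof. by apply: sumr_ge0 => i _; rewrite -expr2 sqr_ge0. Qed.

Lemma dot_gt0 n (x : 'rV[R]_n) : x != 0 -> 0 < dot x x.
Proof.
move=> x0; rewrite lt_def dot_ge0 andbT; apply: contra x0 => /eqP x0.
by rewrite (dot_eq0 x0).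
Qed.

Definition rball n (r : R) : set 'rV[R]_n := [set x | dot x x <= r ^+ 2].

Lemma eballE n : @eball R n = rball 1.
Proof. by rewrite /rball expr1n. Qed.

Lemma le_coord_dot n (x : 'rV[R]_n) i : x ord0 i ^+ 2 <= dot x x.
Proof.
rewrite /dot (bigD1 i)//= -expr2 lerDl; apply: sumr_ge0 => j _.
by rewrite -expr2 sqr_ge0.
Qed.

Lemma rball_coord n r (x : 'rV[R]_n) i : 0 <= r -> rball r x -> `|x ord0 i| <= r.
Proof.
move=> r0 xr; rewrite -(ler_pXn2r (_ : (0 < 2)%N))// ?nnegrE//.
by rewrite real_normK ?num_real//; exact: le_trans (le_coord_dot _ _) xr.
Qed.

Lemma cube_shift_rball n r (x : 'rV[R]_n) : 0 <= r -> rball r x ->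
  cube (r + r) (x + const_mx r).
Proof.
move=> r0 xr i /=; rewrite in_itv/= !mxE.
have := rball_coord i r0 xr; rewrite ler_norml => /andP[? ?]; lra.
Qed.

Lemma closed_rball n r : closed (@rball n r).
Proof.
have c : continuous (fun x : 'rV[R]_n => dot x x).
  by apply: continuous_dot => x; exact: cvg_id.
by have /continuous_closedP/(_ _ (@closed_le R (r ^+ 2))) := c.
Qed.

Lemma measurable_rball n r : measurable (@rball n r).
Proof. by apply: closed_measurable_mx; exact: closed_rball. Qed.

Lemma lebesgue_rball_lty n r : 0 <= r -> (mu n (rball r) < +oo)%E.
Proof.
move=> r0; apply: (@le_lt_trans _ _ (mu n [set x | cube (r + r) (x + const_mx r)])).
  apply: le_measure; rewrite ?inE; [exact: measurable_rball| |].
    by apply: measurable_translate; exact: measurable_cube.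
  by move=> x; exact: cube_shift_rball.
have /= -> := (preserves_translate (const_mx r : 'rV[R]_n)).2 _ (@measurable_cube n (r + r)).
by rewrite lebesgue_cube ?ltry// addr_ge0.
Qed.

Definition ebounded (n : nat) (A : set 'rV[R]_n) := exists2 r, 0 <= r & A `<=` rball r.

Lemma ebounded_lty n (A : set 'rV[R]_n) : measurable A -> ebounded A -> (mu n A < +oo)%E.
Proof.
move=> mA [r r0 Ar]; apply: le_lt_trans (lebesgue_rball_lty n r0).
by apply: le_measure; rewrite ?inE//; exact: measurable_rball.
Qed.

Lemma ebounded_fin n (A : set 'rV[R]_n) : measurable A -> ebounded A -> mu n A \is a fin_num.
Proof. by move=> mA wA; rewrite ge0_fin_numE// ebounded_lty. Qed.

Lemma eball_ebounded n : ebounded (@eball R n).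
Proof. by exists 1 => //; rewrite eballE. Qed.

Lemma measurable_eball n : measurable (@eball R n).
Proof. by rewrite eballE; exact: measurable_rball. Qed.

Lemma eball_fin n : mu n (@eball R n) \is a fin_num.
Proof. by apply: ebounded_fin; [exact: measurable_eball|exact: eball_ebounded]. Qed.

Lemma cube_eball n : cube n.+1%:R^-1 `<=` @eball R n.
Proof.
move=> x xc; rewrite /eball/=.
apply: (@le_trans _ _ (\sum_(i < n) n.+1%:R^-1)).
  apply: ler_sum => i _; have := xc i; rewrite /= in_itv/= => /andP[x0 x1].
  apply: le_trans x1; rewrite ler_piMr//; apply: le_trans (_ : n.+1%:R^-1 <= 1).
    by have := xc i; rewrite /= in_itv/= => /andP[].
  by rewrite invf_le1 ?ltr0n// ler1n.
rewrite sumr_const card_ord -[_ *+ n]mulr_natr ler_pdivrMl ?ltr0n// mulr1.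
by rewrite ler_nat.
Qed.

Lemma omegaE n : mu n (@eball R n) = (omega R n)%:E.
Proof. by rewrite /omega fineK// eball_fin. Qed.

Lemma omega_gt0 n : 0 < omega R n.
Proof.
rewrite -lte_fin -omegaE; apply: (@lt_le_trans _ _ (mu n (cube n.+1%:R^-1))).
  by rewrite lebesgue_cube// lte_fin exprn_gt0// invr_gt0 ltr0n.
by apply: le_measure; rewrite ?inE;
  [exact: measurable_cube|exact: measurable_eball|exact: cube_eball].
Qed.

(** No determinant is involved: the pushforward is again translation invariant, hence proportional
    to Lebesgue measure, and the factor is 1 because the unit ball is mapped to itself and has
    finite positive volume. *)
Lemma preserves_orthogonal n (U : 'M[R]_n) : ortho_mx U ->
  preserves (mu n) (mu n) (fun x => x *m U).
Proof.
move=> oU; have mU := @measurable_mulmxr 1 n n U.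
have UK : cancel (fun x : 'rV[R]_n => x *m U) (fun x => x *m U^T).
  by move=> x; rewrite -mulmxA oU mulmx1.
pose nu := sigma_finite_push (mu n) mU (@measurable_mulmxr 1 n n U^T) UK.
have nuE A : nu A = mu n ((fun x => x *m U) @^-1` A) by [].
have nuT (a : 'rV[R]_n) (D : set 'rV[R]_n) : measurable D -> nu [set x | D (x + a)] = nu D.
  move=> mD; rewrite !nuE.
  have mD' : measurable ((fun x => x *m U) @^-1` D).
    exact: measurable_preim mU mD.
  rewrite -((preserves_translate (a *m U^T)).2 _ mD'); congr (mu n _).
  by apply/seteqP; split => x /=; rewrite mulmxDl -mulmxA (mulmx1C oU) mulmx1.
split => // A mA; have := translation_invariant_uniq nuT mA (@measurable_eball n).
have -> : nu (@eball R n) = mu n (@eball R n).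
  by rewrite nuE; congr (mu n _); apply/seteqP; split => x; rewrite /eball /= dot_orthogonal.
rewrite omegaE muleC => /(congr1 (fun x => (omega R n)^-1%:E * x)%E).
rewrite !muleA -!EFinM mulVf ?mul1e ?gt_eqF ?omega_gt0// => ->.
Qed.

Lemma lebesgue_scale n (a : R) (A : set 'rV[R]_n) : 0 < a -> measurable A ->
  mu n [set x | A (a *: x)] = ((a ^- n)%:E * mu n A)%E.
Proof.
move=> a0 mA; have aN0 : a != 0 by rewrite gt_eqF.
have aK : cancel (fun x : 'rV[R]_n => a *: x) (fun x => a^-1 *: x).
  by move=> x; rewrite scalerA mulVf// scale1r.
pose nu := sigma_finite_push (mu n) (@measurable_scalemx n a) (@measurable_scalemx n a^-1) aK.
have nuE D : nu D = mu n ((fun x => a *: x) @^-1` D) by [].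
rewrite [LHS](_ : _ = nu A)// (@preserves_uniq_cube _ nu)//.
  congr (_ * _)%E; rewrite nuE (_ : _ @^-1` _ = cube a^-1).
    by rewrite lebesgue_cube ?exprVn// invr_ge0 ltW.
  apply/seteqP; split => x H i; have := H i; rewrite /= !in_itv/= mxE.
    by rewrite pmulr_rge0// -(ler_pM2l a0 _ a^-1) divff.
  by rewrite pmulr_rge0// -(ler_pM2l a0 _ a^-1) divff.
move=> b D mD; rewrite !nuE.
have mD' : measurable ((fun x : 'rV[R]_n => a *: x) @^-1` D).
  by apply: measurable_preim => //; exact: measurable_scalemx.
rewrite -((preserves_translate (a^-1 *: b)).2 _ mD'); congr (mu n _).
by apply/seteqP; split => x /=; rewrite scalerDr scalerA divff// scale1r.
Qed.

Lemma measurable_dilate n (a : R) (A : set 'rV[R]_n) : 0 < a -> measurable A ->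
  measurable (dilate a A).
Proof.
move=> a0 mA; have aN0 : a != 0 by rewrite gt_eqF.
rewrite (_ : dilate a A = (fun x => a^-1 *: x) @^-1` A).
  by apply: measurable_preim => //; exact: measurable_scalemx.
apply/seteqP; split => [_ [x Ax <-] /=|x /= Ax]; first by rewrite scalerA mulVf// scale1r.
by exists (a^-1 *: x) => //; rewrite scalerA divff// scale1r.
Qed.

Lemma lebesgue_dilate n (a : R) (A : set 'rV[R]_n) : 0 < a -> measurable A ->
  mu n (dilate a A) = ((a ^+ n)%:E * mu n A)%E.
Proof.
move=> a0 mA; have aN0 : a != 0 by rewrite gt_eqF.
have := lebesgue_scale (_ : 0 < a^-1) mA; rewrite invr_gt0 exprVn invrK => <- //.
congr (mu n _); apply/seteqP; split => [_ [x Ax <-] /=|x /= Ax]; first by rewrite scalerA mulVf// scale1r.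
by exists (a^-1 *: x) => //; rewrite scalerA divff// scale1r.
Qed.

(** [lebesgue_rV] splits off one coordinate at a time, so the splitting [m + k] does not hold by
    definition. Both measures are translation invariant and give mass 1 to the unit cube. *)
Lemma preserves_row_mx m k :
  preserves (mu m \x mu k)%E (mu (m + k)) (fun p => row_mx p.1 p.2).
Proof.
have mr : measurable_fun setT (fun p : 'rV[R]_m * 'rV[R]_k => row_mx p.1 p.2).
  by apply: measurable_fun_row_mx; [exact: measurable_fst|exact: measurable_snd].
have ml : measurable_fun setT (fun x : 'rV[R]_(m + k) => (lsubmx x, rsubmx x)).
  apply: measurable_fun_pair; apply: continuous_measurable_mx.
    by apply: continuous_lsubmx => x; exact: cvg_id.
  by apply: continuous_rsubmx => x; exact: cvg_id.
have rK : cancel (fun p : 'rV[R]_m * 'rV[R]_k => row_mx p.1 p.2)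
    (fun x : 'rV[R]_(m + k) => (lsubmx x, rsubmx x)).
  by case=> x y /=; rewrite row_mxKl row_mxKr.
pose nu := sigma_finite_push
  (sfprod (mu m) (mu k) : {sigma_finite_measure set ('rV[R]_m * 'rV[R]_k)%type -> \bar R}) mr ml rK.
have nuE D : nu D = (mu m \x mu k)%E ((fun p => row_mx p.1 p.2) @^-1` D) by [].
split => // A mA; rewrite [LHS](_ : _ = nu A)// (@preserves_uniq_cube _ nu)//.
  rewrite nuE (_ : _ @^-1` _ = cube 1 `*` cube 1).
    rewrite product_measure1E; [|exact: measurable_cube|exact: measurable_cube].
    have mc p : mu p (cube 1) = 1%E by rewrite lebesgue_cube// expr1n.
    by rewrite -[RHS]mul1e -[in RHS](mul1e 1); congr (_ * _ * _)%E; exact: mc.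
  apply/seteqP; split => -[x y] /=; rewrite /cube /=.
    move=> H; split => i.
      by have := H (lshift k i); rewrite row_mxEl.
    by have := H (rshift m i); rewrite row_mxEr.
  by move=> [Hx Hy] i; rewrite mxE; case: fintype.splitP.
move=> a D mD; rewrite !nuE.
have mD' : measurable ((fun p : 'rV[R]_m * 'rV[R]_k => row_mx p.1 p.2) @^-1` D).
  exact: measurable_preim mr mD.
have := (preserves_prod (preserves_translate (lsubmx a)) (preserves_translate (rsubmx a))).2 _ mD'.
move=> <-; congr ((_ \x _)%E _).
have aE x y : row_mx x y + a = row_mx (x + lsubmx a) (y + rsubmx a).
  by rewrite -{1}(hsubmxK a) add_row_mx.
by apply/seteqP; split => -[x y] /=; rewrite aE.
Qed.

Section RowMx.
Variables m k : nat.

Lemma measurable_row_slicel (A : set 'rV[R]_(m + k)) (y : 'rV[R]_k) :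
  measurable A -> measurable [set x : 'rV[R]_m | A (row_mx x y)].
Proof.
by move=> mA; exact: (measurable_slice2 y (measurable_preim (preserves_row_mx m k).1 mA)).
Qed.

Lemma measurable_row_slicer (A : set 'rV[R]_(m + k)) (x : 'rV[R]_m) :
  measurable A -> measurable [set y : 'rV[R]_k | A (row_mx x y)].
Proof.
by move=> mA; exact: (measurable_slice1 x (measurable_preim (preserves_row_mx m k).1 mA)).
Qed.

Lemma measurable_row_voll (A : set 'rV[R]_(m + k)) : measurable A ->
  measurable_fun setT (fun y : 'rV[R]_k => mu m [set x : 'rV[R]_m | A (row_mx x y)]).
Proof.
move=> mA.
exact: (measurable_vol2 (mu m) (measurable_preim (preserves_row_mx m k).1 mA)).
Qed.

Lemma lebesgue_row_mxl (A : set 'rV[R]_(m + k)) : measurable A ->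
  mu (m + k) A = (\int[mu k]_y mu m [set x : 'rV[R]_m | A (row_mx x y)])%E.
Proof.
move=> mA; rewrite -(preserves_row_mx m k).2//.
exact: (prod_vol2 (mu m) (mu k) (measurable_preim (preserves_row_mx m k).1 mA)).
Qed.

Lemma lebesgue_row_mxr (A : set 'rV[R]_(m + k)) : measurable A ->
  mu (m + k) A = (\int[mu m]_x mu k [set y : 'rV[R]_k | A (row_mx x y)])%E.
Proof.
move=> mA; rewrite -(preserves_row_mx m k).2//.
exact: (prod_vol1 (mu m) (mu k) (measurable_preim (preserves_row_mx m k).1 mA)).
Qed.

Variable f : 'rV[R]_(m + k) -> \bar R.
Hypotheses (mf : measurable_fun setT f) (f0 : forall x, (0 <= f x)%E).

Let mfr : measurable_fun setT (fun p : 'rV[R]_m * 'rV[R]_k => f (row_mx p.1 p.2)).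
Proof. exact: measurableT_comp mf (preserves_row_mx m k).1. Qed.

Lemma integral_row_mxr :
  (\int[mu (m + k)]_z f z = \int[mu m]_x \int[mu k]_y f (row_mx x y))%E.
Proof.
rewrite -(preserves_integral (mu := sfprod (mu m) (mu k)) (preserves_row_mx m k))//.
exact: (fubini_tonelli1 (m1 := mu m) (m2 := mu k) _ mfr (fun p => f0 _)).
Qed.

Lemma integral_row_mxl :
  (\int[mu (m + k)]_z f z = \int[mu k]_y \int[mu m]_x f (row_mx x y))%E.
Proof.
rewrite -(preserves_integral (mu := sfprod (mu m) (mu k)) (preserves_row_mx m k))//.
exact: (fubini_tonelli2 (m1 := mu m) (m2 := mu k) _ mfr (fun p => f0 _)).
Qed.

End RowMx.

End LebesgueLinear.

(** * Haar measure on the orthogonal group *)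

Section Householder.
Variables (R : realType) (n : nat).

Definition e0 : 'rV[R]_n.+1 := delta_mx 0 0.

Definition hvec (x : 'rV[R]_n.+1) : 'rV[R]_n.+1 := x - Num.sqrt (dot x x) *: e0.

(* Reflection exchanging [x] and [|x| e0]; it is the identity when
   [x = |x| e0], since then [hvec x = 0] and [0^-1 = 0]. *)
Definition householder (x : 'rV[R]_n.+1) : 'M[R]_n.+1 :=
  1%:M - (2 / dot (hvec x) (hvec x)) *: ((hvec x)^T *m hvec x).

Lemma dot_e0r (x : 'rV[R]_n.+1) : dot x e0 = x 0 0.
Proof.
rewrite /dot (bigD1 ord0)//= big1 ?addr0 => [|i i0]; last by rewrite mxE (negPf i0) mulr0.
by rewrite mxE !eqxx mulr1.
Qed.

Lemma dot_e0 : dot e0 e0 = 1.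
Proof. by rewrite dot_e0r mxE !eqxx. Qed.

Lemma householderT x : (householder x)^T = householder x.
Proof. by rewrite /householder linearB linearZ /= trmx1 trmx_mul trmxK. Qed.

Lemma mul_householder (x y : 'rV[R]_n.+1) :
  y *m householder x =
  y - (2 * dot y (hvec x) / dot (hvec x) (hvec x)) *: hvec x.
Proof.
rewrite mulmxBr mulmx1 -scalemxAr mulmxA.
have -> : y *m (hvec x)^T = (dot y (hvec x))%:M.
  by rewrite dotE [LHS]mx11_scalar.
by rewrite mul_scalar_mx scalerA mulrAC.
Qed.

Lemma householder_orthogonal x : ortho_mx (householder x).
Proof.
rewrite /ortho_mx householderT /householder; set v := hvec x; set P := v^T *m v.
have PP : P *m P = dot v v *: P.
  rewrite /P mulmxA -(mulmxA v^T) (mx11_scalar (v *m v^T)) -dotE.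
  by rewrite mul_mx_scalar -scalemxAl.
rewrite mulmxBl mul1mx mulmxBr mulmx1 -scalemxAl -scalemxAr PP !scalerA.
have [v0|v0] := eqVneq (dot v v) 0; first by rewrite v0 invr0 mulr0 !(scale0r, mulr0, mul0r, subr0).
rewrite (_ : 2 / dot v v * (2 / dot v v) * dot v v = 2 / dot v v + 2 / dot v v); last by field.
by rewrite scalerDl opprB [in X in _ + X]addrK subrK.
Qed.

Lemma householderE (x : 'rV[R]_n.+1) : x *m householder x = Num.sqrt (dot x x) *: e0.
Proof.
rewrite mul_householder; set s := Num.sqrt (dot x x).
have s2 : s * s = dot x x by rewrite -expr2 sqr_sqrtr// dot_ge0.
have [v0|v0] := eqVneq (dot (hvec x) (hvec x)) 0.
  by move/dot_eq0 : v0 => v0; rewrite v0 scaler0 subr0; apply/eqP; rewrite -subr_eq0; apply/eqP.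
have -> : 2 * dot x (hvec x) = dot (hvec x) (hvec x).
  rewrite /hvec -/s !(dotDl, dotDr, dotNl, dotNr, dotZl, dotZr) dot_e0 !dot_e0r (dotC e0) dot_e0r -s2.
  by ring.
by rewrite divff// scale1r /hvec -/s opprB addrC subrK.
Qed.

Lemma householder_e0 (x : 'rV[R]_n.+1) : x != 0 ->
  e0 *m householder x = (Num.sqrt (dot x x))^-1 *: x.
Proof.
move=> x0; have s0 : Num.sqrt (dot x x) != 0.
  by rewrite gt_eqF// sqrtr_gt0 dot_gt0.
have := householder_orthogonal x; rewrite /ortho_mx householderT => HH.
apply: (scalerI s0); rewrite scalerA divff// scale1r scalemxAl -householderE.
by rewrite -mulmxA HH mulmx1.
Qed.

Lemma measurable_invr_ge0 d (T : measurableType d) (f : T -> R) :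
  (forall x, 0 <= f x) -> measurable_fun setT f -> measurable_fun setT (fun x => (f x)^-1).
Proof.
move=> f0 mf; rewrite (_ : (fun x => _) = (fun x => (f x) `^ (-1))).
  exact: (measurableT_comp (measurable_powR (-1)) mf).
by apply/funext => x; rewrite powR_inv1.
Qed.

Lemma measurable_dot m d (T : measurableType d) (f g : T -> 'rV[R]_m) :
  measurable_fun setT f -> measurable_fun setT g ->
  measurable_fun setT (fun x => dot (f x) (g x)).
Proof.
move=> mf mg; apply: measurable_sum => i.
by apply: measurable_funM; exact: measurable_mx_coordfun.
Qed.

Lemma measurable_householder : measurable_fun setT householder.
Proof.
have msq : measurable_fun setT (fun x : 'rV[R]_n.+1 => Num.sqrt (dot x x)).
  apply: (measurableT_comp (f := @Num.sqrt R)).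
    by apply: continuous_measurable_fun; exact: sqrt_continuous.
  by apply: measurable_dot; exact: measurable_id.
have mv : measurable_fun setT hvec.
  apply: measurable_fun_mx => i j; under eq_fun do rewrite !mxE.
  apply: measurable_funB; first exact: measurable_mx_coord.
  by apply: measurable_funM => //; exact: measurable_cst.
have hE x i j : householder x i j =
    (i == j)%:R - 2 / dot (hvec x) (hvec x) * (hvec x 0 i * hvec x 0 j).
  by rewrite /householder; set v := hvec x; rewrite !mxE big_ord1 !mxE.
apply: measurable_fun_mx => i j; under eq_fun do rewrite hE.
apply: measurable_funB; first exact: measurable_cst.
apply: measurable_funM; last by apply: measurable_funM; exact: measurable_mx_coordfun mv.
apply: measurable_funM; first exact: measurable_cst.
by apply: measurable_invr_ge0 => [x|]; [exact: dot_ge0|exact: measurable_dot].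
Qed.

End Householder.

Section UniformBall.
Variables (R : realType) (n : nat).

Lemma omegaV_ge0 : 0 <= (omega R n)^-1.
Proof. by rewrite invr_ge0 ltW// omega_gt0. Qed.

(** It stands for a random direction: away from the origin [householder x] depends only on the
    direction of [x], so no surface measure on the sphere is needed. *)
Definition unifball : set 'rV[R]_n -> \bar R :=
  mscale (NngNum omegaV_ge0) (mrestr (lebesgue_rV R n) (@measurable_eball R n)).

HB.instance Definition _ := Measure.on unifball.

Let unifballT : unifball setT = 1%E.
Proof.
have -> : unifball setT = ((omega R n)^-1%:E * lebesgue_rV R n (setT `&` @eball R n))%E by [].
rewrite setTI omegaE -EFinM mulVf//.
by rewrite gt_eqF// omega_gt0.
Qed.

HB.instance Definition _ := Measure_isProbability.Build _ _ _ unifball unifballT.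

Lemma preserves_unifball (U : 'M[R]_n) : ortho_mx U ->
  preserves unifball unifball (fun x => x *m U).
Proof.
move=> oU; have [mU HU] := preserves_orthogonal oU; split => // A mA.
rewrite /unifball /mscale /mrestr; congr (_ * _)%E.
transitivity (lebesgue_rV R n ((fun x => x *m U) @^-1` (A `&` @eball R n))).
  rewrite /mrestr; congr (lebesgue_rV R n _); apply/seteqP.
  by split => x; rewrite /eball /= dot_orthogonal.
by apply: HU; apply: measurableI => //; exact: measurable_eball.
Qed.

End UniformBall.

Lemma lebesgue_rV_set0 (R : realType) n : lebesgue_rV R n.+1 [set 0] = 0%E.
Proof.
have -> : [set 0] = [set x : 'rV[R]_n.+1 | forall i, [set 0] (x ord0 i)].
  apply/seteqP; split => x /= => [-> i|H]; first by rewrite mxE.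
  by apply/rowP => i; rewrite mxE H.
rewrite (lebesgue_rV_box (A := fun=> [set 0])) => [|i]; last exact: measurable_set1.
by rewrite big_ord_recl lebesgue_measure_set1 mul0e.
Qed.

Section Haar.
Variable R : realType.

Definition extend0 n (V : 'M[R]_n) : 'M[R]_n.+1 := block_mx (1%:M : 'M[R]_1) 0 0 V.

Lemma extend0_orthogonal n (V : 'M[R]_n) : ortho_mx V -> ortho_mx (extend0 V).
Proof.
move=> oV; rewrite /ortho_mx /extend0.
have -> : (block_mx (1%:M : 'M[R]_1) 0 0 V)^T = block_mx 1%:M 0 0 V^T.
  by apply: etrans (@tr_block_mx R 1 n 1 n _ _ _ _) _; rewrite !trmx0 trmx1.
apply: etrans (@mulmx_block R 1 n 1 n 1 n _ _ _ _ _ _ _ _) _.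
by rewrite !(mulmx0, mul0mx, addr0, add0r) mulmx1 oV; apply/esym; exact: (@scalar_mx_block R 1 n 1).
Qed.

Lemma extend0M n (V W : 'M[R]_n) : extend0 V *m extend0 W = extend0 (V *m W).
Proof.
rewrite /extend0; apply: etrans (@mulmx_block R 1 n 1 n 1 n _ _ _ _ _ _ _ _) _.
by rewrite !(mulmx0, mul0mx, addr0, add0r) mulmx1.
Qed.

Lemma e0E n : e0 R n = row_mx (1%:M : 'M[R]_1) 0.
Proof.
apply/rowP => i; rewrite !mxE; case: splitP => k ik.
  by rewrite (_ : i = 0) ?eqxx ?mxE ?ord1//; apply/val_inj; rewrite /= ik ord1.
by rewrite (negPf (_ : i != 0)) ?andbF ?mxE//; apply/eqP => i0; rewrite i0 in ik.
Qed.

(** By orthogonality the transpose fixes [e0] as well, so both the first row and the first column of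
    [G] are those of the identity. *)
Lemma extend0_fixing_e0 n (G : 'M[R]_n.+1) : ortho_mx G -> e0 R n *m G = e0 R n ->
  exists2 W : 'M[R]_n, ortho_mx W & G = extend0 W.
Proof.
move=> oG G0.
have G0' : e0 R n *m G^T = e0 R n by rewrite -{1}G0 -mulmxA oG mulmx1.
pose G' := G : 'M[R]_(1 + n).
have GE : G = block_mx (ulsubmx G') (ursubmx G') (dlsubmx G') (drsubmx G').
  by rewrite submxK.
have [ul ur] : ulsubmx G' = 1%:M /\ ursubmx G' = 0.
  apply: eq_row_mx; rewrite -[RHS]e0E -[RHS]G0 e0E [in RHS]GE.
  by apply/esym; apply: etrans (@mul_row_block R 1 1 n 1 n _ _ _ _ _ _) _; rewrite !mul1mx !mul0mx !addr0.
have [_ dl] : (ulsubmx G')^T = 1%:M /\ (dlsubmx G')^T = 0.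
  apply: eq_row_mx; rewrite -[RHS]e0E -[RHS]G0' e0E [in RHS]GE.
  have -> : (block_mx (ulsubmx G') (ursubmx G') (dlsubmx G') (drsubmx G'))^T =
     block_mx (ulsubmx G')^T (dlsubmx G')^T (ursubmx G')^T (drsubmx G')^T.
    exact: (@tr_block_mx R 1 n 1 n).
  by apply/esym; apply: etrans (@mul_row_block R 1 1 n 1 n _ _ _ _ _ _) _; rewrite !mul1mx !mul0mx !addr0.
have dl0 : dlsubmx G' = 0 by rewrite -[LHS]trmxK dl trmx0.
have GW : G = extend0 (drsubmx G') by rewrite {1}GE ul ur dl0.
exists (drsubmx G') => //.
have GT : G^T = extend0 (drsubmx G')^T.
  by rewrite {1}GW; apply: etrans (@tr_block_mx R 1 n 1 n _ _ _ _) _; rewrite !trmx0 trmx1.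
move: oG; rewrite /ortho_mx GT {1}GW extend0M => GG.
have : block_mx (1%:M : 'M[R]_1) 0 0 (drsubmx G' *m (drsubmx G')^T) = block_mx 1%:M 0 0 1%:M.
  by apply: etrans GG _; exact: (@scalar_mx_block R 1 n 1).
by case/eq_block_mx.
Qed.

Section step.
Variables (n : nat) (P : probability 'M[R]_n R).

(* The first row of a Haar distributed orthogonal matrix is a uniform direction;
   conditionally on it, the remaining rows are Haar distributed in the orthogonal
   hyperplane, which a Householder reflection identifies with [R^n]. *)
Definition haar_map (p : 'rV[R]_n.+1 * 'M[R]_n) : 'M[R]_n.+1 :=
  householder p.1 *m extend0 p.2.

Lemma measurable_extend0 : measurable_fun setT (@extend0 n).
Proof.
apply: measurable_fun_mx => i j; under eq_fun do rewrite !mxE.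
case: (@fintype.split 1 n i) => a; under eq_fun do rewrite !mxE;
  case: (@fintype.split 1 n j) => b; try exact: measurable_cst.
exact: measurable_mx_coord.
Qed.

Lemma measurable_haar_map : measurable_fun setT haar_map.
Proof.
apply: measurable_fun_mulmx.
  by apply: measurableT_comp; [exact: measurable_householder|exact: measurable_fst].
by apply: measurableT_comp; [exact: measurable_extend0|exact: measurable_snd].
Qed.

Definition haar_step : set 'M[R]_n.+1 -> \bar R :=
  pushforward (@unifball R n.+1 \x P)%E haar_map.

HB.instance Definition _ := Measure.copy haar_step
  (measure_function_pushforward__canonical__measure_function_Measure
    (@unifball R n.+1 \x P)%E measurable_haar_map).

Let haar_stepT : haar_step setT = 1%E.
Proof.
rewrite /haar_step /pushforward preimage_setT.
exact: (@probability_setT _ _ _ (@unifball R n.+1 \x P)%E).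
Qed.

HB.instance Definition _ := Measure_isProbability.Build _ _ _ haar_step haar_stepT.

End step.

Fixpoint haar n : probability 'M[R]_n R :=
  match n with
  | 0 => \d_(0 : 'M[R]_0)
  | n'.+1 => haar_step (haar n')
  end.

Lemma closed_set1_mx m n (x : 'M[R]_(m, n)) : closed [set x].
Proof.
by apply: accessible_closed_set1; apply: hausdorff_accessible; exact: norm_hausdorff.
Qed.

Definition On n : set 'M[R]_n := [set U | ortho_mx U].

Arguments On n : clear implicits.

Lemma measurable_On n : measurable (On n).
Proof.
apply: closed_measurable_mx.
have c : continuous (fun U : 'M[R]_n => U *m U^T).
  have idc : continuous (@id 'M[R]_n) by move=> x; exact: cvg_id.
  exact: continuous_mulmx idc (continuous_trmx idc).
by have /continuous_closedP/(_ _ (@closed_set1_mx n n 1%:M)) := c.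
Qed.

Lemma haarE n (A : set 'M[R]_n.+1) : measurable A ->
  haar n.+1 A = (\int[@unifball R n.+1]_x
    haar n [set V | A (householder x *m extend0 V)])%E.
Proof.
move=> mA; exact: (prod_vol1 (@unifball R n.+1) (haar n) (measurable_preim (@measurable_haar_map n) mA)).
Qed.

Lemma haar_On n : haar n (On n) = 1%E.
Proof.
elim: n => [|n IH].
  by rewrite /= diracE mem_set// /On /= /ortho_mx; apply/matrixP => -[].
rewrite haarE; last exact: measurable_On.
rewrite -[RHS](@probability_setT _ _ _ (@unifball R n.+1)) -[RHS]mul1e -integral_cst//.
apply: eq_integral => x _ /=; rewrite -IH; congr (haar n _).
apply/seteqP; split => V; rewrite /On /= => oV.
  have /extend0_fixing_e0[|W oW] : ortho_mx (extend0 V).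
  - have := ortho_mxM (ortho_mxT (householder_orthogonal x)) oV.
    by rewrite mulmxA (mulmx1C (householder_orthogonal x)) mul1mx.
  - rewrite e0E; apply: etrans (@mul_row_block R 1 1 n 1 n _ _ _ _ _ _) _.
    by rewrite !mul1mx !mul0mx !addr0.
  by case/(@eq_block_mx R 1 n 1 n _ _ _ _ _ _ _ _) => _ _ _ ->.
by apply: ortho_mxM; [exact: householder_orthogonal|exact: extend0_orthogonal].
Qed.

Lemma haar_integral_cst n c : (\int[haar n]_(U in On n) c = c)%E.
Proof.
rewrite [LHS]integral_cst; last exact: measurable_On.
by rewrite -[RHS]mule1; congr (_ * _)%E; exact: haar_On.
Qed.

(** With [y = x *m W^T], the matrix [householder y *m W *m householder x] fixes [e0], hence is
    [extend0 W']. So multiplication by [W] changes the direction [x] into [y], which the uniform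
    measure on the ball does not see, and multiplies the lower block by [W'], which the induction
    hypothesis absorbs. *)
Lemma haar_left n (W : 'M[R]_n) : ortho_mx W ->
  preserves (haar n) (haar n) (fun U => W *m U).
Proof.
have mW m (V : 'M[R]_m) : measurable_fun setT (fun U : 'M[R]_m => V *m U).
  by apply: measurable_fun_mulmx; [exact: measurable_cst|exact: measurable_id].
elim: n W => [|n IH] W oW.
  have -> : (fun U : 'M[R]_0 => W *m U) = id by apply/funext => x; rewrite [LHS]thinmx0 [RHS]thinmx0.
  by split => //; exact: measurable_id.
split; first exact: mW.
move=> A mA; rewrite !haarE//; last exact: measurable_preim (mW _ _) mA.
pose g x := haar n [set V | A (householder x *m extend0 V)].
have mg : measurable_fun setT g.
  exact: (measurable_vol1 (haar n) (measurable_preim (@measurable_haar_map n) mA)).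
have oWT := ortho_mxT oW.
rewrite -[RHS](preserves_integral (preserves_unifball oWT) mg)//.
(* The origin, where [householder] does not represent a direction, is a null set of the ball and is
   removed from both integrals. *)
have m0 : measurable [set 0 : 'rV[R]_n.+1].
  by apply: closed_measurable_mx; exact: closed_set1_mx.
have u0 : @unifball R n.+1 [set 0] = 0%E.
  have -> : @unifball R n.+1 [set 0] =
    ((omega R n.+1)^-1%:E * lebesgue_rV R n.+1 ([set 0%R] `&` @eball R n.+1))%E by [].
  rewrite (_ : lebesgue_rV R n.+1 _ = 0%E) ?mule0//.
  apply: (@subset_measure0 _ _ _ (lebesgue_rV R n.+1) _ [set 0]) => //.
  - by apply: measurableI => //; exact: measurable_eball.
  - exact: lebesgue_rV_set0.
have mgW : measurable_fun setT (fun x => g (x *m W^T)).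
  exact: measurableT_comp mg (preserves_unifball oWT).1.
rewrite [LHS](ge0_negligible_integral m0 _ _ _ u0)//; last first.
  exact: (measurable_vol1 (haar n) (measurable_preim (@measurable_haar_map n)
    (measurable_preim (mW _ W) mA))).
rewrite [RHS](ge0_negligible_integral m0 _ _ _ u0)//.
apply: eq_integral => x; rewrite inE => -[_ /eqP x0].
pose y := x *m W^T; pose G := householder y *m (W *m householder x).
have y0 : y != 0.
  apply: contra x0 => /eqP y0; rewrite -[x]mulmx1 -(mulmx1C oW) mulmxA.
  by rewrite -/y y0 mul0mx.
have Hy := householder_orthogonal y; have Hx := householder_orthogonal x.
have oG : ortho_mx G by apply: ortho_mxM => //; exact: ortho_mxM.
have [|W' oW' GW] := extend0_fixing_e0 oG.
  rewrite /G mulmxA householder_e0// -scalemxAl /y mulmxA -(mulmxA x).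
  rewrite (mulmx1C oW) mulmx1 householderE scalerA dot_orthogonal; last exact: ortho_mxT.
  by rewrite mulVf ?scale1r// gt_eqF// sqrtr_gt0 dot_gt0.
have E V : W *m (householder x *m extend0 V) = householder y *m extend0 (W' *m V).
  rewrite -extend0M -GW /G !mulmxA.
  by move: Hy; rewrite /ortho_mx householderT => ->; rewrite mul1mx.
rewrite /g -/y -[RHS](IH _ oW').2; last first.
  exact: (measurable_slice1 y (measurable_preim (@measurable_haar_map n) mA)).
congr (haar n _); apply/seteqP; split => V /=; rewrite E//.
Qed.

Section HaarIntegral.
Variables (n : nat) (f : 'M[R]_n -> \bar R).
Hypotheses (mf : measurable_fun setT f) (f0 : forall U, (0 <= f U)%E).
Local Open Scope ereal_scope.

Lemma haar_integral_On : \int[haar n]_U f U = \int[haar n]_(U in On n) f U.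
Proof.
have mO := @measurable_On n.
rewrite (ge0_negligible_integral (measurableC mO) _ _ _ _)//.
  by rewrite setTD setCK.
transitivity (1 - haar n (On n)); first exact: probability_setC.
by rewrite haar_On subee.
Qed.

Lemma haar_integral_left W : ortho_mx W -> \int[haar n]_U f (W *m U) = \int[haar n]_U f U.
Proof. by move=> oW; exact: (preserves_integral (haar_left oW)). Qed.
End HaarIntegral.

Lemma measurable_trmx m n : measurable_fun setT (fun U : 'M[R]_(m, n) => U^T).
Proof.
by apply: measurable_fun_mx => i j; under eq_fun do rewrite mxE; exact: measurable_mx_coord.
Qed.

Section HaarIntegral2.
Variables (n : nat) (f : 'M[R]_n -> \bar R).
Hypotheses (mf : measurable_fun setT f) (f0 : forall U, (0 <= f U)%E).
Local Open Scope ereal_scope.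

(** Average [f (V^T *m U)] over both matrices. Integrating over [U] first, left invariance removes
    [V^T]; integrating over [V] first, the argument is the transpose of [U^T *m V], and left
    invariance removes [U^T]. *)
Lemma haar_integral_trmx : \int[haar n]_U f U^T = \int[haar n]_U f U.
Proof.
pose F (p : 'M[R]_n * 'M[R]_n) := f (p.1^T *m p.2)%R.
have mF : measurable_fun setT F.
  apply: measurableT_comp mf _; apply: measurable_fun_mulmx; last exact: measurable_snd.
  by apply: measurableT_comp; [exact: measurable_trmx|exact: measurable_fst].
have F0 p : 0 <= F p by exact: f0.
have mfT : measurable_fun setT (fun U => f U^T) by exact: measurableT_comp mf (@measurable_trmx n n).
have E1 : \int[haar n]_V \int[haar n]_U F (V, U) = \int[haar n]_U f U.
  rewrite haar_integral_On//; last 2 first.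
  - exact: measurable_fun_fubini_tonelli_F.
  - by move=> V; exact: integral_ge0.
  rewrite (eq_integral (fun=> \int[haar n]_U f U)) => [|V]; last first.
    by rewrite inE => oV; rewrite /F /= haar_integral_left//; exact: ortho_mxT.
  exact: haar_integral_cst.
rewrite -E1 (fubini_tonelli (m1 := haar n) (m2 := haar n) F mF F0).
rewrite [RHS]haar_integral_On//; last 2 first.
- exact: measurable_fun_fubini_tonelli_G.
- by move=> V; exact: integral_ge0.
rewrite [RHS](eq_integral (fun=> \int[haar n]_U f U^T)) => [|V]; last first.
  rewrite inE => oV; rewrite /F /=.
  rewrite -[RHS](haar_integral_left mfT (fun U => f0 _) (ortho_mxT oV)).
  by apply: eq_integral => U _; rewrite trmx_mul trmxK.
by apply/esym; exact: haar_integral_cst.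
Qed.

End HaarIntegral2.

(** Transposition turns right multiplication into left multiplication. *)
Lemma haar_integral_right n (f : 'M[R]_n -> \bar R) W :
  measurable_fun setT f -> (forall U, (0 <= f U)%E) -> ortho_mx W ->
  (\int[haar n]_U f (U *m W) = \int[haar n]_U f U)%E.
Proof.
move=> mf f0 oW.
have mfW : measurable_fun setT (fun U => f (U *m W)).
  by apply: measurableT_comp mf _; exact: measurable_mulmxr.
have mfT : measurable_fun setT (fun U => f U^T) by exact: measurableT_comp mf (@measurable_trmx n n).
rewrite -(haar_integral_trmx mfW)// -(haar_integral_trmx mf)//.
rewrite -[RHS](haar_integral_left mfT (fun U => f0 _) (ortho_mxT oW)).
by apply: eq_integral => U _; rewrite trmx_mul trmxK.
Qed.

End Haar.
Arguments On : clear implicits.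

(** * Convex sets and the Brunn-Minkowski inequality *)

Section ConvexSets.
Variable R : realType.

Definition cvx n (A : set 'rV[R]_n) := forall x y t, A x -> A y -> 0 <= t -> t <= 1 ->
  A ((1 - t) *: x + t *: y).

Lemma convex_set_cvx n (A : set 'rV[R]_n) : convex_set A -> cvx A.
Proof.
move=> cA x y t Ax Ay t0 t1.
pose p : {i01 R} := Itv01 t0 t1.
have := cA y x p; rewrite !inE => /(_ Ay Ax) H.
by rewrite addrC; exact: H.
Qed.

Lemma continuous_within (T U : topologicalType) (A : set T) (f : T -> U) :
  continuous f -> {within A, continuous f}.
Proof. by move=> cf; exact: continuous_subspaceT. Qed.

Lemma compact_closed_rV n (A : set 'rV[R]_n) : compact A -> closed A.
Proof. by apply: compact_closed; exact: norm_hausdorff. Qed.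

Lemma compact_mx_measurable n (A : set 'rV[R]_n) : compact A -> measurable A.
Proof. by move=> /compact_closed_rV; exact: closed_measurable_mx. Qed.

Lemma norm_coord n (x : 'rV[R]_n) i : `|x ord0 i| <= `|x|.
Proof.
rewrite [leRHS]/Num.norm /= mx_normrE; apply/bigmax_geP; right => /=.
by exists (ord0, i).
Qed.

Lemma compact_ebounded n (A : set 'rV[R]_n) : compact A -> ebounded A.
Proof.
move=> /compact_bounded [M [Mr MA]].
have M1 : M < `|M| + 1 by rewrite ltr_pwDr// ler_norm.
have s0 : 0 <= \sum_(i < n) (`|M| + 1) ^+ 2 by apply: sumr_ge0 => i _; rewrite sqr_ge0.
exists (Num.sqrt (\sum_(i < n) (`|M| + 1) ^+ 2)) => // x Ax.
rewrite /rball/= sqr_sqrtr//; apply: ler_sum => i _.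
rewrite -expr2 -[X in X <= _]real_normK ?num_real//.
rewrite ler_pXn2r ?nnegrE ?addr_ge0//.
exact: le_trans (norm_coord _ _) (MA _ M1 _ Ax).
Qed.

Lemma closed_ebounded_compact n (A : set 'rV[R]_n) : closed A -> ebounded A -> compact A.
Proof.
move=> cA [r r0 Ar]; apply: bounded_closed_compact => //.
exists r; split; first exact: num_real.
move=> M rM x /Ar xr /=; rewrite [leLHS]/Num.norm /= mx_normrE; apply/bigmax_leP.
split; first exact: ltW (le_lt_trans r0 rM).
by move=> [i j] _ /=; rewrite ord1; apply: le_trans (ltW rM); exact: rball_coord.
Qed.

Lemma image_compact n m (f : 'rV[R]_n -> 'rV[R]_m) (A : set 'rV[R]_n) :
  continuous f -> compact A -> compact (f @` A).
Proof. by move=> cf; apply: continuous_compact; exact: continuous_within. Qed.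

Lemma minkowski_compact n (A B : set 'rV[R]_n) :
  compact A -> compact B -> compact (minkowski_sum A B).
Proof.
move=> cA cB.
have -> : minkowski_sum A B = (fun p => p.1 + p.2) @` (A `*` B).
  apply/seteqP; split => [_ [x Ax [y By <-]]|_ [[x y] [/= Ax By] <-]].
    by exists (x, y).
  by exists x => //; exists y.
apply: continuous_compact; last exact: compact_setX.
apply: continuous_within; apply: continuous_addmx => -[x y].
  exact: cvg_fst.
exact: cvg_snd.
Qed.

Lemma minkowski_cvx n (A B : set 'rV[R]_n) : cvx A -> cvx B -> cvx (minkowski_sum A B).
Proof.
move=> cA cB _ _ t [x Ax [y By <-]] [x' Ax' [y' By' <-]] t0 t1.
exists ((1 - t) *: x + t *: x'); first exact: cA.
exists ((1 - t) *: y + t *: y'); first exact: cB.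
by rewrite !scalerDr addrACA.
Qed.

Lemma dilate_compact n a (A : set 'rV[R]_n) : compact A -> compact (dilate a A).
Proof.
apply: image_compact; rewrite (_ : (fun x => _) = fun x => x *m a%:M).
  exact: continuous_mulmxr.
by apply/funext => x; rewrite mul_mx_scalar.
Qed.

Lemma dilate_cvx n a (A : set 'rV[R]_n) : cvx A -> cvx (dilate a A).
Proof.
move=> cA _ _ t [x Ax <-] [y Ay <-] t0 t1; exists ((1 - t) *: x + t *: y); first exact: cA.
by rewrite scalerDr !scalerA ![a * _]mulrC.
Qed.

Lemma eball_compact n : compact (@eball R n).
Proof.
by apply: closed_ebounded_compact; [rewrite eballE; exact: closed_rball|exact: eball_ebounded].
Qed.

Lemma dot_cauchy n (x y : 'rV[R]_n) : dot x y ^+ 2 <= dot x x * dot y y.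
Proof.
have [/eqP y0|y0] := eqVneq (dot y y) 0.
  by move/eqP/dot_eq0: y0 => ->; rewrite !dot0r expr0n mulr0.
have yy : 0 < dot y y by rewrite lt_def y0 dot_ge0.
have := dot_ge0 (dot y y *: x - dot x y *: y).
rewrite !(dotDl, dotDr, dotNl, dotNr, dotZl, dotZr) (dotC y x) => H.
rewrite -subr_ge0 -(pmulr_rge0 _ yy).
by rewrite (_ : _ * (_ - _) = dot y y * (dot y y * dot x x) - dot y y * (dot x y * dot x y) -
   dot x y * (dot y y * dot x y) + dot x y * (dot x y * dot y y)) in H *; [lra|ring].
Qed.

Definition enorm n (x : 'rV[R]_n) := Num.sqrt (dot x x).

Lemma enorm_sq n (x : 'rV[R]_n) : enorm x ^+ 2 = dot x x.
Proof. by rewrite sqr_sqrtr// dot_ge0. Qed.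

Lemma enorm_ge0 n (x : 'rV[R]_n) : 0 <= enorm x.
Proof. exact: sqrtr_ge0. Qed.

Lemma dot_le n (x y : 'rV[R]_n) : `|dot x y| <= enorm x * enorm y.
Proof.
rewrite -(ler_pXn2r (_ : (0 < 2)%N))// ?nnegrE ?mulr_ge0 ?enorm_ge0//.
by rewrite real_normK ?num_real// exprMn !enorm_sq dot_cauchy.
Qed.

Lemma eball_cvx n : cvx (@eball R n).
Proof.
move=> x y t; rewrite /eball/= => x1 y1 t0 t1.
rewrite !(dotDl, dotDr, dotZl, dotZr) (dotC y x).
have xy : dot x y <= 1.
  apply: le_trans (ler_norm _) _; apply: le_trans (dot_le _ _) _.
  have e1 (z : 'rV[R]_n) : dot z z <= 1 -> enorm z <= 1.
    by move=> z1; rewrite -(ler_pXn2r (_ : (0 < 2)%N))// ?nnegrE ?enorm_ge0// expr1n enorm_sq.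
  by rewrite -[leRHS]mulr1 ler_pM ?enorm_ge0 ?e1.
have s0 : 0 <= 1 - t by rewrite subr_ge0.
have := mulr_ge0 (mulr_ge0 s0 s0) (_ : 0 <= 1 - dot x x).
have := mulr_ge0 (mulr_ge0 s0 t0) (_ : 0 <= 1 - dot x y).
have := mulr_ge0 (mulr_ge0 t0 t0) (_ : 0 <= 1 - dot y y).
rewrite !subr_ge0 => /(_ y1) h1 /(_ xy) h2 /(_ x1) h3; lra.
Qed.

(** First-order condition at a minimum: the derivative of the squared norm at [v] in the direction
    [- w] is [-2 * dot v w]. *)
Lemma dot_le0_perturb n (v w : 'rV[R]_n) :
  (forall t, 0 < t -> t <= 1 -> dot v v <= dot (v - t *: w) (v - t *: w)) ->
  dot v w <= 0.
Proof.
move=> vw; have H t : 0 < t -> t <= 1 -> 2 * dot v w <= t * dot w w.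
  move=> t0 t1; have := vw t t0 t1.
  rewrite !(dotDl, dotDr, dotNl, dotNr, dotZl, dotZr) (dotC w v) => H.
  rewrite -(ler_pM2l t0); lra.
rewrite leNgt; apply/negP => vw0.
have w0 : 0 <= dot w w by exact: dot_ge0.
(* This [t] makes [t * dot w w] smaller than [dot v w], which contradicts [H]; the added 1 covers
   [w = 0]. *)
pose t := Num.min 1 (dot v w / (dot w w + 1)).
have t0 : 0 < t by rewrite lt_min ltr01 divr_gt0// ltr_wpDl.
have t1 : t <= 1 by rewrite ge_min lexx.
have := H _ t0 t1.
have : t * (dot w w + 1) <= dot v w.
  by rewrite -ler_pdivlMr ?ltr_wpDl// ge_min lexx orbT.
lra.
Qed.

(** The normal is [z - p] with [p] the point of [A] nearest to [z]; moving from [p] towards a point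
    of [A] cannot decrease the distance. *)
Lemma separation n (A : set 'rV[R]_n) z : compact A -> cvx A -> A !=set0 -> ~ A z ->
  exists v c, (forall x, A x -> dot v x <= c) /\ c < dot v z.
Proof.
move=> cA vA A0 Az.
have cf : continuous (fun x : 'rV[R]_n => dot (z - x) (z - x)).
  have c1 : continuous (fun x : 'rV[R]_n => z - x).
    by apply: continuous_submx; [exact: cst_continuous|move=> x; exact: cvg_id].
  exact: continuous_dot.
have [p] := EVT_min_rV A0 cA (continuous_within cf).
rewrite inE => Ap pmin; exists (z - p), (dot (z - p) p); split; last first.
  rewrite -subr_gt0 -dotNr -dotDr addrC; apply: dot_gt0.
  by rewrite addrC subr_eq0; apply: contra_notN Az => /eqP ->.
move=> x Ax; rewrite -subr_le0 -dotNr -dotDr; apply: dot_le0_perturb => t t0 t1.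
have := pmin ((1 - t) *: p + t *: x).
rewrite inE => /(_ (vA _ _ _ Ap Ax (ltW t0) t1)).
by congr (_ <= dot _ _); apply/rowP => i; rewrite !mxE; ring.
Qed.

End ConvexSets.

(** * One-dimensional ingredients of the Brunn-Minkowski inequality *)

Section OneDimensional.
Variable R : realType.
Local Notation leb := (@lebesgue_measure R).
Local Notation RM := (measurableTypeR R).

Lemma measurable_le_level (f : RM -> \bar R) (p : R) :
  measurable_fun setT f ->
  measurable [set q : RM * RM | 0 < q.1 < 1 /\ ((q.1 * p)%:E <= f q.2)%E].
Proof.
move=> mf.
rewrite (_ : [set _ | _] = (fst @^-1` `]0, 1[) `&`
    [set q : RM * RM | ((q.1 * p)%:E <= f q.2)%E]); last first.
  by apply/seteqP; split => q /=; rewrite in_itv.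
apply: measurableI; first exact: measurable_preim measurable_fst (measurable_itv _).
rewrite -[X in measurable X]setTI; apply: measurable_lee => //.
  apply/measurable_EFinP; apply: measurable_funM; last exact: measurable_cst.
  exact: measurable_fst.
exact: measurableT_comp mf measurable_snd.
Qed.

(** Layer-cake formula: both sides measure the region [r * p <= f s], [0 < r < 1], by integrating in
    either order. Levels are taken relative to [p], so that level sets of functions with different
    maxima can be compared at the same [r]. *)
Lemma integral_min_level (f : RM -> \bar R) (p : R) : 0 < p ->
  measurable_fun setT f -> (forall x, 0 <= f x)%E ->
  (p%:E * \int[leb]_(r in `]0%R, 1%R[) leb [set s | (r * p)%:E <= f s] =
   \int[leb]_s mine (f s) p%:E)%E.
Proof.
move=> p0 mf f0; have mE := measurable_le_level p mf.
have E1 : (\int[leb]_(r in `]0%R, 1%R[) leb [set s | (r * p)%:E <= f s] =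
   \int[leb]_r leb [set s | (0 < r < 1)%R /\ (r * p)%:E <= f s])%E.
  rewrite integral_mkcond; apply: eq_integral => r _; rewrite patchE.
  case: ifPn => [|] rI.
    congr (leb _); apply/seteqP; split => s /= => [|[]//].
    by split => //; rewrite inE/= in_itv/= in rI.
  rewrite (_ : [set s | _] = set0) ?measure0//; apply/seteqP; split => s //= -[r01 _].
  by move: rI; rewrite notin_setE /= in_itv/= => /negP; rewrite r01.
rewrite E1 -(prod_vol1 leb leb mE) (prod_vol2 leb leb mE) -ge0_integralZl//; last 2 first.
- exact: measurable_vol2 mE.
- by rewrite lee_fin ltW.
apply: eq_integral => s _ /=.
have x0 := f0 s; move: (f s) x0 => [x| |] //= x0.
- rewrite lee_fin in x0.
  have [px|xp] := leP p x.
    rewrite (_ : [set x0 | _] = `]0, 1[%classic); last first.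
      apply/seteqP; split => r /=; rewrite in_itv/=; first by case.
      move=> r01; split => //.
      by rewrite lee_fin (le_trans _ px)// ler_piMl ?(ltW p0)//; case/andP: r01 => _ /ltW.
    rewrite lebesgue_measure_itv/= lte_fin ltr01 oppr0 adde0 mule1.
    by rewrite /Order.min /= lte_fin ltNge px.
  rewrite (_ : [set x0 | _] = `]0, (x / p)]%classic); last first.
    apply/seteqP; split => r /=; rewrite !in_itv/= lee_fin -ler_pdivlMr//.
      by move=> [/andP[-> _] ->].
    move=> /andP[r0 rx]; rewrite r0 rx; split => //=.
    by apply: le_lt_trans rx _; rewrite ltr_pdivrMr// mul1r.
  rewrite lebesgue_measure_itv/= !lte_fin oppr0 adde0 /Order.min /= lte_fin xp.
  case: ifPn => [_|]; first by rewrite -EFinM mulrCA divff ?mulr1// gt_eqF.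
  rewrite -leNgt pmulr_lle0 ?invr_gt0// => x0'.
  by rewrite mule0 (_ : x = 0)//; apply/eqP; rewrite eq_le x0' x0.
- rewrite (_ : [set x1 | _] = `]0, 1[%classic); last first.
    apply/seteqP; split => r /=; rewrite in_itv/=; first by case.
    by move=> r01; split => //; rewrite leey.
  by rewrite lebesgue_measure_itv/= lte_fin ltr01 oppr0 adde0 mule1 /Order.min /=.
Qed.

(** The sets are intervals whose end points need not belong to them, so only the open interval
    between the combined end points is shown to lie in [D], which has the same length. *)
Lemma lebesgue_interval_add (I J D : set RM) (t r : R) :
  0 < t -> t < 1 -> measurable I -> measurable J -> measurable D ->
  I !=set0 -> J !=set0 -> (forall x, I x -> `|x| <= r) -> (forall x, J x -> `|x| <= r) ->
  (forall x y a, I x -> I y -> 0 <= a -> a <= 1 -> I ((1 - a) * x + a * y)) ->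
  (forall x y a, J x -> J y -> 0 <= a -> a <= 1 -> J ((1 - a) * x + a * y)) ->
  (forall x y, I x -> J y -> D ((1 - t) * x + t * y)) ->
  ((1 - t)%:E * leb I + t%:E * leb J <= leb D)%E.
Proof.
move=> t0 t1 mI mJ mD I0 J0 Ir Jr cI cJ IJD.
have hub (A : set R) : (forall x, A x -> `|x| <= r) -> has_ubound A.
  by move=> H; exists r => x /H; rewrite ler_norml => /andP[].
have hlb (A : set R) : (forall x, A x -> `|x| <= r) -> has_lbound A.
  by move=> H; exists (- r) => x /H; rewrite ler_norml => /andP[].
have len (A : set RM) : measurable A -> A !=set0 -> (forall x, A x -> `|x| <= r) ->
    (leb A <= (sup A - inf A)%:E)%E.
  move=> mA [a Aa] Ar.
  have infsup : inf A <= sup A.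
    by apply: (@le_trans _ _ a); [exact: ge_inf (hlb _ Ar) _ Aa|exact: ub_le_sup (hub _ Ar) _ Aa].
  apply: (@le_trans _ _ (leb `[inf A, sup A])).
    apply: le_measure; rewrite ?inE//=.
    move=> x Ax /=; rewrite in_itv/=.
    by rewrite (ge_inf (hlb _ Ar) Ax) (ub_le_sup (hub _ Ar) Ax).
  rewrite lebesgue_measure_itv/= lte_fin; case: ifPn => [_|]; first by rewrite EFinB.
  by rewrite lee_fin subr_ge0.
have t0' : 0 <= 1 - t by rewrite subr_ge0 ltW.
apply: (@le_trans _ _ ((1 - t) * (sup I - inf I) + t * (sup J - inf J))%:E).
  rewrite [leRHS]EFinD (EFinM (1 - t)) (EFinM t); apply: leeD.
    by apply: lee_wpmul2l; [rewrite lee_fin|exact: len].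
  by apply: lee_wpmul2l; [rewrite lee_fin ltW|exact: len].
pose lo := (1 - t) * inf I + t * inf J; pose hi := (1 - t) * sup I + t * sup J.
apply: (@le_trans _ _ (leb `]lo, hi[)).
  rewrite lebesgue_measure_itv/= lte_fin; case: ifPn => [_|].
    by rewrite -EFinB lee_fin /lo /hi; lra.
  by rewrite -leNgt lee_fin /lo /hi; lra.
apply: le_measure; rewrite ?inE//=.
move=> z /=; rewrite in_itv/= => /andP[loz zhi].
have hz : 0 < hi - z by rewrite subr_gt0.
have lz : 0 < z - lo by rewrite subr_gt0.
(* The same tolerance [hi - z] may be spent in both [I] and [J], because the weights [1 - t] and [t]
   add up to 1. *)
have [i2 Ii2 i2s] := sup_adherent hz (conj I0 (hub _ Ir)).
have [j2 Jj2 j2s] := sup_adherent hz (conj J0 (hub _ Jr)).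
have [i1 Ii1 i1s] := inf_adherent lz (conj I0 (hlb _ Ir)).
have [j1 Jj1 j1s] := inf_adherent lz (conj J0 (hlb _ Jr)).
pose a1 := (1 - t) * i1 + t * j1; pose a2 := (1 - t) * i2 + t * j2.
have a1z : a1 < z.
  have -> : z = (1 - t) * (inf I + (z - lo)) + t * (inf J + (z - lo)) by rewrite /lo; ring.
  by rewrite ltrD// ltr_pM2l// subr_gt0.
have za2 : z < a2.
  have -> : z = (1 - t) * (sup I - (hi - z)) + t * (sup J - (hi - z)) by rewrite /hi; ring.
  by rewrite ltrD// ltr_pM2l// subr_gt0.
pose a := (z - a1) / (a2 - a1).
have a12 : 0 < a2 - a1 by rewrite subr_gt0 (lt_trans a1z).
have a0 : 0 <= a by rewrite divr_ge0 ?ltW// subr_gt0.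
have a_le1 : a <= 1 by rewrite ler_pdivrMr// mul1r lerB// ltW.
have aE : a * (a2 - a1) = z - a1 by rewrite mulfVK// gt_eqF.
have -> : z = (1 - t) * ((1 - a) * i1 + a * i2) + t * ((1 - a) * j1 + a * j2).
  have : z = a1 + a * (a2 - a1) by rewrite aE addrC subrK.
  by rewrite /a1 /a2 => ->; ring.
by apply: IJD; [exact: cI|exact: cJ].
Qed.

(** The graph of the power [n.+1] lies above its tangent line at [m]. *)
Lemma pow_tangent (z m : R) n : 0 <= z -> 0 <= m ->
  n.+1%:R * m ^+ n * z <= z ^+ n.+1 + n%:R * m ^+ n.+1.
Proof.
move=> z0 m0; elim: n => [|n IH]; first by rewrite expr0 !mul1r mul0r addr0 expr1.
have := ler_wpM2r z0 IH.
have : 0 <= n.+1%:R * m ^+ n * (z - m) ^+ 2.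
  by rewrite mulr_ge0 ?sqr_ge0// mulr_ge0// exprn_ge0.
rewrite !exprS -[n.+2%:R]natr1 -[n.+1%:R]natr1 expr0 mulr1 => H1 H2.
have : 0 <= z * (z * z ^+ n) + (n%:R + 1) * (m * (m * m ^+ n)) - (n%:R + 1 + 1) * (m * m ^+ n) * z.
  apply: le_trans (addr_ge0 H1 (_ : 0 <= (z * z ^+ n + n%:R * (m * m ^+ n)) * z - (n%:R + 1) * m ^+ n * z * z)) _.
    by rewrite subr_ge0.
  by rewrite le_eqVlt; apply/orP; left; apply/eqP; ring.
lra.
Qed.

(** Radon's inequality, that is, convexity of the perspective [x ^+ n.+1 / al ^+ n]. Both terms are
    bounded below by the tangent at the common slope [m = X / Y], for which the bounds add up
    exactly. *)
Lemma radon (t x y al be : R) n : 0 < t -> t < 1 -> 0 < x -> 0 < y -> 0 < al -> 0 < be ->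
  ((1 - t) * x + t * y) ^+ n.+1 <=
  ((1 - t) * al + t * be) ^+ n *
    ((1 - t) * (x ^+ n.+1 / al ^+ n) + t * (y ^+ n.+1 / be ^+ n)).
Proof.
move=> t0 t1 x0 y0 a0 b0; have s0 : 0 < 1 - t by rewrite subr_gt0.
set X := (1 - t) * x + t * y; set Y := (1 - t) * al + t * be.
have X0 : 0 < X by rewrite addr_gt0// mulr_gt0.
have Y0 : 0 < Y by rewrite addr_gt0// mulr_gt0.
pose m := X / Y; have m0 : 0 <= m by rewrite divr_ge0// ltW.
have key u v : 0 < u -> 0 < v ->
    n.+1%:R * m ^+ n * u - n%:R * m ^+ n.+1 * v <= u ^+ n.+1 / v ^+ n.
  move=> u0 v0; have uv0 : 0 <= u / v by rewrite divr_ge0 ?ltW.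
  have := ler_wpM2r (ltW v0) (pow_tangent n uv0 m0).
  have -> : n.+1%:R * m ^+ n * (u / v) * v = n.+1%:R * m ^+ n * u.
    by rewrite -mulrA divfK ?gt_eqF.
  have -> : ((u / v) ^+ n.+1 + n%:R * m ^+ n.+1) * v =
      u ^+ n.+1 / v ^+ n + n%:R * m ^+ n.+1 * v.
    rewrite mulrDl expr_div_n [v ^+ n.+1]exprSr invfM -[in LHS]mulrA -[in LHS]mulrA.
    by rewrite mulVf ?mulr1 ?gt_eqF.
  by rewrite lerBlDr.
have := ler_wpM2l (ltW s0) (key x al x0 a0).
have := ler_wpM2l (ltW t0) (key y be y0 b0).
have mY : m * Y = X by rewrite divfK// gt_eqF.
have -> : X ^+ n.+1 = Y ^+ n * (n.+1%:R * m ^+ n * X - n%:R * m ^+ n.+1 * Y).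
  by rewrite -mY; move: (m) => z; rewrite !exprMn !exprS -natr1; ring.
move=> h1 h2; rewrite ler_pM2l ?exprn_gt0//.
apply: le_trans (lerD h2 h1); rewrite le_eqVlt; apply/orP; left; apply/eqP.
by rewrite /X /Y; ring.
Qed.

End OneDimensional.

Lemma le_integral_comb d (X : measurableType d) (R : realType)
    (mu : {measure set X -> \bar R}) (D : set X) (f g h : X -> \bar R) (a b : R) :
  measurable D -> 0 <= a -> 0 <= b ->
  measurable_fun D f -> measurable_fun D g -> measurable_fun D h ->
  (forall x, D x -> 0 <= f x)%E -> (forall x, D x -> 0 <= g x)%E ->
  (forall x, D x -> a%:E * f x + b%:E * g x <= h x)%E ->
  (a%:E * \int[mu]_(x in D) f x + b%:E * \int[mu]_(x in D) g x <= \int[mu]_(x in D) h x)%E.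
Proof.
move=> mD a0 b0 mf mg mh f0 g0 fgh.
have af0 x : D x -> (0 <= a%:E * f x)%E by move=> Dx; rewrite mule_ge0 ?lee_fin ?f0.
have bg0 x : D x -> (0 <= b%:E * g x)%E by move=> Dx; rewrite mule_ge0 ?lee_fin ?g0.
rewrite -(ge0_integralZl mu mD mf f0) ?lee_fin// -(ge0_integralZl mu mD mg g0) ?lee_fin//.
rewrite -ge0_integralD//; [|exact: measurable_funeM|exact: measurable_funeM].
apply: ge0_le_integral => //.
- by move=> x Dx; rewrite adde_ge0 ?af0 ?bg0.
- by apply: emeasurable_funD; exact: measurable_funeM.
Qed.

Section BrunnMinkowski.
Variable R : realType.
Local Notation leb := (@lebesgue_measure R).
Local Notation RM := (measurableTypeR R).
Local Notation mu n := (lebesgue_rV R n).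

(* [n]-th root; the value for [n = 0] makes statements about levels of
   volumes uniform, a nonempty subset of R^0 having volume [1]. *)
Definition rt n (x : R) := if n is 0 then 1 else x `^ n%:R^-1.

Lemma rt_gt0 n x : 0 < x -> 0 < rt n x.
Proof. by case: n => //= n x0; exact: powR_gt0. Qed.

Lemma rt_ge0 n x : 0 <= rt n x.
Proof. by case: n => //= n; exact: powR_ge0. Qed.

Lemma rtM n x y : 0 <= x -> 0 <= y -> rt n (x * y) = rt n x * rt n y.
Proof. by case: n => [|n] x0 y0 /=; [rewrite mulr1|rewrite powRM]. Qed.

Lemma rtK n x : 0 <= x -> rt n.+1 x ^+ n.+1 = x.
Proof.
by move=> x0; rewrite -powR_mulrn ?powR_ge0// -powRrM mulVf ?powRr1// pnatr_eq0.
Qed.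

Lemma rt_le n x y : 0 <= x -> x <= y -> rt n x <= rt n y.
Proof.
case: n => //= n x0 xy; apply: ge0_ler_powR; rewrite ?nnegrE ?invr_ge0//.
exact: le_trans xy.
Qed.

Lemma lebesgue_rV0 (A : set 'rV[R]_0) : A !=set0 -> mu 0 A = 1%E.
Proof. by move=> [x Ax]; rewrite /= diracE mem_set// (_ : 0 = x)// [RHS]thinmx0. Qed.

Lemma lebesgue_rV_gt0_neq0 n (A : set 'rV[R]_n) : (0 < mu n A)%E -> A !=set0.
Proof.
by apply: contraPP => /nonemptyPn ->; rewrite measure0 ltxx.
Qed.

Lemma rt_bound n x : 0 <= x -> (n = 0%N -> x <= 1) -> x <= rt n x ^+ n.
Proof. by case: n => [x0 /(_ erefl)//|n x0 _]; rewrite rtK. Qed.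

Lemma lebesgue_rV_le1 n (A : set 'rV[R]_n) : n = 0%N -> (mu n A <= 1)%E.
Proof. by move=> n0; case: _ / (esym n0) A => A /=; rewrite diracE; case: (_ \in _). Qed.

Lemma rt_level n (A : set 'rV[R]_n) (x : R) :
  0 < x -> (x%:E <= mu n A)%E -> (((rt n x) ^+ n)%:E <= mu n A)%E.
Proof.
case: n A => [|n] A x0 xA; last by rewrite rtK// ltW.
rewrite expr0 lebesgue_rV0//; apply: lebesgue_rV_gt0_neq0.
by apply: lt_le_trans xA; rewrite lte_fin.
Qed.

Definition slice n (A : set 'rV[R]_n.+1) (s : RM) : set 'rV[R]_n :=
  [set v | A (rV_cons (s, v))].

Lemma rV_consD n s u (v w : 'rV[R]_n) a b :
  rV_cons (a * s + b * u, a *: v + b *: w) =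
  a *: rV_cons (s, v) + b *: rV_cons (u, w).
Proof.
have E m (M N : 'rV[R]_m) i : (a *: M + b *: N) ord0 i = a * M ord0 i + b * N ord0 i.
  by rewrite !mxE.
by apply/rowP => i; rewrite E; case: (unliftP ord0 i) => [j ->|->];
  rewrite ?rV_consS ?rV_cons0 //= E.
Qed.

Lemma dot_cons n s (v : 'rV[R]_n) s' v' :
  dot (rV_cons (s, v)) (rV_cons (s', v')) = s * s' + dot v v'.
Proof.
by rewrite /dot big_ord_recl !rV_cons0 /=; congr (_ + _); apply: eq_bigr => i _; rewrite !rV_consS.
Qed.

Lemma measurable_slice n (A : set 'rV[R]_n.+1) s : measurable A -> measurable (slice A s).
Proof.
by move=> mA; exact: (measurable_slice1 s (measurable_preim (@measurable_rV_cons R n) mA)).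
Qed.

Lemma measurable_slice_vol n (A : set 'rV[R]_n.+1) :
  measurable A -> measurable_fun setT (fun s => mu n (slice A s)).
Proof.
by move=> mA; exact: (measurable_vol1 (mu n) (measurable_preim (@measurable_rV_cons R n) mA)).
Qed.

Lemma lebesgue_slice n (A : set 'rV[R]_n.+1) : measurable A ->
  mu n.+1 A = (\int[leb]_s mu n (slice A s))%E.
Proof.
by move=> mA; exact: (prod_vol1 leb (mu n) (measurable_preim (@measurable_rV_cons R n) mA)).
Qed.

Lemma slice_cvx n (A : set 'rV[R]_n.+1) s : cvx A -> cvx (slice A s).
Proof.
move=> cA v w t Av Aw t0 t1; rewrite /slice/=.
have -> : s = (1 - t) * s + t * s by ring.
by rewrite rV_consD; exact: cA.
Qed.

Lemma slice_rball n (A : set 'rV[R]_n.+1) s r : A `<=` rball r -> slice A s `<=` rball r.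
Proof.
move=> Ar v /Ar; rewrite /rball/= dot_cons; apply: le_trans.
by rewrite lerDr -expr2 sqr_ge0.
Qed.

(* Induction on the dimension: after rescaling so that the maximal slices of [A]
   and [B] have the same volume, the level sets of the slice volume functions are
   intervals to which the one-dimensional inequality applies. *)
Theorem brunn_minkowski n (A B C : set 'rV[R]_n) (t a b : R) :
  measurable A -> measurable B -> measurable C -> cvx A -> cvx B ->
  ebounded A -> ebounded B -> A !=set0 -> B !=set0 ->
  0 <= t -> t <= 1 -> 0 <= a -> 0 <= b ->
  (forall x y, A x -> B y -> C ((1 - t) *: x + t *: y)) ->
  ((a ^+ n)%:E <= mu n A)%E -> ((b ^+ n)%:E <= mu n B)%E ->
  ((((1 - t) * a + t * b) ^+ n)%:E <= mu n C)%E.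
Proof.
elim: n A B C t a b => [|n IH] A B C t a b mA mB mC cA cB bA bB A0 B0 t0 t1 a0 b0 ABC aA bB'.
  have [x Ax] := A0; have [y By] := B0.
  by rewrite expr0 lebesgue_rV0//; exists ((1 - t) *: x + t *: y); exact: ABC.
have s0 : 0 <= 1 - t by rewrite subr_ge0.
have trans (D : set 'rV[R]_n.+1) (u : R) (z : 'rV[R]_n.+1) : measurable D -> 0 <= u ->
    (forall x, D x -> C (u *: x + z)) -> ((u ^+ n.+1)%:E * mu n.+1 D <= mu n.+1 C)%E.
  move=> mD; rewrite le_eqVlt => /predU1P[<- _|u0 H].
    by rewrite expr0n mul0e.
  rewrite -lebesgue_dilate// -((preserves_translate z).2 _ mC).
  apply: le_measure; rewrite ?inE; [exact: measurable_dilate|exact: measurable_translate|].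
  by move=> _ [x Dx <-]; exact: H.
have [x0 Ax0] := A0; have [y0 By0] := B0.
(* When one of the two terms vanishes, [C] contains a translate of a dilate of the other body, and
   the homogeneity of volume suffices. *)
have [->|ta] := eqVneq ((1 - t) * a) 0.
  rewrite add0r exprMn EFinM; apply: le_trans (trans B t ((1 - t) *: x0) mB t0 _).
    by apply: lee_wpmul2l => //; rewrite lee_fin exprn_ge0.
  by move=> y By; rewrite addrC; exact: ABC.
have [->|tb] := eqVneq (t * b) 0.
  rewrite addr0 exprMn EFinM; apply: le_trans (trans A (1 - t) (t *: y0) mA s0 _).
    by apply: lee_wpmul2l => //; rewrite lee_fin exprn_ge0.
  by move=> x Ax; exact: ABC.
have [s_gt0 a_gt0] : 0 < 1 - t /\ 0 < a.
  by move: ta; rewrite mulf_eq0 negb_or => /andP[? ?]; rewrite !lt_def s0 a0; split; apply/andP.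
have [t_gt0 b_gt0] : 0 < t /\ 0 < b.
  by move: tb; rewrite mulf_eq0 negb_or => /andP[? ?]; rewrite !lt_def t0 b0; split; apply/andP.
have t_lt1 : t < 1 by rewrite -subr_gt0.
have level (D1 D2 D3 : set 'rV[R]_n.+1) (l p q : R) (s u : RM) :
    measurable D1 -> measurable D2 -> measurable D3 -> cvx D1 -> cvx D2 ->
    ebounded D1 -> ebounded D2 -> 0 <= l -> l <= 1 -> 0 < p -> 0 < q ->
    (forall x y, D1 x -> D2 y -> D3 ((1 - l) *: x + l *: y)) ->
    (p%:E <= mu n (slice D1 s))%E -> (q%:E <= mu n (slice D2 u))%E ->
    ((((1 - l) * rt n p + l * rt n q) ^+ n)%:E <= mu n (slice D3 ((1 - l) * s + l * u)%R))%E.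
  move=> m1 m2 m3 c1 c2 [r1 r10 b1] [r2 r20 b2] l0 l1 p0 q0 D123 ps qu.
  apply: (IH (slice D1 s) (slice D2 u)) => //.
  - exact: measurable_slice.
  - exact: measurable_slice.
  - exact: measurable_slice.
  - exact: slice_cvx.
  - exact: slice_cvx.
  - by exists r1 => //; exact: slice_rball.
  - by exists r2 => //; exact: slice_rball.
  - by apply: lebesgue_rV_gt0_neq0; apply: lt_le_trans ps; rewrite lte_fin.
  - by apply: lebesgue_rV_gt0_neq0; apply: lt_le_trans qu; rewrite lte_fin.
  - exact: rt_ge0.
  - exact: rt_ge0.
  - by move=> v w Dv Dw; rewrite /slice/= rV_consD; exact: D123.
  - exact: rt_level.
  - exact: rt_level.
have fin_slice (D : set 'rV[R]_n.+1) s : measurable D -> ebounded D ->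
    mu n (slice D s) \is a fin_num.
  move=> mD [r r0 Dr]; apply: ebounded_fin; first exact: measurable_slice.
  by exists r => //; exact: slice_rball.
(* Here [p] is the supremum of the slice volumes. It need not be attained, so slices are produced
   only at the levels [r * p] with [r < 1], which are all that the layer-cake integral uses. *)
have maxslice (D : set 'rV[R]_n.+1) : measurable D -> cvx D -> ebounded D ->
    (0 < mu n.+1 D)%E -> exists p, [/\ 0 < p, p <= rt n p ^+ n,
      (forall s, mu n (slice D s) <= p%:E)%E &
      forall r, 0 < r < 1 -> exists s, ((r * p)%:E <= mu n (slice D s))%E].
  move=> mD cD bD D_gt0; have [r r0 Dr] := bD.
  pose F s := fine (mu n (slice D s)); pose p := sup (range F).
  have FE s : (F s)%:E = mu n (slice D s) by rewrite fineK// fin_slice.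
  have hub : has_ubound (range F).
    exists (fine (mu n (rball r))) => _ [s _ <-].
    rewrite -lee_fin FE fineK; last first.
      by apply: ebounded_fin; [exact: measurable_rball|exists r].
    apply: le_measure; rewrite ?inE; [exact: measurable_slice|exact: measurable_rball|].
    exact: slice_rball.
  have Fp s : F s <= p by apply: ub_le_sup => //; exists s.
  have p_gt0 : 0 < p.
    rewrite ltNge; apply/negP => p0; move: D_gt0; rewrite lebesgue_slice//.
    rewrite (eq_integral (cst 0%E)) ?integral0 ?ltxx// => s _ /=.
    by apply/eqP; rewrite -FE eqe eq_le (le_trans (Fp s) p0) fine_ge0.
  exists p; split => // [|s|q /andP[q0 q1]].
  - apply: rt_bound; first exact: ltW.
    move=> n0; apply: ge_sup; first by exists (F 0), 0.
    by move=> _ [s _ <-]; rewrite -lee_fin FE lebesgue_rV_le1.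
  - by rewrite -FE lee_fin.
  - have qp : 0 < p - q * p by rewrite subr_gt0 gtr_pMl.
    have F0 : range F !=set0 by exists (F 0), 0.
    have [_ [s _ <-] Fs] := sup_adherent qp (conj F0 hub).
    by exists s; rewrite -FE lee_fin ltW//; apply: le_lt_trans Fs; rewrite opprB addrC subrK.
have A_gt0 : (0 < mu n.+1 A)%E by apply: lt_le_trans aA; rewrite lte_fin exprn_gt0.
have B_gt0 : (0 < mu n.+1 B)%E by apply: lt_le_trans bB'; rewrite lte_fin exprn_gt0.
have [p [p0 prt pA pAr]] := maxslice A mA cA bA A_gt0.
have [q [q0 qrt qB qBr]] := maxslice B mB cB bB B_gt0.
(* [ga] is what the induction hypothesis guarantees for the combination of slices of volumes [p] and
   [q]. Multiplying both volumes by [r] gives at least [r * ga], so the level sets at the same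
   relative height combine. *)
pose al := rt n p; pose be := rt n q; pose ga := ((1 - t) * al + t * be) ^+ n.
have al0 : 0 < al by exact: rt_gt0.
have be0 : 0 < be by exact: rt_gt0.
have ga0 : 0 < ga by rewrite exprn_gt0// addr_gt0// mulr_gt0.
pose I D m r := [set s : RM | ((r * m)%:E <= mu n (slice D s))%E].
have mI D m r : measurable D -> measurable (I D m r).
  move=> mD; rewrite -[I _ _ _]setTI.
  by apply: emeasurable_fun_c_infty => //; exact: measurable_slice_vol.
have Ile (D : set 'rV[R]_n.+1) m r s : cvx D -> measurable D -> 0 < r -> 0 < m ->
    forall rad, 0 <= rad -> D `<=` rball rad -> I D m r s -> `|s| <= rad.
  move=> cD mD r0 m0 rad rad0 Drad; rewrite /I/= => H.
  have [v Dv] : slice D s !=set0.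
    by apply: lebesgue_rV_gt0_neq0; apply: lt_le_trans H; rewrite lte_fin mulr_gt0.
  have := rball_coord ord0 rad0 (Drad _ Dv); by rewrite rV_cons0.
have Icvx D m r : measurable D -> cvx D -> ebounded D -> 0 < r -> r < 1 -> 0 < m ->
    forall x y l, I D m r x -> I D m r y -> 0 <= l -> l <= 1 -> I D m r ((1 - l) * x + l * y).
  move=> mD cD bD r0 r1 m0 x y l Ix Iy l0 l1.
  have rm0 : 0 < r * m by rewrite mulr_gt0.
  have := level D D D l (r * m) (r * m) x y mD mD mD cD cD bD bD l0 l1 rm0 rm0
    (fun x y Dx Dy => cD _ _ _ Dx Dy l0 l1) Ix Iy.
  rewrite -mulrDl subrK mul1r; apply: le_trans; rewrite lee_fin.
  apply: rt_bound (ltW rm0) _ => n0; rewrite -lee_fin.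
  exact: le_trans Ix (lebesgue_rV_le1 _ n0).
have key r : 0 < r < 1 ->
    ((1 - t)%:E * leb (I A p r) + t%:E * leb (I B q r) <= leb (I C ga r))%E.
  move=> /andP[r0 r1]; have [ra ra0 Ara] := bA; have [rb rb0 Brb] := bB.
  apply: (@lebesgue_interval_add _ _ _ _ t (Num.max ra rb)) => //.
  - exact: mI.
  - exact: mI.
  - exact: mI.
  - by have [|s] := pAr r; [rewrite r0 r1|exists s].
  - by have [|s] := qBr r; [rewrite r0 r1|exists s].
  - by move=> x /(Ile _ _ _ _ cA mA r0 p0 _ ra0 Ara) H; rewrite le_max H.
  - by move=> x /(Ile _ _ _ _ cB mB r0 q0 _ rb0 Brb) H; rewrite le_max H orbT.
  - exact: Icvx.
  - exact: Icvx.
  - move=> x y Ix Iy.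
    have rp0 : 0 < r * p by rewrite mulr_gt0.
    have rq0 : 0 < r * q by rewrite mulr_gt0.
    have := level A B C t (r * p) (r * q) x y mA mB mC cA cB bA bB t0 t1 rp0 rq0 ABC Ix Iy.
    apply: le_trans; rewrite lee_fin !rtM ?(ltW r0) ?(ltW p0) ?(ltW q0)//.
    rewrite !(mulrCA _ (rt n r)) -mulrDr exprMn -/al -/be -/ga ler_pM2r//.
    by apply: rt_bound (ltW r0) _ => _; exact: ltW.
have mv D : measurable D -> measurable_fun setT (fun s => mu n (slice D s)).
  exact: measurable_slice_vol.
have lay D m : measurable D -> 0 < m ->
    (m%:E * \int[leb]_(r in `]0%R, 1%R[) leb (I D m r) = \int[leb]_s mine (mu n (slice D s)) m%:E)%E.
  by move=> mD m0; apply: integral_min_level => //; exact: mv.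
have layA : (p%:E * \int[leb]_(r in `]0%R, 1%R[) leb (I A p r) = mu n.+1 A)%E.
  rewrite lay// lebesgue_slice//; apply: eq_integral => s _.
  by rewrite min_l.
have layB : (q%:E * \int[leb]_(r in `]0%R, 1%R[) leb (I B q r) = mu n.+1 B)%E.
  rewrite lay// lebesgue_slice//; apply: eq_integral => s _.
  by rewrite min_l.
have mleb D m : measurable D -> measurable_fun (`]0%R, 1%R[%classic : set RM) (fun r : RM => leb (I D m r)).
  move=> mD; have mE := measurable_le_level m (mv D mD).
  have := measurable_vol1 leb mE; move=> /measurable_funTS H.
  apply: eq_measurable_fun (H _) => r; rewrite inE/= in_itv/= => r01.
  by congr (leb _); apply/seteqP; split => s /= => [[]|].
have layC : (ga%:E * \int[leb]_(r in `]0%R, 1%R[) leb (I C ga r) <= mu n.+1 C)%E.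
  rewrite lay// lebesgue_slice//; apply: ge0_le_integral => //.
  - by move=> s _; rewrite le_min measure_ge0 lee_fin ltW.
  - apply: measurable_mine; [exact: mv|exact: measurable_cst].
  - exact: mv.
  - by move=> s _; rewrite ge_min lexx.
apply: le_trans layC.
have intA : (((a ^+ n.+1) / p)%:E <= \int[leb]_(r in `]0%R, 1%R[) leb (I A p r))%E.
  by rewrite EFinM muleC lee_pdivrMl// layA.
have intB : (((b ^+ n.+1) / q)%:E <= \int[leb]_(r in `]0%R, 1%R[) leb (I B q r))%E.
  by rewrite EFinM muleC lee_pdivrMl// layB.
have H1 : ((1 - t)%:E * (\int[leb]_(r in `]0%R, 1%R[) leb (I A p r)) +
   t%:E * (\int[leb]_(r in `]0%R, 1%R[) leb (I B q r)) <=
   \int[leb]_(r in `]0%R, 1%R[) leb (I C ga r))%E.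
  apply: le_integral_comb => //; rewrite ?(ltW t_gt0) ?(ltW s_gt0)//.
  - exact: mleb.
  - exact: mleb.
  - exact: mleb.
apply: le_trans (lee_wpmul2l _ H1); last by rewrite lee_fin ltW.
apply: le_trans (lee_wpmul2l _ (leeD (lee_wpmul2l _ intA) (lee_wpmul2l _ intB))); rewrite ?lee_fin ?(ltW ga0)//.
(* Radon's inequality has the denominators [al ^+ n] and [be ^+ n], which are at least [p] and
   [q]. *)
apply: le_trans (radon n t_gt0 t_lt1 a_gt0 b_gt0 al0 be0) _.
rewrite -/ga ler_pM2l// lerD// ler_pM2l//.
  by rewrite ler_pM2l ?exprn_gt0// lef_pV2// posrE exprn_gt0.
by rewrite ler_pM2l ?exprn_gt0// lef_pV2// posrE exprn_gt0.
Qed.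

End BrunnMinkowski.

(** * Zonotopes and projections *)

Section CompactProjection.
Variable R : realType.

(** Tube lemma: projection along a compact factor is a closed map. *)
Lemma closed_exists_compact (Z X : topologicalType) (K : set X) (E : set (Z * X)) :
  compact K -> closed E -> closed [set z | exists2 x, K x & E (z, x)].
Proof.
move=> /compact_near_coveringP cK cE; rewrite -[X in closed X]setCK.
apply: open_closedC; rewrite openE => z nDz; rewrite /interior.
have /(_ _ _) H := cK Z (nbhs z) (fun z' x => ~ E (z', x)) _.
have : \forall z' \near z, K `<=` (fun x => ~ E (z', x)).
  apply: H => x Kx.
  have nE : ~ E (z, x) by move=> Ezx; apply: nDz; exists x.
  have : nbhs (z, x) (~` E).
    by apply: open_nbhs_nbhs; split => //; exact: closed_openC.
  case=> -[A B] /= [zA xB] AB; exists (B, A) => //= -[x' z'] /= [Bx' Az'].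
  exact: (AB (z', x')).
by apply: filterS => z' H' [x Kx Ex]; exact: H' Kx Ex.
Qed.

(** The set of pairs [(U, y)] is closed, hence measurable, and Tonelli's theorem makes the volumes
    of its sections measurable. The volumes of shadows, sections and cylinders are all treated in
    this way. *)
Lemma measurable_exists_vol p q n m (K : set 'rV[R]_n)
    (E : set ('M[R]_(p, q) * 'rV[R]_m * 'rV[R]_n)) :
  compact K -> closed E ->
  measurable_fun setT
    (fun U : 'M[R]_(p, q) => lebesgue_rV R m [set y | exists2 x, K x & E (U, y, x)]).
Proof.
move=> cK cE; have cD := closed_exists_compact cK cE.
exact: (measurable_vol1 (lebesgue_rV R m) (closed_measurable_prod cD)).
Qed.

Lemma measurable_image_vol p q n m (K : set 'rV[R]_n)
    (f : 'M[R]_(p, q) -> 'rV[R]_n -> 'rV[R]_m) :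
  compact K -> continuous (fun z : 'M[R]_(p, q) * 'rV[R]_n => f z.1 z.2) ->
  measurable_fun setT (fun U => lebesgue_rV R m [set f U x | x in K]).
Proof.
move=> cK cf.
pose E : set ('M[R]_(p, q) * 'rV[R]_m * 'rV[R]_n) :=
  [set z | f z.1.1 z.2 - z.1.2 = 0].
have cE : closed E.
  have c : continuous (fun z : 'M[R]_(p, q) * 'rV[R]_m * 'rV[R]_n =>
      f z.1.1 z.2 - z.1.2).
    apply: continuous_submx; last first.
      by move=> z; apply: (@continuous_comp _ _ _ fst snd); [exact: cvg_fst|exact: cvg_snd].
    pose pr (z : 'M[R]_(p, q) * 'rV[R]_m * 'rV[R]_n) := (z.1.1, z.2).
    have cpr : continuous pr.
      apply: continuous_pair; last by move=> z; exact: cvg_snd.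
      by move=> z; apply: (@continuous_comp _ _ _ fst fst); exact: cvg_fst.
    by move=> z; exact: (@continuous_comp _ _ _ pr (fun z => f z.1 z.2) z (cpr z) (cf _)).
  by move/continuous_closedP : c => /(_ _ (@closed_set1_mx R 1 m 0)).
have := measurable_exists_vol cK cE; congr (measurable_fun _ _).
apply/funext => U; congr (lebesgue_rV R m _); apply/seteqP; split => y /=.
  by move=> [x Kx]; rewrite /E /= => /subr0_eq <-; exists x.
by move=> [x Kx <-]; exists x => //; rewrite /E/= subrr.
Qed.

End CompactProjection.

Section Vol.
Variable R : realType.

Definition vol n (A : set 'rV[R]_n) : R := fine (lebesgue_rV R n A).

Lemma vol_ge0 n (A : set 'rV[R]_n) : 0 <= vol A.
Proof. exact: fine_ge0. Qed.

Lemma volE n (A : set 'rV[R]_n) : compact A -> lebesgue_rV R n A = (vol A)%:E.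
Proof.
move=> cA; rewrite /vol fineK// ebounded_fin//; first exact: (compact_mx_measurable cA).
exact: compact_ebounded.
Qed.

Lemma vol_le n (A B : set 'rV[R]_n) : compact A -> compact B -> A `<=` B -> vol A <= vol B.
Proof.
move=> cA cB AB; rewrite -lee_fin -!volE//; apply: le_measure => //; rewrite inE.
  exact: (compact_mx_measurable cA).
exact: (compact_mx_measurable cB).
Qed.

Lemma omega_vol n : omega R n = vol (@eball R n).
Proof. by []. Qed.

Definition rotate n (U : 'M[R]_n) (A : set 'rV[R]_n) : set 'rV[R]_n := [set x *m U | x in A].

Lemma rotate_compact n (U : 'M[R]_n) A : compact A -> compact (rotate U A).
Proof. by apply: image_compact; exact: continuous_mulmxr. Qed.

Lemma rotate_preimage n (U : 'M[R]_n) A : ortho_mx U -> rotate U A = [set x | A (x *m U^T)].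
Proof.
move=> oU; apply/seteqP; split => [_ [x Ax <-] /=|x /= Ax].
  by rewrite -mulmxA oU mulmx1.
by exists (x *m U^T) => //; rewrite -mulmxA (mulmx1C oU) mulmx1.
Qed.

Lemma lebesgue_rot n (U : 'M[R]_n) A : ortho_mx U -> measurable A ->
  lebesgue_rV R n (rotate U A) = lebesgue_rV R n A.
Proof.
move=> oU mA; rewrite rotate_preimage//.
by have /= := (preserves_orthogonal (ortho_mxT oU)).2 _ mA.
Qed.

Lemma vol_rot n (U : 'M[R]_n) A : ortho_mx U -> measurable A -> vol (rotate U A) = vol A.
Proof. by move=> oU mA; rewrite /vol lebesgue_rot. Qed.

Lemma rotate_cvx n (U : 'M[R]_n) A : cvx A -> cvx (rotate U A).
Proof.
move=> cA _ _ t [x Ax <-] [y Ay <-] t0 t1; exists ((1 - t) *: x + t *: y); first exact: cA.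
by rewrite mulmxDl !scalemxAl.
Qed.

Lemma minkowskiA n (A B C : set 'rV[R]_n) :
  minkowski_sum A (minkowski_sum B C) = minkowski_sum (minkowski_sum A B) C.
Proof.
apply/seteqP; split => [_ [x Ax [_ [y By [z Cz <-]] <-]]|_ [_ [x Ax [y By <-]] [z Cz <-]]].
  by exists (x + y); [exists x => //; exists y|exists z => //; rewrite addrA].
by exists x => //; exists (y + z); [exists y => //; exists z|rewrite addrA].
Qed.

Lemma minkowski_le n (A B C : set 'rV[R]_n) : B `<=` C -> minkowski_sum A B `<=` minkowski_sum A C.
Proof. by move=> BC _ [x Ax [y By <-]]; exists x => //; exists y => //; exact: BC. Qed.

Lemma minkowski_sub n (A B : set 'rV[R]_n) : B 0 -> A `<=` minkowski_sum A B.
Proof. by move=> B0 x Ax; exists x => //; exists 0 => //; rewrite addr0. Qed.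

Lemma rotate_minkowski n (U : 'M[R]_n) A B :
  rotate U (minkowski_sum A B) = minkowski_sum (rotate U A) (rotate U B).
Proof.
apply/seteqP; split => [_ [_ [x Ax [y By <-]] <-]|_ [_ [x Ax <-] [_ [y By <-] <-]]].
  by rewrite mulmxDl; exists (x *m U); [exists x|exists (y *m U) => //; exists y].
by exists (x + y); [exists x => //; exists y|rewrite mulmxDl].
Qed.

Lemma eball0 n : @eball R n 0.
Proof. by rewrite /eball/= dot0l. Qed.

Lemma rotate_eball n (U : 'M[R]_n) : ortho_mx U -> rotate U (@eball R n) = @eball R n.
Proof.
move=> oU; rewrite rotate_preimage//; apply/seteqP.
by split => x; rewrite /eball/= dot_orthogonal//; exact: ortho_mxT.
Qed.

Lemma rotate_dilate n (U : 'M[R]_n) a A : rotate U (dilate a A) = dilate a (rotate U A).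
Proof.
apply/seteqP; split => [_ [_ [x Ax <-] <-]|_ [_ [x Ax <-] <-]].
  by exists (x *m U); [exists x|rewrite scalemxAl].
by exists (a *: x); [exists x|rewrite scalemxAl].
Qed.

Lemma dilate_eball_compact n a : compact (dilate a (@eball R n)).
Proof. by apply: dilate_compact; exact: eball_compact. Qed.

Lemma dilate_eball_cvx n a : cvx (dilate a (@eball R n)).
Proof. by apply: dilate_cvx; exact: eball_cvx. Qed.

Lemma dilate_eball0 n a : dilate a (@eball R n) 0.
Proof. by exists 0; [exact: eball0|rewrite scaler0]. Qed.

Lemma dilateD_eball n s t : 0 <= s -> 0 <= t ->
  minkowski_sum (dilate s (@eball R n)) (dilate t (@eball R n)) = dilate (s + t) (@eball R n).
Proof.
move=> s0 t0; apply/seteqP; split => [_ [_ [x Bx <-] [_ [y By <-] <-]]|_ [x Bx <-]].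
  have [/eqP st|st] := eqVneq (s + t) 0.
    move: st; rewrite paddr_eq0// => /andP[/eqP -> /eqP ->].
    by rewrite !scale0r !addr0; exact: dilate_eball0.
  have st0 : 0 < s + t by rewrite lt_def st addr_ge0.
  exists ((1 - t / (s + t)) *: x + (t / (s + t)) *: y).
    apply: eball_cvx => //; first by rewrite divr_ge0// ltW.
    by rewrite ler_pdivrMr// mul1r lerDr.
  rewrite scalerDr !scalerA mulrBr mulr1 mulrCA divff// mulr1.
  by rewrite addrK.
exists (s *: x); first by exists x.
by exists (t *: x); [exists x|rewrite scalerDl].
Qed.

Lemma dilate_eballE n a (x : 'rV[R]_n) : 0 <= a -> dilate a (@eball R n) x <-> enorm x <= a.
Proof.
move=> a0; split => [[y y1 <-]|xa].
  rewrite /enorm dotZl dotZr mulrA -expr2 sqrtrM ?sqr_ge0// sqrtr_sqr ger0_norm//.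
  rewrite ler_piMr// -(ler_pXn2r (_ : (0 < 2)%N))// ?nnegrE ?sqrtr_ge0//.
  by rewrite sqr_sqrtr ?dot_ge0// expr1n.
move: a0; rewrite le_eqVlt => /predU1P[a0|a0].
  exists 0; first exact: eball0.
  rewrite scaler0; apply/esym/dot_eq0; rewrite -enorm_sq.
  by apply/eqP; rewrite sqrf_eq0 eq_le enorm_ge0 a0 xa.
exists (a^-1 *: x); last by rewrite scalerA divff ?scale1r// gt_eqF.
rewrite /eball/= dotZl dotZr mulrA -invfM -expr2 mulrC ler_pdivrMr ?exprn_gt0//.
by rewrite mul1r -enorm_sq ler_pXn2r// nnegrE ?enorm_ge0// ltW.
Qed.

End Vol.

(** * Minkowski sums with a segment *)

Section Segments.
Variable R : realType.

Definition tail n (x : 'rV[R]_n.+1) : 'rV[R]_n := rsubmx (x : 'rV[R]_(1 + n)).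

Lemma tail_cons n p : tail (@rV_cons R n p) = p.2.
Proof. by have := congr1 snd (rV_consK p). Qed.

Lemma cons_tail n (x : 'rV[R]_n.+1) : rV_cons (x ord0 ord0, tail x) = x.
Proof. exact: (rV_unconsK x). Qed.

Lemma tailD n (x y : 'rV[R]_n.+1) : tail (x + y) = tail x + tail y.
Proof. by apply/rowP => i; rewrite !mxE. Qed.

Lemma tailZ n a (x : 'rV[R]_n.+1) : tail (a *: x) = a *: tail x.
Proof. by apply/rowP => i; rewrite !mxE. Qed.

Lemma tail_e0 n : tail (e0 R n) = 0.
Proof. by apply/rowP => i; rewrite !mxE. Qed.

Lemma continuous_tail n : continuous (@tail n).
Proof. by apply: continuous_mx => i j; under eq_fun do rewrite mxE; exact: coord_continuous. Qed.

Lemma tail_compact n (A : set 'rV[R]_n.+1) : compact A -> compact [set tail x | x in A].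
Proof. by apply: image_compact; exact: continuous_tail. Qed.

Lemma tail_cvx n (A : set 'rV[R]_n.+1) : cvx A -> cvx [set tail x | x in A].
Proof.
move=> cA _ _ t [x Ax <-] [y Ay <-] t0 t1; exists ((1 - t) *: x + t *: y); first exact: cA.
by rewrite tailD !tailZ.
Qed.

Lemma image_neq0 (T U : Type) (f : T -> U) (A : set T) : A !=set0 -> f @` A !=set0.
Proof. by move=> [x Ax]; exists (f x), x. Qed.

Definition seg n (w : R) (u : 'rV[R]_n) : set 'rV[R]_n := [set t *: u | t in `[- w, w]%classic].

Lemma seg_compact n w (u : 'rV[R]_n) : compact (seg w u).
Proof.
apply: continuous_compact; last exact: segment_compact.
apply: continuous_within; apply: continuous_mx => i j.
by under eq_fun do rewrite mxE; move=> t; apply: cvgM; [exact: cvg_id|exact: cvg_cst].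
Qed.

Lemma seg_cvx n w (u : 'rV[R]_n) : cvx (seg w u).
Proof.
move=> _ _ t [a + <-] [b + <-] t0 t1; rewrite /= !in_itv/= => /andP[a1 a2] /andP[b1 b2].
exists ((1 - t) * a + t * b); last by rewrite [LHS]scalerDl -!scalerA.
by rewrite /= in_itv/=; apply/andP; split; nra.
Qed.

Lemma seg0 n w (u : 'rV[R]_n) : 0 <= w -> seg w u 0.
Proof. by move=> w0; exists 0; rewrite ?scale0r//= in_itv/= w0 oppr_le0 w0. Qed.

Lemma rotate_seg n (U : 'M[R]_n) w u : rotate U (seg w u) = seg w (u *m U).
Proof.
apply/seteqP; split => [_ [_ [t tw <-] <-]|_ [t tw <-]].
  by exists t => //; rewrite scalemxAl.
by exists (t *: u); [exists t|rewrite scalemxAl].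
Qed.

Local Notation leb := (@lebesgue_measure R).
Local Notation mu n := (lebesgue_rV R n).

Lemma rV_cons_seg n t s (v : 'rV[R]_n) : rV_cons (t, v) + s *: e0 R n = rV_cons (t + s, v).
Proof.
apply/rowP => i; rewrite mxE [X in _ + X]mxE; case: (unliftP ord0 i) => [j ->|->].
  by rewrite !rV_consS /= mxE mulr0 addr0.
by rewrite !rV_cons0 /= mxE !eqxx mulr1.
Qed.

Lemma fiber_segment n (K : set 'rV[R]_n.+1) v : compact K -> cvx K ->
  [set tail x | x in K] v ->
  exists a b, a <= b /\ [set t : measurableTypeR R | K (rV_cons (t, v))] = `[a, b]%classic.
Proof.
move=> cK vK [x0 Kx0 tx0].
pose Kv := K `&` [set x | tail x = v].
have cKv : compact Kv.
  apply: compact_closedI => //.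
  by have /continuous_closedP/(_ _ (@closed_set1_mx R 1 n v)) := @continuous_tail n.
have Kv0 : Kv !=set0 by exists x0.
have cc := continuous_within (A := Kv) (@coord_continuous R 1 n.+1 ord0 ord0).
have [xa + amin] := EVT_min_rV Kv0 cKv cc; rewrite inE => -[Ka ta].
have [xb + bmax] := EVT_max_rV Kv0 cKv cc; rewrite inE => -[Kb tb].
exists (xa ord0 ord0), (xb ord0 ord0); split.
  by apply: amin; rewrite inE.
apply/seteqP; split => t /=.
  move=> Kt; rewrite in_itv/=.
  have tKv : rV_cons (t, v) \in Kv by rewrite inE; split => //=; rewrite tail_cons.
  by have := amin _ tKv; have := bmax _ tKv; rewrite rV_cons0 /= => -> ->.
rewrite in_itv/= => /andP[at' tb'].
set a := xa ord0 ord0 in at' *; set b := xb ord0 ord0 in tb' *.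
have [ab|ab] := eqVneq a b.
  have -> : t = a by apply/eqP; rewrite eq_le {1}ab tb' at'.
  by rewrite -ta cons_tail.
have ab0 : 0 < b - a by rewrite subr_gt0 lt_def eq_sym ab (le_trans at').
have := vK _ _ ((t - a) / (b - a)) Ka Kb.
rewrite divr_ge0 ?subr_ge0 ?(le_trans at')// ler_pdivrMr// mul1r lerB//.
move=> /(_ isT isT); rewrite -(cons_tail xa) -(cons_tail xb) ta tb -rV_consD.
rewrite -/a -/b -scalerDl subrK scale1r.
rewrite (_ : (1 - _) * a + _ = t)//.
have e : (t - a) / (b - a) * (b - a) = t - a by rewrite divfK// gt_eqF.
by rewrite mulrBl mul1r -addrA [- _ + _]addrC -mulrBr e addrC subrK.
Qed.

(** Fubini along [e0]: every nonempty fibre is an interval, and the sum lengthens it by [w] at both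
    ends. *)
Lemma vol_add_seg_e0 n (K : set 'rV[R]_n.+1) w : compact K -> cvx K -> 0 <= w ->
  vol (minkowski_sum K (seg w (e0 R n))) = vol K + 2 * w * vol [set tail x | x in K].
Proof.
move=> cK vK w0; have cS := minkowski_compact cK (@seg_compact _ w (e0 R n)).
apply: EFin_inj; rewrite EFinD EFinM -!volE//; last exact: tail_compact.
have fib (A : set 'rV[R]_n.+1) : measurable A ->
    mu n.+1 A = (\int[mu n]_v leb [set t : measurableTypeR R | A (rV_cons (t, v))])%E.
  by move=> mA; exact: (prod_vol2 leb (mu n) (measurable_preim (@measurable_rV_cons R n) mA)).
have mfib (A : set 'rV[R]_n.+1) : measurable A -> measurable_fun setT
    (fun v => leb [set t : measurableTypeR R | A (rV_cons (t, v))]).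
  by move=> mA; exact: (measurable_vol2 leb (measurable_preim (@measurable_rV_cons R n) mA)).
have mK := compact_mx_measurable cK; have mS := compact_mx_measurable cS.
have mT := compact_mx_measurable (tail_compact cK).
have -> : mu n [set tail x | x in K] = (\int[mu n]_v (\1_[set tail x | x in K] v)%:E)%E.
  by rewrite integral_indic// setIT.
rewrite !fib//.
rewrite -ge0_integralZl//; last 2 first.
- by apply/measurable_EFinP; exact: measurable_indic.
- by rewrite lee_fin mulr_ge0.
rewrite -ge0_integralD//; last 3 first.
- exact: mfib.
- by move=> v _; rewrite mule_ge0// lee_fin mulr_ge0.
- by apply: measurable_funeM; apply/measurable_EFinP; exact: measurable_indic.
apply: eq_integral => v _; rewrite indicE; have [|vT] := boolP (v \in _).
  rewrite inE => /(fiber_segment cK vK)[a [b [ab Kv]]].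
  have Sv : [set t : measurableTypeR R | minkowski_sum K (seg w (e0 R n)) (rV_cons (t, v))]
      = `[a - w, b + w]%classic.
    apply/seteqP; split => t /=.
      move=> [x Kx [_ [s + <-] xs]]; rewrite /= !in_itv/= => /andP[s1 s2].
      have : [set t : measurableTypeR R | K (rV_cons (t, v))] (x ord0 ord0).
        have xv : tail x = v.
          have := congr1 (@tail n) xs.
          by rewrite tail_cons tailD tailZ tail_e0 scaler0 addr0.
        by rewrite /= -xv cons_tail.
      have xt : x ord0 ord0 + s = t.
        have := congr1 (fun z : 'rV_n.+1 => z ord0 ord0) xs.
        by rewrite rV_cons0 /= mxE [X in _ + X]mxE [X in _ * X]mxE !eqxx mulr1.
      rewrite Kv /= in_itv/= => /andP[? ?]; rewrite -xt; lra.
    rewrite in_itv/= => /andP[t1 t2].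
    (* The point of the fibre closest to [t]; the remainder [t - t'] is then at most [w] in absolute
       value. *)
    pose t' := Num.min b (Num.max a t).
    have t'ab : a <= t' <= b by rewrite /t' le_min ab le_max lexx /= ge_min lexx.
    exists (rV_cons (t', v)).
      have : [set t : measurableTypeR R | K (rV_cons (t, v))] t' by rewrite Kv /= in_itv.
      by [].
    exists ((t - t') *: e0 R n); last by rewrite rV_cons_seg addrC subrK.
    exists (t - t') => //; rewrite /= in_itv/= /t'.
    by case: (leP a t) => ?; case: (leP b _) => ?; apply/andP; split; lra.
  rewrite Sv Kv !lebesgue_measure_itv/= !lte_fin mule1.
  case: ifPn => [_|]; last first.
    rewrite -leNgt => h; have w0' : w = 0 by lra.
    have -> : a = b by lra.
    by rewrite ltxx w0' mulr0 adde0.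
  case: ifPn => [_|]; first by rewrite -!EFinB -EFinD; congr EFin; ring.
  rewrite -leNgt => ba; have -> : a = b by lra.
  by rewrite add0e -EFinB; congr EFin; ring.
rewrite mule0 adde0.
have e (A : set 'rV[R]_n.+1) : (forall x, A x -> [set tail x | x in K] (tail x)) ->
    [set t : measurableTypeR R | A (rV_cons (t, v))] = set0.
  move=> H; apply/seteqP; split => t //= /H; rewrite tail_cons => Kv.
  by move: vT; rewrite notin_setE.
rewrite !e//; first by move=> x Kx; exists x.
move=> _ [x Kx [_ [s _ <-] <-]]; exists x => //.
by rewrite tailD tailZ tail_e0 scaler0 addr0.
Qed.

Definition shadow n (U : 'M[R]_n.+1) (K : set 'rV[R]_n.+1) : set 'rV[R]_n :=
  [set tail (x *m U) | x in K].

Lemma shadowE n (U : 'M[R]_n.+1) K : shadow U K = [set tail x | x in rotate U K].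
Proof.
apply/seteqP; split => [_ [x Kx <-]|_ [_ [x Kx <-] <-]]; last by exists x.
by exists (x *m U) => //; exists x.
Qed.

Lemma shadow_compact n (U : 'M[R]_n.+1) K : compact K -> compact (shadow U K).
Proof. by move=> cK; rewrite shadowE; apply: tail_compact; exact: rotate_compact. Qed.

Lemma vol_add_seg n (K : set 'rV[R]_n.+1) w U : compact K -> cvx K -> 0 <= w -> ortho_mx U ->
  vol (minkowski_sum K (seg w (e0 R n *m U^T))) = vol K + 2 * w * vol (shadow U K).
Proof.
move=> cK vK w0 oU.
have cS := minkowski_compact cK (@seg_compact _ w (e0 R n *m U^T)).
rewrite -(vol_rot oU (compact_mx_measurable cS)) -(vol_rot oU (compact_mx_measurable cK)).
rewrite rotate_minkowski rotate_seg -mulmxA (mulmx1C oU) mulmx1 shadowE.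
by apply: vol_add_seg_e0 => //; [exact: rotate_compact|exact: rotate_cvx].
Qed.

End Segments.

(** * Zonotopes: volumes of sums and support functions *)

Section Zonotope.
Variables (R : realType) (n : nat).
Implicit Types (K : set 'rV[R]_n.+1) (l : seq (R * 'M[R]_n.+1)).

(* A direction is encoded by an orthogonal matrix whose transpose maps the
   first basis vector to it. *)
Definition zon l : set 'rV[R]_n.+1 :=
  foldr (fun p Z => minkowski_sum (seg p.1 (e0 R n *m p.2^T)) Z) [set 0] l.

Definition zon_data l := forall p, p \in l -> 0 <= p.1 /\ ortho_mx p.2.

Lemma zon_dataS p l : zon_data (p :: l) -> [/\ 0 <= p.1, ortho_mx p.2 & zon_data l].
Proof.
move=> H; have [|p0 op] := H p; first by rewrite mem_head.
by split => // q ql; apply: H; rewrite inE ql orbT.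
Qed.

Lemma zon_compact l : compact (zon l).
Proof.
elim: l => [|p l IH] /=.
  by apply: closed_ebounded_compact; [exact: (@closed_set1_mx R 1 n.+1)|exists 0 => // x ->; rewrite /rball/= dot0l expr0n].
by apply: minkowski_compact => //; exact: seg_compact.
Qed.

Lemma zon_cvx l : cvx (zon l).
Proof.
elim: l => [|p l IH] /=; first by move=> x y t -> -> _ _; rewrite !scaler0 addr0.
by apply: minkowski_cvx => //; exact: seg_cvx.
Qed.

Lemma zon0 l : zon_data l -> zon l 0.
Proof.
elim: l => [//|p l IH] /zon_dataS[p0 op /IH l0] /=.
by exists 0; [exact: seg0|exists 0 => //; rewrite addr0].
Qed.

Lemma minkowski0 m (K : set 'rV[R]_m) : minkowski_sum K [set 0] = K.
Proof.
apply/seteqP; split => [_ [x Kx [_ -> <-]]|x Kx]; first by rewrite addr0.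
by exists x => //; exists 0; rewrite ?addr0.
Qed.

Lemma shadow_le U K K' : compact K -> compact K' -> K `<=` K' ->
  vol (shadow U K) <= vol (shadow U K').
Proof.
move=> cK cK' KK'; apply: vol_le; [exact: shadow_compact|exact: shadow_compact|].
by move=> _ [x Kx <-]; exists x => //; exact: KK'.
Qed.

(** The segments are added one at a time. The shadow that enters at each stage contains that of [K]
    and is contained in that of the full sum, which gives this bound and its counterpart
    [zon_vol_le]. *)
Lemma zon_vol_ge l K : zon_data l -> compact K -> cvx K ->
  vol K + \sum_(p <- l) 2 * p.1 * vol (shadow p.2 K) <= vol (minkowski_sum K (zon l)).
Proof.
elim: l K => [|p l IH] K; first by rewrite big_nil addr0 minkowski0.
move=> /zon_dataS[p0 op gl] cK vK; rewrite big_cons /= minkowskiA.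
have cKs := minkowski_compact cK (@seg_compact R n.+1 p.1 (e0 R n *m p.2^T)).
have vKs := minkowski_cvx vK (@seg_cvx R n.+1 p.1 (e0 R n *m p.2^T)).
apply: le_trans (IH _ gl cKs vKs); rewrite vol_add_seg// addrA lerD2l.
rewrite !big_seq; apply: ler_sum => q ql; have [q0 _] := gl q ql.
rewrite ler_wpM2l ?mulr_ge0//; apply: shadow_le => //.
by apply: minkowski_sub; exact: seg0.
Qed.

Lemma zon_vol_le l K : zon_data l -> compact K -> cvx K ->
  vol (minkowski_sum K (zon l)) <=
  vol K + \sum_(p <- l) 2 * p.1 * vol (shadow p.2 (minkowski_sum K (zon l))).
Proof.
elim: l K => [|p l IH] K; first by rewrite big_nil addr0 minkowski0.
move=> /zon_dataS[p0 op gl] cK vK; rewrite big_cons /= minkowskiA.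
have cKs := minkowski_compact cK (@seg_compact R n.+1 p.1 (e0 R n *m p.2^T)).
have vKs := minkowski_cvx vK (@seg_cvx R n.+1 p.1 (e0 R n *m p.2^T)).
apply: le_trans (IH _ gl cKs vKs) _; rewrite vol_add_seg// addrA lerD2r lerD2l.
rewrite ler_wpM2l ?mulr_ge0//; apply: shadow_le => //.
  by apply: minkowski_compact => //; exact: zon_compact.
apply: subset_trans (minkowski_sub (zon0 gl)).
by apply: minkowski_sub; exact: seg0.
Qed.

Lemma dot_dir (U : 'M[R]_n.+1) v : dot (e0 R n *m U^T) v = (v *m U) ord0 ord0.
Proof. by rewrite dotC dotE trmx_mul trmxK mulmxA -dotE dot_e0r. Qed.

(** The support function of the zonotope, as [zon_supp_le] and [zon_supp_eq] show. *)
Definition zsupp l (v : 'rV[R]_n.+1) := \sum_(p <- l) p.1 * `|(v *m p.2) ord0 ord0|.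

Lemma zon_supp_le l x v : zon_data l -> zon l x -> dot x v <= zsupp l v.
Proof.
elim: l x => [|p l IH] x; first by move=> _ ->; rewrite /zsupp big_nil dot0l.
move=> /zon_dataS[p0 op gl] [_ [t + <-] [z zz <-]]; rewrite /= in_itv/= -ler_norml => tp.
rewrite /zsupp big_cons dotDl lerD ?IH// dotZl dot_dir.
by apply: le_trans (ler_norm _) _; rewrite normrM ler_wpM2r.
Qed.

Lemma zon_supp_eq l v : zon_data l -> exists2 x, zon l x & dot x v = zsupp l v.
Proof.
elim: l => [|p l IH]; first by move=> _; exists 0; rewrite ?dot0l /zsupp ?big_nil.
move=> /zon_dataS[p0 op /IH[z zz zv]].
pose t := p.1 * (-1) ^+ ((v *m p.2) ord0 ord0 < 0)%R.
exists (t *: (e0 R n *m p.2^T) + z).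
  exists (t *: (e0 R n *m p.2^T)); last by exists z.
  exists t => //; rewrite /= in_itv/= -ler_norml normrM normrX normrN1 expr1n mulr1.
  by rewrite ger0_norm.
by rewrite dotDl zv /zsupp big_cons dotZl dot_dir /t -mulrA -normrEsign.
Qed.

(** The bound on the support function is tested in the direction of the point [x] itself. *)
Lemma zon_sub_ball l b : 0 <= b -> zon_data l -> (forall v, zsupp l v <= b * enorm v) ->
  zon l `<=` dilate b (@eball R n.+1).
Proof.
move=> b0 gl lb x zx; apply/dilate_eballE => //.
have := le_trans (zon_supp_le x gl zx) (lb x).
rewrite -enorm_sq expr2; have [x0|x0] := eqVneq (enorm x) 0; first by rewrite x0.
by rewrite ler_pM2r// lt_def x0 enorm_ge0.
Qed.

(** A point of the ball outside the zonotope would be strictly separated from it, against the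
    comparison of the support functions in the normal direction. *)
Lemma ball_sub_zon l b : 0 <= b -> zon_data l -> (forall v, b * enorm v <= zsupp l v) ->
  dilate b (@eball R n.+1) `<=` zon l.
Proof.
move=> b0 gl lb x /(dilate_eballE _ b0) xb; apply: contrapT => nzx.
have [v [c [zc cv]]] := separation (@zon_compact l) (@zon_cvx l) (ex_intro _ 0 (zon0 gl)) nzx.
have [y zy yv] := zon_supp_eq v gl.
have := zc y zy; rewrite dotC yv => vc.
have : dot v x <= b * enorm v.
  apply: le_trans (ler_norm _) _; apply: le_trans (dot_le _ _) _.
  by rewrite mulrC ler_wpM2r ?enorm_ge0.
move=> vx; have := lt_le_trans cv (le_trans vx (le_trans (lb v) vc)).
by rewrite ltxx.
Qed.

Definition zscale (a : R) l := [seq (a * p.1, p.2) | p <- l].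

Lemma zscale_data a l : 0 <= a -> zon_data l -> zon_data (zscale a l).
Proof.
by move=> a0 gl _ /mapP[p pl ->] /=; have [p0 op] := gl p pl; rewrite mulr_ge0.
Qed.

Lemma zsupp_scale a l v : zsupp (zscale a l) v = a * zsupp l v.
Proof. by rewrite /zsupp big_map mulr_sumr; apply: eq_bigr => p _ /=; rewrite mulrA. Qed.

End Zonotope.

(** * The mean absolute coordinate of a random unit vector *)

Section MeanWidth.
Variables (R : realType) (n : nat).
Local Open Scope ereal_scope.
Local Notation haar := (haar R n.+1).
Local Notation On := (On R n.+1).

Lemma ortho_col_le (U : 'M[R]_n.+1) i j : ortho_mx U -> (`|U i j| <= 1)%R.
Proof.
move=> oU; rewrite -(ler_pXn2r (_ : (0 < 2)%N))// ?nnegrE// expr1n real_normK ?num_real//.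
have := le_coord_dot (row i U) j; rewrite mxE => /le_trans; apply.
have /(congr1 (fun M : 'M[R]_n.+1 => M i i)) := oU; rewrite !mxE eqxx => E; rewrite -[leRHS]E.
by rewrite le_eqVlt; apply/orP; left; apply/eqP; apply: eq_bigr => k _; rewrite !mxE.
Qed.

Lemma measurable_coord_mul (v : 'rV[R]_n.+1) :
  measurable_fun setT (fun U : 'M[R]_n.+1 => (`|(v *m U) ord0 ord0|%R)%:E).
Proof.
apply/measurable_EFinP; apply: measurableT_comp; first exact: normr_measurable.
apply: measurable_mx_coordfun; apply: measurable_fun_mulmx; first exact: measurable_cst.
exact: measurable_id.
Qed.

(** The mean of [|<e, u>|] over random unit vectors [u], for a fixed unit vector [e]. It is never
    evaluated: positivity is enough until [kappa_const] determines it. *)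
Definition kappa : R := fine (\int[haar]_(U in On) (`|U ord0 ord0|%R)%:E).

Lemma kappaE : \int[haar]_(U in On) (`|U ord0 ord0|%R)%:E = kappa%:E.
Proof.
rewrite /kappa fineK// ge0_fin_numE; last by apply: integral_ge0.
apply: (@le_lt_trans _ _ (\int[haar]_(U in On) 1)); last by rewrite haar_integral_cst ltry.
apply: ge0_le_integral => //.
- exact: measurable_On.
- apply: measurable_funTS; apply/measurable_EFinP; apply: measurableT_comp => //.
  exact: measurable_mx_coord.
- by move=> U oU; rewrite lee_fin ortho_col_le.
Qed.

(** The vector [v] is [enorm v] times a rotated [e0], and left invariance removes the rotation. *)
Lemma kappa_dir v : \int[haar]_(U in On) (`|(v *m U) ord0 ord0|%R)%:E = (kappa * enorm v)%:E.
Proof.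
have [W oW vE] : exists2 W : 'M[R]_n.+1, ortho_mx W & v = enorm v *: (e0 R n *m W).
  exists (householder v); first exact: householder_orthogonal.
  rewrite scalemxAl -householderE -mulmxA.
  by have := householder_orthogonal v; rewrite /ortho_mx householderT => ->; rewrite mulmx1.
rewrite -haar_integral_On//; last exact: measurable_coord_mul.
have mf : measurable_fun setT (fun U : 'M[R]_n.+1 => ((enorm v * `|(e0 R n *m U) ord0 ord0|)%R)%:E).
  under eq_fun do rewrite EFinM.
  by apply: measurable_funeM; exact: measurable_coord_mul.
have f0 (U : 'M[R]_n.+1) : 0 <= ((enorm v * `|(e0 R n *m U) ord0 ord0|)%R)%:E.
  by rewrite lee_fin mulr_ge0 ?enorm_ge0.
transitivity (\int[haar]_U ((enorm v * `|(e0 R n *m (W *m U)) ord0 ord0|)%R)%:E).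
  apply: eq_integral => U _; rewrite {1}vE -scalemxAl [in LHS]mxE normrM.
  by rewrite ger0_norm ?enorm_ge0// mulmxA.
rewrite (haar_integral_left mf f0 oW) haar_integral_On//.
rewrite mulrC EFinM -kappaE -ge0_integralZl//.
- by apply: eq_integral => U _; rewrite /e0 -rowE mxE EFinM.
- exact: measurable_On.
- by apply: measurable_funTS; apply/measurable_EFinP; apply: measurableT_comp => //; exact: measurable_mx_coord.
- by rewrite lee_fin enorm_ge0.
Qed.

(** If the mean were zero, every entry of the first column would have mean absolute value zero; yet
    these absolute values add up to at least 1, as the column is a unit vector. *)
Lemma kappa_gt0 : (0 < kappa)%R.
Proof.
have k0 : (0 <= kappa)%R by rewrite fine_ge0// integral_ge0.
rewrite lt_def k0 andbT; apply/eqP => kz.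
have H i : \int[haar]_(U in On) (`|U i ord0|%R)%:E = 0.
  have := kappa_dir (delta_mx ord0 i); rewrite kz mul0r => E; rewrite -[RHS]E.
  by apply: eq_integral => U _; rewrite -rowE mxE.
have : \int[haar]_(U in On) 1 <= \int[haar]_(U in On) \sum_(i < n.+1) (`|U i ord0|%R)%:E.
  apply: ge0_le_integral => //.
  - exact: measurable_On.
  - apply: measurable_funTS; apply: emeasurable_sum => i.
    by apply/measurable_EFinP; apply: measurableT_comp => //; exact: measurable_mx_coord.
  - move=> U oU; rewrite sumEFin lee_fin.
    have /(congr1 (fun M : 'M[R]_n.+1 => M ord0 ord0)) := mulmx1C oU.
    rewrite !mxE eqxx => E; rewrite -[leLHS]E; apply: ler_sum => i _; rewrite mxE.
    apply: le_trans (ler_norm _) _; rewrite normrM ler_piMr//; exact: ortho_col_le.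
rewrite haar_integral_cst ge0_integral_sum//; last 2 first.
- exact: measurable_On.
- move=> i; apply: measurable_funTS; apply/measurable_EFinP.
  by apply: measurableT_comp => //; exact: measurable_mx_coord.
by rewrite big1 ?lee_fin ?ler10// => i _; exact: H.
Qed.

End MeanWidth.

(** * Zonotopes with almost uniformly distributed segments *)

Section ZonotopeApproximation.
Variables (R : realType) (n : nat).
Local Notation haar := (haar R n.+1).
Local Notation On := (On R n.+1).

(** Some value of [q] comes within [e] of its mean over [D]. If [D] is a null set, the integral
    vanishes and any point serves. *)
Lemma le_integral_point d (X : measurableType d) (mu : {measure set X -> \bar R})
    (D : set X) (q : X -> R) (M e : R) :
  measurable D -> D !=set0 -> (mu D < +oo)%E -> measurable_fun D q ->
  (forall x, D x -> 0 <= q x <= M) -> 0 < e ->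
  exists2 x, D x & (\int[mu]_(x in D) (q x)%:E <= ((q x + e) * fine (mu D))%:E)%E.
Proof.
move=> mD [x0 Dx0] muD mq qM e0; apply: contrapT => H.
have muDE : mu D = (fine (mu D))%:E by rewrite fineK// ge0_fin_numE.
set w := fine (mu D) in muDE H *.
have w0 : 0 <= w by rewrite fine_ge0.
have {}H x : D x -> (((q x + e) * w)%:E < \int[mu]_(x in D) (q x)%:E)%E.
  by move=> Dx; rewrite ltNge; apply/negP => H'; apply: H; exists x.
have mqE : measurable_fun D (fun x => (q x)%:E) by apply/measurable_EFinP.
have q0 x : D x -> (0 <= (q x)%:E)%E by move=> /qM /andP[? _]; rewrite lee_fin.
have bound c : 0 <= c -> (forall x, D x -> q x <= c) ->
    (\int[mu]_(x in D) (q x)%:E <= (c * w)%:E)%E.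
  move=> c0 qc; rewrite EFinM -muDE -integral_cst//; apply: ge0_le_integral => //.
have M0 : 0 <= M by have /andP[a b] := qM _ Dx0; exact: le_trans a b.
have [I IE] : exists I, (\int[mu]_(x in D) (q x)%:E)%E = I%:E.
  exists (fine (\int[mu]_(x in D) (q x)%:E)%E); rewrite fineK// ge0_fin_numE ?integral_ge0//.
  by apply: le_lt_trans (bound M M0 _) _; [move=> x /qM /andP[]|exact: ltry].
rewrite IE in H bound.
have [w00|w_gt0] := eqVneq w 0.
  have := H _ Dx0; rewrite w00 mulr0 lte_fin => I0.
  have := bound M M0 (fun x Dx => (andP (qM x Dx)).2).
  by rewrite w00 mulr0 lee_fin leNgt I0.
have wp : 0 < w by rewrite lt_def w_gt0.
have qle x : D x -> q x <= I / w - e.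
  by move=> /H; rewrite lte_fin -ltr_pdivlMr// -ltrBrDr => /ltW.
have c0 : 0 <= I / w - e by apply: le_trans (qle _ Dx0); have /andP[] := qM _ Dx0.
have := bound _ c0 qle; rewrite lee_fin mulrBl divfK//.
by rewrite lerBrDr gerDl pmulr_lle0// leNgt e0.
Qed.

(* Riemann sums over a fine measurable partition of the orthogonal group; the
   sample points are chosen so that [q] is not underestimated. *)
Lemma zon_approx_ge (q : 'M[R]_n.+1 -> R) (M e : R) : measurable_fun setT q ->
  (forall U, On U -> 0 <= q U <= M) -> 0 < e ->
  exists l : seq (R * 'M[R]_n.+1), [/\ zon_data l, \sum_(p <- l) p.1 = 1,
    forall v, (kappa R n - e) * enorm v <= zsupp l v,
    forall v, zsupp l v <= (kappa R n + e) * enorm v &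
    (\int[haar]_(U in On) (q U)%:E <= (\sum_(p <- l) p.1 * q p.2 + e)%:E)%E].
Proof.
move=> mq qM e0; have mO := @measurable_On R n.+1.
(* Two unit vectors in the same cell differ by less than [1 / N] in each of their [n.+1]
   coordinates, so their distance is at most [n.+1 / N <= e]. *)
pose N := (Num.truncn (n.+1%:R / e)).+1; have N0 : 0 < N%:R :> R by rewrite ltr0n.
have Ne : n.+1%:R / N%:R <= e.
  by rewrite ler_pdivrMr// mulrC -ler_pdivrMr// ltW// truncnS_gt.
pose T := {ffun 'I_n.+1 -> 'I_(2 * N).+1}.
(* The cells restrict only the first column of [U], on which alone the support function depends. As
   entries lie in [[-1, 1]], the shifted and scaled ones lie in [[0, 2 * N]], both ends included,
   which gives [2 * N + 1] indices. *)
pose cell (c : T) := On `&` [set U : 'M[R]_n.+1 | forall i,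
  ((c i)%:R <= (U i ord0 + 1) * N%:R) && ((U i ord0 + 1) * N%:R < (c i).+1%:R)].
have mcell c : measurable (cell c).
  apply: measurableI => //.
  rewrite (_ : [set U | _] = \bigcap_(i in [set: 'I_n.+1]) ((fun U : 'M[R]_n.+1 => (U i ord0 + 1) * N%:R) @^-1`
      `[(c i)%:R, (c i).+1%:R[)); last first.
    apply/seteqP; split => U /= H i; first by move=> _ /=; rewrite in_itv/=; exact: H.
    by have := H i I; rewrite /= in_itv.
  apply: fin_bigcap_measurable => // i _; apply: measurable_preim; last exact: measurable_itv.
  apply: measurable_funM; last exact: measurable_cst.
  by apply: measurable_funD; [exact: measurable_mx_coord|exact: measurable_cst].
have cellP U : On U -> exists c, cell c U.
  move=> oU.
  have b i : 0 <= (U i ord0 + 1) * N%:R <= (2 * N)%:R.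
    have := ortho_col_le i ord0 oU; rewrite ler_norml => /andP[a b].
    rewrite natrM mulr_ge0 ?ler_wpM2r//=; lra.
  have lt i : (Num.truncn ((U i ord0 + 1) * N%:R) < (2 * N).+1)%N.
    have /andP[b1 b2] := b i.
    by rewrite ltnS -(ler_nat R); apply: le_trans b2; rewrite truncn_le.
  exists [ffun i => Ordinal (lt i)]; split => // i; rewrite ffunE /=.
  have /andP[b1 b2] := b i; exact: truncn_itv.
have cell_uniq c c' U : cell c U -> cell c' U -> c = c'.
  move=> [_ H] [_ H']; apply/ffunP => i; apply/val_inj => /=.
  have /andP[a b] := H i; have /andP[a' b'] := H' i.
  have := le_lt_trans a b'; have := le_lt_trans a' b.
  by rewrite !ltr_nat !ltnS => x y; apply/eqP; rewrite eqn_leq x y.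
have near c U V : cell c U -> cell c V -> forall v,
    `|(v *m U) ord0 ord0| <= `|(v *m V) ord0 ord0| + e * enorm v.
  move=> [_ H] [_ H'] v; rewrite -lerBlDl; apply: le_trans (lerB_dist _ _) _.
  rewrite -(dot_dir U) -(dot_dir V) -dotNl -dotDl; apply: le_trans (dot_le _ _) _.
  rewrite ler_wpM2r ?enorm_ge0//; apply: le_trans Ne.
  have p0 : 0 <= n.+1%:R / N%:R :> R by rewrite divr_ge0.
  rewrite -(ler_pXn2r (_ : (0 < 2)%N))// ?nnegrE ?enorm_ge0// enorm_sq.
  apply: (@le_trans _ _ (\sum_(i < n.+1) N%:R^-1 ^+ 2)).
    rewrite /dot /e0 -!rowE; apply: ler_sum => i _; rewrite -expr2 !mxE.
    rewrite -[X in X <= _]real_normK ?num_real// ler_pXn2r ?nnegrE ?invr_ge0//.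
    have /andP[a b] := H i; have /andP[a' b'] := H' i.
    rewrite -(ler_pM2r N0) mulVf ?gt_eqF// -[X in _ * X]ger0_norm ?ler0n// -normrM ler_norml.
    have -> : (U i 0 - V i 0) * N%:R = (U i ord0 + 1) * N%:R - (V i ord0 + 1) * N%:R.
      by rewrite -mulrBl opprD addrACA subrr addr0.
    move: a b a' b'; rewrite -natr1.
    move: ((U i ord0 + 1) * N%:R) ((V i ord0 + 1) * N%:R) ((c i)%:R : R) => x y z a b a' b'.
    by apply/andP; split; lra.
  rewrite sumr_const card_ord -[leLHS]mulr_natl exprMn; apply: ler_wpM2r; first by rewrite exprn_ge0 ?invr_ge0.
  by rewrite expr2 ler_peMr// ler1n.
have /choice[rep repP] : forall c, exists U, [/\ ortho_mx U, cell c !=set0 -> cell c U &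
    (\int[haar]_(V in cell c) (q V)%:E <= ((q U + e) * fine (haar (cell c)))%:E)%E].
  move=> c; have [[x cx]|c0] := pselect (cell c !=set0).
    have [||||U cU qU] := @le_integral_point _ _ haar (cell c) q M e (mcell c) (ex_intro _ x cx).
    - by apply: le_lt_trans (probability_le1 _ (mcell c)) _; exact: ltry.
    - exact: measurable_funTS.
    - by move=> V [oV _]; exact: qM.
    - by [].
    - by exists U; split => //; case: cU.
  (* An empty cell gets an arbitrary orthogonal matrix; its weight in the sum is zero. *)
  exists 1%:M; split => //; first exact: ortho_mx1.
  have -> : cell c = set0 by apply/nonemptyPn.
  by rewrite integral_set0 measure0 mulr0.
pose w c := fine (haar (cell c)).
have wE c : haar (cell c) = (w c)%:E.
  rewrite fineK// ge0_fin_numE//.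
  by apply: le_lt_trans (probability_le1 _ (mcell c)) _; exact: ltry.
have w0 c : 0 <= w c by exact: fine_ge0.
have indic_sum (g : T -> R) U c : cell c U -> \sum_c' g c' * \1_(cell c') U = g c.
  move=> cU; rewrite (bigD1 c)//= indicE mem_set// mulr1 big1 ?addr0// => c' c'c.
  rewrite indicE memNset ?mulr0// => c'U; move/eqP: c'c; apply; exact: cell_uniq c'U cU.
have mind c : measurable_fun setT (fun U : 'M[R]_n.+1 => (\1_(cell c) U : R)).
  exact: measurable_indic.
have wsum (g : T -> R) : (forall c, 0 <= g c) ->
    (\int[haar]_(U in On) (\sum_c g c * \1_(cell c) U)%:E = (\sum_c w c * g c)%:E)%E.
  move=> g0; under eq_integral do rewrite -sumEFin.
  rewrite ge0_integral_sum//; last 2 first.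
  - move=> c; apply: measurable_funTS; apply/measurable_EFinP.
    by apply: measurable_funM => //; exact: measurable_cst.
  - by move=> c U _; rewrite lee_fin mulr_ge0.
  rewrite -sumEFin; apply: eq_bigr => c _.
  under eq_integral do rewrite EFinM.
  rewrite ge0_integralZl//; last 2 first.
  - by apply: measurable_funTS; apply/measurable_EFinP.
  - by rewrite lee_fin.
  rewrite integral_indic// (_ : cell c `&` On = cell c); last first.
    by apply/seteqP; split => U [] //; case.
  by rewrite [X in (_ * X)%E]wE mulrC.
exists [seq (w c, rep c) | c <- enum T]; split.
- by move=> _ /mapP[c _ ->] /=; have [] := repP c.
- rewrite big_map big_enum /=; apply: EFin_inj.
  transitivity ((\sum_c w c * 1)%:E : \bar R); first by congr EFin; apply: eq_bigr => c _; rewrite mulr1.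
  rewrite -wsum//; transitivity (\int[haar]_(U in On) (1 : \bar R))%E; last exact: haar_integral_cst.
  apply: eq_integral => U; rewrite inE => /cellP[c cU].
  by rewrite (indic_sum (fun=> 1) _ c).
- move=> v; rewrite mulrBl lerBlDr -lee_fin -kappa_dir /zsupp big_map big_enum/= EFinD.
  pose g c := `|(v *m rep c) ord0 ord0|; have g0 c : 0 <= g c by exact: normr_ge0.
  rewrite -[X in (_ <= X + _)%E](wsum g g0).
  rewrite -[X in (_ <= _ + X)%E](haar_integral_cst n.+1) -ge0_integralD//; last 3 first.
  - by move=> U _; rewrite lee_fin sumr_ge0// => c _; rewrite mulr_ge0.
  - apply: measurable_funTS; apply/measurable_EFinP; apply: measurable_sum => c.
    by apply: measurable_funM => //; exact: measurable_cst.
  - by move=> U _; rewrite lee_fin mulr_ge0 ?enorm_ge0// ltW.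
  apply: ge0_le_integral => //.
  - by apply: measurable_funTS; exact: measurable_coord_mul.
  - apply: emeasurable_funD; last exact: measurable_cst.
    apply: measurable_funTS; apply/measurable_EFinP; apply: measurable_sum => c.
    by apply: measurable_funM => //; exact: measurable_cst.
  - move=> U /cellP[c cU]; rewrite (indic_sum g _ c)// -EFinD lee_fin.
    by apply: (near c) => //; have [_ H _] := repP c; apply: H; exists U.
- move=> v; rewrite mulrDl -lee_fin EFinD -kappa_dir /zsupp big_map big_enum/=.
  pose g c := `|(v *m rep c) ord0 ord0|; have g0 c : 0 <= g c by exact: normr_ge0.
  rewrite -[X in (X <= _)%E](wsum g g0).
  rewrite -[X in (_ <= _ + X)%E](haar_integral_cst n.+1) -ge0_integralD//; last 2 first.
  - by apply: measurable_funTS; exact: measurable_coord_mul.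
  - by move=> U _; rewrite lee_fin mulr_ge0 ?enorm_ge0// ltW.
  apply: ge0_le_integral => //.
  - by move=> U _; rewrite lee_fin sumr_ge0// => c _; rewrite mulr_ge0.
  - apply: measurable_funTS; apply/measurable_EFinP; apply: measurable_sum => c.
    by apply: measurable_funM => //; exact: measurable_cst.
  - apply: emeasurable_funD; last exact: measurable_cst.
    by apply: measurable_funTS; exact: measurable_coord_mul.
  - move=> U /cellP[c cU]; rewrite (indic_sum g _ c)// -EFinD lee_fin.
    by apply: (near c) => //; have [_ H _] := repP c; apply: H; exists U.
- rewrite big_map big_enum/=.
  have -> : (\int[haar]_(U in On) (q U)%:E = \sum_c \int[haar]_(U in cell c) (q U)%:E)%E.
    transitivity (\int[haar]_(U in On) (\sum_c (q U * \1_(cell c) U)%:E))%E.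
      apply: eq_integral => U; rewrite inE => /cellP[c cU].
      by rewrite sumEFin (indic_sum (fun=> q U) _ c).
    rewrite ge0_integral_sum//; last 2 first.
    - move=> c; apply: measurable_funTS; apply/measurable_EFinP; exact: measurable_funM.
    - by move=> c U oU; rewrite lee_fin mulr_ge0//; have /andP[] := qM U oU.
    apply: eq_bigr => c _.
    have {2}-> : cell c = On `&` cell c by apply/seteqP; split => U [] //= oU H; split.
    rewrite integral_mkcondr; apply: eq_integral => U _; rewrite patchE indicE.
    by case: ifP => _; rewrite ?mulr1 ?mulr0.
  apply: (@le_trans _ _ (\sum_c ((q (rep c) + e) * w c)%:E)%E).
    by apply: lee_sum => c _; have [] := repP c.
  rewrite sumEFin lee_fin.
  rewrite (_ : \sum_c _ = \sum_c w c * q (rep c) + e * \sum_c w c); last first.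
    by rewrite mulr_sumr -big_split/=; apply: eq_bigr => c _; rewrite mulrDl mulrC.
  rewrite lerD2l ler_piMr ?(ltW e0)//.
  rewrite -lee_fin; have := wsum (fun=> 1) (fun=> ler01).
  under [X in _ = X%:E -> _]eq_bigr do rewrite mulr1.
  move=> <-; rewrite -[leRHS](haar_integral_cst n.+1); apply: ge0_le_integral => //.
  - by move=> U _; rewrite lee_fin sumr_ge0// => c _; rewrite mulr_ge0.
  - apply: measurable_funTS; apply/measurable_EFinP; apply: measurable_sum => c.
    by apply: measurable_funM => //; exact: measurable_cst.
  - by move=> U /cellP[c cU]; rewrite (indic_sum (fun=> 1) _ c).
Qed.

(** The preceding lemma is applied to [M - q]; since the weights add up to 1, the constant [M]
    cancels. *)
Lemma zon_approx_le (q : 'M[R]_n.+1 -> R) (M e : R) : measurable_fun setT q ->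
  (forall U, On U -> 0 <= q U <= M) -> 0 < e ->
  exists l : seq (R * 'M[R]_n.+1), [/\ zon_data l,
    forall v, (kappa R n - e) * enorm v <= zsupp l v,
    forall v, zsupp l v <= (kappa R n + e) * enorm v &
    ((\sum_(p <- l) p.1 * q p.2)%:E <= \int[haar]_(U in On) (q U)%:E + e%:E)%E].
Proof.
move=> mq qM e0; have mO := @measurable_On R n.+1.
have mq' : measurable_fun setT (fun U => M - q U) by apply: measurable_funB => //; exact: measurable_cst.
have [|l [gl l1 lb ub ql]] := @zon_approx_ge (fun U => M - q U) M e mq' _ e0.
  by move=> U /qM/andP[a b]; rewrite subr_ge0 b gerBl.
exists l; split => //.
have : (\int[haar]_(U in On) (q U)%:E + \int[haar]_(U in On) (M - q U)%:E = M%:E)%E.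
  rewrite -ge0_integralD//.
  - rewrite -[RHS](haar_integral_cst n.+1); apply: eq_integral => U _.
    by rewrite -EFinD addrC subrK.
  - by move=> U /qM/andP[]; rewrite lee_fin.
  - by apply: measurable_funTS; apply/measurable_EFinP.
  - by move=> U /qM/andP[_ H]; rewrite lee_fin subr_ge0.
  - by apply: measurable_funTS; apply/measurable_EFinP.
move: ql; have : (0 <= \int[haar]_(U in On) (M - q U)%:E)%E.
  by apply: integral_ge0 => U /qM/andP[_ H]; rewrite lee_fin subr_ge0.
have : (0 <= \int[haar]_(U in On) (q U)%:E)%E.
  by apply: integral_ge0 => U /qM/andP[H _]; rewrite lee_fin.
case: (\int[haar]_(U in On) (M - q U)%:E)%E => [b| |]//; case: (\int[haar]_(U in On) (q U)%:E)%E => [a| |]//.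
move=> _ _; rewrite lee_fin -!EFinD lee_fin => ql [] ab.
have : \sum_(p <- l) p.1 * (M - q p.2) = M - \sum_(p <- l) p.1 * q p.2.
  under eq_bigr do rewrite mulrBr.
  by rewrite sumrB -mulr_suml l1 mul1r.
lra.
Qed.

End ZonotopeApproximation.

(** * Steiner's and Kubota's formulas *)

Section HaarFubini.
Variables (R : realType) (n m : nat) (g : 'M[R]_m -> 'M[R]_n) (f : 'M[R]_n -> \bar R).
Hypotheses (mg : measurable_fun setT g) (og : forall V, ortho_mx V -> ortho_mx (g V)).
Hypotheses (mf : measurable_fun setT f) (f0 : forall U, (0 <= f U)%E).
Local Open Scope ereal_scope.

Let F (p : 'M[R]_n * 'M[R]_m) := f (p.1 *m g p.2)%R.

Let mF : measurable_fun setT F.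
Proof.
apply: measurableT_comp mf _; apply: measurable_fun_mulmx; first exact: measurable_fst.
by apply: measurableT_comp mg _; exact: measurable_snd.
Qed.

Let F0 p : 0 <= F p. Proof. exact: f0. Qed.

Lemma measurable_haar_inner :
  measurable_fun setT (fun U => \int[haar R m]_V f (U *m g V)%R).
Proof. exact: (@measurable_fun_fubini_tonelli_F _ _ _ _ _ (haar R m) F mF F0). Qed.

(** For fixed [V], right invariance absorbs [g V]. An additional average over a subgroup of
    rotations can therefore be inserted or removed. *)
Lemma haar_integral_mul :
  \int[haar R n]_U \int[haar R m]_V f (U *m g V)%R = \int[haar R n]_U f U.
Proof.
rewrite [LHS](fubini_tonelli (m1 := haar R n) (m2 := haar R m) F mF F0).
rewrite [LHS]haar_integral_On//; last 2 first.
- exact: measurable_fun_fubini_tonelli_G.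
- by move=> V; exact: integral_ge0.
rewrite [LHS](eq_integral (fun=> \int[haar R n]_U f U)) => [|V]; last first.
  by rewrite inE => oV; rewrite /F /= haar_integral_right//; exact: og.
exact: haar_integral_cst.
Qed.

End HaarFubini.

(** * Cauchy's formula: growth of parallel bodies and mean shadows *)

Section MeanShadow.
Variables (R : realType) (n : nat).
Implicit Types (K : set 'rV[R]_n.+1) (U : 'M[R]_n.+1).

Lemma measurable_shadow K : compact K ->
  measurable_fun setT (fun U => lebesgue_rV R n (shadow U K)).
Proof.
move=> cK; apply: (@measurable_image_vol R _ _ _ _ K (fun U x => tail (x *m U)) cK).
move=> z; apply: (@continuous_comp _ _ _ (fun z : 'M[R]_n.+1 * 'rV[R]_n.+1 => z.2 *m z.1) (@tail R n)).
  by apply: continuous_mulmx => w; [exact: cvg_snd|exact: cvg_fst].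
exact: continuous_tail.
Qed.

Lemma measurable_vol_shadow K : compact K -> measurable_fun setT (fun U => vol (shadow U K)).
Proof. by move=> cK; apply: measurableT_comp (measurable_shadow cK); by []. Qed.

Lemma enorm_orthogonal m (U : 'M[R]_m) x : ortho_mx U -> enorm (x *m U) = enorm x.
Proof. by move=> oU; rewrite /enorm dot_orthogonal. Qed.

Lemma enorm_tail m (x : 'rV[R]_m.+1) : enorm (tail x) <= enorm x.
Proof.
rewrite /enorm ler_wsqrtr//; have -> : dot x x = x ord0 ord0 * x ord0 ord0 + dot (tail x) (tail x).
  by rewrite -dot_cons cons_tail.
by rewrite lerDr -expr2 sqr_ge0.
Qed.

Lemma compact_sub_ball m (A : set 'rV[R]_m) : compact A ->
  exists2 r, 0 <= r & A `<=` dilate r (@eball R m).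
Proof.
move=> /compact_ebounded[r r0 Ar]; exists r => // x /Ar.
rewrite /rball /= => xr; apply/dilate_eballE => //.
by rewrite -(ler_pXn2r (_ : (0 < 2)%N))// ?nnegrE ?enorm_ge0// enorm_sq.
Qed.

Lemma shadow_ball U r : 0 <= r -> ortho_mx U ->
  shadow U (dilate r (@eball R n.+1)) `<=` dilate r (@eball R n).
Proof.
move=> r0 oU _ [x /(dilate_eballE _ r0) xr <-]; apply/dilate_eballE => //.
by apply: le_trans (enorm_tail _) _; rewrite enorm_orthogonal.
Qed.

Lemma shadowD U K r : ortho_mx U -> 0 <= r ->
  shadow U (minkowski_sum K (dilate r (@eball R n.+1))) =
  minkowski_sum (shadow U K) (dilate r (@eball R n)).
Proof.
move=> oU r0; apply/seteqP; split => [_ [_ [x Kx [y By <-]] <-]|_ [_ [x Kx <-] [y By <-]]].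
  exists (tail (x *m U)); first by exists x.
  exists (tail (y *m U)); last by rewrite mulmxDl tailD.
  by apply: (shadow_ball r0 oU); exists y.
pose z := rV_cons (0, y).
exists (x + z *m U^T); last first.
  by rewrite mulmxDl -mulmxA (mulmx1C oU) mulmx1 tailD tail_cons.
exists x => //; exists (z *m U^T) => //; apply/dilate_eballE => //.
rewrite enorm_orthogonal; last exact: ortho_mxT.
move/(dilate_eballE _ r0) : By; apply: le_trans.
by rewrite /enorm dot_cons /= mul0r add0r.
Qed.

Lemma vol_shadow_bounded K : compact K ->
  exists M, forall U, On R n.+1 U -> 0 <= vol (shadow U K) <= M.
Proof.
move=> cK; have [r r0 Kr] := compact_sub_ball cK.
exists (vol (dilate r (@eball R n))) => U oU; rewrite vol_ge0/=.
apply: vol_le; [exact: shadow_compact|exact: dilate_eball_compact|].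
by apply: subset_trans (shadow_ball r0 oU) => _ [x Kx <-]; exists x => //; exact: Kr.
Qed.

Definition mean_shadow K : R := fine (\int[haar R n.+1]_(U in On R n.+1) (vol (shadow U K))%:E)%E.

Lemma mean_shadowE K : compact K ->
  (\int[haar R n.+1]_(U in On R n.+1) (vol (shadow U K))%:E = (mean_shadow K)%:E)%E.
Proof.
move=> cK; have [M HM] := vol_shadow_bounded cK.
rewrite /mean_shadow fineK// ge0_fin_numE; last first.
  by apply: integral_ge0 => U _; rewrite lee_fin vol_ge0.
apply: (@le_lt_trans _ _ M%:E); last exact: ltry.
rewrite -[leRHS](@haar_integral_cst R n.+1); apply: ge0_le_integral => //.
- exact: measurable_On.
- by move=> U _; rewrite lee_fin vol_ge0.
- by apply: measurable_funTS; apply/measurable_EFinP; exact: measurable_vol_shadow.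
- by move=> U oU; rewrite lee_fin; have /andP[] := HM _ oU.
Qed.

Lemma le_of_forall_scaled (a b c d : R) :
  (forall e, 0 < e -> e < d -> a <= b + e * c) -> 0 < d -> a <= b.
Proof.
move=> H d0; rewrite leNgt; apply/negP => ba.
have d2 : 0 < d / 2 by rewrite divr_gt0.
have d2d : d / 2 < d by lra.
have [c0|c0] := leP c 0; first by have := H _ d2 d2d; nra.
pose e := Num.min (d / 2) ((a - b) / (2 * c)).
have e0 : 0 < e by rewrite /e lt_min !divr_gt0// ?mulr_gt0// subr_gt0.
have ed : e < d.
  by apply: le_lt_trans d2d; rewrite /e ge_min lexx.
have := H e e0 ed; apply/negP; rewrite -ltNge.
apply: (@le_lt_trans _ _ (b + (a - b) / 2)); last by lra.
have -> : (a - b) / 2 = (a - b) / (2 * c) * c by field; exact: lt0r_neq0.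
by rewrite lerD2l ler_pM2r// /e ge_min lexx orbT.
Qed.

(** Half of Cauchy's formula, in finite form: the growth of volume per unit of radius is at least
    [2 / kappa] times the mean shadow. The ball is replaced by an inscribed zonotope whose weighted
    sum of shadows is almost the mean shadow. *)
Lemma vol_add_ball_ge K h : compact K -> cvx K -> 0 <= h ->
  2 * h * mean_shadow K <=
  kappa R n * (vol (minkowski_sum K (dilate h (@eball R n.+1))) - vol K).
Proof.
move=> cK vK h0; have [M HM] := vol_shadow_bounded cK.
have cB := minkowski_compact cK (@dilate_eball_compact R n.+1 h).
set V := vol (minkowski_sum _ _).
apply: (@le_of_forall_scaled _ _ (V - vol K + 2 * h) 1) => // e e0 _.
have [l [gl l1 _ ub ql]] := @zon_approx_ge R n (fun U => vol (shadow U K)) M e (measurable_vol_shadow cK) HM e0.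
have ke : 0 < kappa R n + e by rewrite addr_gt0// kappa_gt0.
(* This scaling makes the support function of the zonotope at most [h] in every unit direction. *)
pose a := h / (kappa R n + e); have a0 : 0 <= a by rewrite divr_ge0// ltW.
have gz := zscale_data a0 gl.
have zB : zon (zscale a l) `<=` dilate h (@eball R n.+1).
  apply: zon_sub_ball => // v; rewrite zsupp_scale.
  apply: le_trans (ler_wpM2l a0 (ub v)) _; rewrite mulrA /a divfK//.
  exact: lt0r_neq0.
have := zon_vol_ge gz cK vK => H1.
have H2 : vol (minkowski_sum K (zon (zscale a l))) <= V.
  apply: vol_le => //; last exact: minkowski_le.
  by apply: minkowski_compact => //; exact: zon_compact.
have := le_trans H1 H2; rewrite big_map -lerBrDl.
rewrite (eq_bigr (fun p => 2 * a * (p.1 * vol (shadow p.2 K)))); last by move=> p _ /=; ring.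
rewrite -mulr_sumr; move: ql; rewrite mean_shadowE// lee_fin.
set S := \sum_(p <- l) _ => ql H3.
have : 2 * a * (mean_shadow K - e) <= V - vol K.
  by apply: le_trans H3; apply: ler_wpM2l; [rewrite mulr_ge0|rewrite lerBlDr].
have -> : 2 * a * (mean_shadow K - e) = 2 * h * (mean_shadow K - e) / (kappa R n + e).
  by rewrite /a; field; exact: lt0r_neq0.
rewrite ler_pdivrMr//; move: (kappa R n) => k; lra.
Qed.

(** Here the zonotope contains the ball of radius [h]. The shadows in the bound are those of the
    final sum, which lies in [K] enlarged by [2 * h]; hence the larger body on the right. *)
Lemma vol_add_ball_le K h : compact K -> cvx K -> 0 <= h ->
  kappa R n * (vol (minkowski_sum K (dilate h (@eball R n.+1))) - vol K) <=
  2 * h * mean_shadow (minkowski_sum K (dilate (2 * h) (@eball R n.+1))).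
Proof.
move=> cK vK h0; set K' := minkowski_sum K (dilate (2 * h) _).
have cK' : compact K' by apply: minkowski_compact => //; exact: dilate_eball_compact.
have [M HM] := vol_shadow_bounded cK'.
have cB := minkowski_compact cK (@dilate_eball_compact R n.+1 h).
set V := vol (minkowski_sum _ _).
move: (kappa R n) (kappa_gt0 R n) (@zon_approx_le R n) => k k0 approx.
(* Below [k / 3] one has [k + e <= 2 * (k - e)], which keeps the circumscribed zonotope inside the
   ball of radius [2 * h]. *)
apply: (@le_of_forall_scaled _ _ (V - vol K + 2 * h) (k / 3)); last by rewrite divr_gt0.
move=> e e0 ek.
have [l [gl lb ub ql]] := approx (fun U => vol (shadow U K')) M e (measurable_vol_shadow cK') HM e0.
have ke : 0 < k - e by move: ek k0; clear; lra.
pose a := h / (k - e); have a0 : 0 <= a by rewrite divr_ge0// ltW.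
have gz := zscale_data a0 gl.
have Bz : dilate h (@eball R n.+1) `<=` zon (zscale a l).
  apply: ball_sub_zon => // v; rewrite zsupp_scale.
  apply: le_trans (ler_wpM2l a0 (lb v)); rewrite mulrA /a divfK//.
  exact: lt0r_neq0.
have zB : zon (zscale a l) `<=` dilate (2 * h) (@eball R n.+1).
  apply: zon_sub_ball => //; first by rewrite mulr_ge0.
  move=> v; rewrite zsupp_scale; apply: le_trans (ler_wpM2l a0 (ub v)) _.
  rewrite mulrA ler_wpM2r ?enorm_ge0// /a mulrAC ler_pdivrMr//.
  have : h * (k + e) <= h * (2 * (k - e)) by rewrite ler_wpM2l//; move: ek k0; clear; lra.
  by clear; lra.
have cz : compact (minkowski_sum K (zon (zscale a l))).
  by apply: minkowski_compact => //; exact: zon_compact.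
have H1 : V <= vol (minkowski_sum K (zon (zscale a l))) by apply: vol_le => //; exact: minkowski_le.
have := le_trans H1 (zon_vol_le gz cK vK); rewrite -lerBlDl => H2.
have : V - vol K <= 2 * a * \sum_(p <- l) p.1 * vol (shadow p.2 K').
  apply: le_trans H2 _; rewrite big_map mulr_sumr !big_seq; apply: ler_sum => p pl /=.
  have [p0 _] := gl p pl.
  rewrite [leRHS](_ : _ = 2 * (a * p.1) * vol (shadow p.2 K')); last by ring.
  apply: ler_wpM2l; first by rewrite mulr_ge0// mulr_ge0.
  exact: (shadow_le _ cz cK' (minkowski_le zB)).
move: ql; rewrite mean_shadowE// -EFinD lee_fin.
set S := \sum_(p <- l) _ => ql H3.
have : V - vol K <= 2 * a * (mean_shadow K' + e).
  by apply: le_trans H3 _; apply: ler_wpM2l => //; rewrite mulr_ge0.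
have -> : 2 * a * (mean_shadow K' + e) = 2 * h * (mean_shadow K' + e) / (k - e).
  by rewrite /a; field; exact: lt0r_neq0.
rewrite ler_pdivlMr//; move: (mean_shadow K') (vol K) => x y; clear; lra.
Qed.

End MeanShadow.

(** * Comparison with a primitive *)

Section Telescoping.
Variable R : realType.

(* [v] is compared with a primitive of [phi] over a subdivision of step [T / N]:
   the increments differ by at most [h * (phi (s + 2 * h) - phi s)]. *)
Lemma eq_primitive (v G phi : R -> R) T : 0 <= T ->
  (forall s h, 0 <= s -> 0 <= h -> h * phi s <= v (s + h) - v s <= h * phi (s + 2 * h)) ->
  (forall s h, 0 <= s -> 0 <= h -> h * phi s <= G (s + h) - G s <= h * phi (s + 2 * h)) ->
  (forall s, 0 <= s -> 0 <= phi s) ->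
  (forall s t, 0 <= s -> s <= t -> phi s <= phi t) ->
  v T - v 0 = G T - G 0.
Proof.
move=> T0 Hv HG p0 pm.
have main N : (0 < N)%N -> `|(v T - v 0) - (G T - G 0)| * N%:R <= 2 * T * phi (3 * T).
  move=> N0; have N0' : 0 < N%:R :> R by rewrite ltr0n.
  pose h := T / N%:R; have h0 : 0 <= h by rewrite divr_ge0.
  pose s i := i%:R * h.
  have s0 i : 0 <= s i by rewrite mulr_ge0.
  have sS i : s i + h = s i.+1 by rewrite /s -natr1 mulrDl mul1r.
  have step i : `|(v (s i.+1) - v (s i)) - (G (s i.+1) - G (s i))| <=
      h * phi (s i.+2) - h * phi (s i).
    have := Hv (s i) h (s0 i) h0; have := HG (s i) h (s0 i) h0.
    have -> : s i + 2 * h = s i.+2 by rewrite -!sS; ring.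
    rewrite sS => /andP[a1 a2] /andP[b1 b2]; rewrite ler_norml; apply/andP; split; lra.
  have tel (f : R -> R) : f T - f 0 = \sum_(i < N) (f (s i.+1) - f (s i)).
    rewrite -(big_mkord xpredT (fun i => f (s i.+1) - f (s i))) telescope_sumr//.
    by rewrite /s mul0r /h mulrCA divff ?mulr1// gt_eqF.
  rewrite !tel -sumrB.
  have : `|\sum_(i < N) ((v (s i.+1) - v (s i)) - (G (s i.+1) - G (s i)))| <=
     \sum_(i < N) (h * phi (s i.+2) - h * phi (s i)).
    by apply: le_trans (ler_norm_sum _ _ _) _; apply: ler_sum => i _; exact: step.
  move=> /le_trans H; rewrite -ler_pdivlMr//; apply: H.
  (* The shift by two steps telescopes to boundary values of [phi], so the total error is of the
     order of [h = T / N]. *)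
  have -> : \sum_(i < N) (h * phi (s i.+2) - h * phi (s i)) =
     h * (phi (s N.+1) + phi (s N)) - h * (phi (s 1) + phi (s 0)).
    rewrite -(big_mkord xpredT (fun i => h * phi (s i.+2) - h * phi (s i))).
    rewrite (eq_bigr (fun i => h * (phi (s i.+2) + phi (s i.+1)) - h * (phi (s i.+1) + phi (s i)))); last by move=> i _; ring.
    by rewrite (telescope_sumr (fun i => h * (phi (s i.+1) + phi (s i)))).
  have hT : h <= T by rewrite /h ler_piMr// invf_le1// ler1n.
  have sN : s N = T by rewrite /s /h mulrCA divff ?mulr1// gt_eqF.
  have p1 : phi (s N.+1) <= phi (3 * T) by rewrite -sS sN; apply: pm; lra.
  have p2 : phi (s N) <= phi (3 * T) by rewrite sN; apply: pm; lra.
  apply: (@le_trans _ _ (h * (phi (s N.+1) + phi (s N)))).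
    by rewrite gerBl mulr_ge0// addr_ge0// p0.
  rewrite [leRHS](_ : _ = h * (phi (3 * T) + phi (3 * T))); last by rewrite /h; ring.
  by rewrite ler_wpM2l// lerD.
apply/eqP; rewrite -subr_eq0 -normr_eq0; apply/eqP; set D := `|_| in main *.
have D0 : 0 <= D by exact: normr_ge0.
have Q0 : 0 <= 2 * T * phi (3 * T) by rewrite !mulr_ge0// p0// mulr_ge0.
apply/eqP; rewrite eq_le D0 andbT leNgt; apply/negP => Dp.
pose N := (Num.truncn (2 * T * phi (3 * T) / D)).+1.
have := main N isT; rewrite leNgt => /negP; apply.
rewrite [D * _]mulrC -ltr_pdivrMr//; exact: truncnS_gt.
Qed.

Lemma subrX_bounds (s h : R) i : 0 <= s -> 0 <= h ->
  i.+1%:R * h * s ^+ i <= (s + h) ^+ i.+1 - s ^+ i.+1 <= i.+1%:R * h * (s + h) ^+ i.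
Proof.
move=> s0 h0; rewrite subrXX (_ : s + h - s = h); last by ring.
have sh : 0 <= s + h by rewrite addr_ge0.
rewrite -!mulrA ![_%:R * (h * _)]mulrCA !ler_wpM2l//=.
  rewrite mulr_natl -[X in _ *+ X]card_ord -sumr_const; apply: ler_sum => j _.
  rewrite -[in leRHS](subnK (ltnSE (ltn_ord j))) exprD ler_wpM2l ?exprn_ge0// lerXn2r ?nnegrE//.
  by rewrite lerDl.
rewrite mulr_natl -[X in _ *+ X]card_ord -sumr_const; apply: ler_sum => j _.
rewrite -[in leLHS](subnK (ltnSE (ltn_ord j))) exprD ler_wpM2r ?exprn_ge0// lerXn2r ?nnegrE//.
by rewrite lerDl.
Qed.

End Telescoping.

(** * Kubota's averages as the coefficients of Steiner's polynomial *)

Section Kubota.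
Variable R : realType.

Fixpoint tl n i {struct n} : 'rV[R]_n -> 'rV[R]_(n - i) :=
  match n, i return 'rV[R]_n -> 'rV[R]_(n - i) with
  | 0, _ => fun x => x
  | n'.+1, 0 => fun x => x
  | n'.+1, i'.+1 => fun x => tl i' (tail x)
  end.

Lemma tlS n i (x : 'rV[R]_n.+1) : tl i.+1 x = tl i (tail x).
Proof. by []. Qed.

Lemma continuous_tl n i : continuous (@tl n i).
Proof.
elim: n i => [|n IH] [|i] x; [exact: cvg_id|exact: cvg_id|exact: cvg_id|].
by apply: (@continuous_comp _ _ _ (@tail R n) (@tl n i)); [exact: continuous_tail|exact: IH].
Qed.

Definition tlvol n i (K : set 'rV[R]_n) (U : 'M[R]_n) : \bar R :=
  lebesgue_rV R (n - i) [set tl i (x *m U) | x in K].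

Lemma measurable_tlvol n i (K : set 'rV[R]_n) : compact K ->
  measurable_fun setT (tlvol i K).
Proof.
move=> cK; apply: (@measurable_image_vol R _ _ _ _ K (fun U x => tl i (x *m U)) cK).
move=> z; apply: (@continuous_comp _ _ _ (fun z : 'M[R]_n * 'rV[R]_n => z.2 *m z.1) (@tl n i)).
  by apply: continuous_mulmx => w; [exact: cvg_snd|exact: cvg_fst].
exact: continuous_tl.
Qed.

(* Kubota's formula for the quermassintegrals; [tl i] is the projection onto the
   last [n - i] coordinates. *)
Definition kubota n (K : set 'rV[R]_n) (i : nat) : R :=
  omega R n / omega R (n - i) * fine (\int[haar R n]_U tlvol i K U)%E.

Lemma kubota_ge0 n (K : set 'rV[R]_n) i : 0 <= kubota K i.
Proof.
apply: mulr_ge0; first by rewrite divr_ge0// ltW// omega_gt0.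
by apply/fine_ge0/integral_ge0 => U _; exact: measure_ge0.
Qed.

Lemma enorm_tl n i (x : 'rV[R]_n) : enorm (tl i x) <= enorm x.
Proof.
elim: n i x => [|n IH] [|i] x //=; apply: le_trans (IH _ _) _; exact: enorm_tail.
Qed.

Lemma tlvolE n i (K : set 'rV[R]_n) : compact K ->
  (\int[haar R n]_U tlvol i K U = (fine (\int[haar R n]_U tlvol i K U))%:E)%E.
Proof.
move=> cK; rewrite fineK// ge0_fin_numE; last by apply: integral_ge0 => U _; exact: measure_ge0.
have [r r0 Kr] := compact_sub_ball cK.
rewrite haar_integral_On; [|exact: measurable_tlvol|by move=> U; exact: measure_ge0].
apply: (@le_lt_trans _ _ (vol (dilate r (@eball R (n - i))))%:E); last exact: ltry.
rewrite -[leRHS](@haar_integral_cst R n); apply: ge0_le_integral => //.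
- exact: measurable_On.
- by apply: measurable_funTS; exact: measurable_tlvol.
- move=> U oU; rewrite -volE; last exact: dilate_eball_compact.
  apply: le_measure; rewrite ?inE; last first.
  + move=> _ [x Kx <-]; apply/dilate_eballE => //.
    apply: le_trans (enorm_tl _ _) _; rewrite enorm_orthogonal//.
    by apply/dilate_eballE => //; exact: Kr.
  + by apply: compact_mx_measurable; exact: dilate_eball_compact.
  + apply: compact_mx_measurable; apply: image_compact => //.
    move=> x; apply: (@continuous_comp _ _ _ (fun x : 'rV[R]_n => x *m U) (@tl n i)).
      exact: continuous_mulmxr.
    exact: continuous_tl.
Qed.

Lemma tail_mulmx n (x : 'rV[R]_n.+1) (V : 'M[R]_n) : tail x *m V = tail (x *m extend0 V).
Proof.
have -> : x = row_mx (lsubmx (x : 'rV[R]_(1 + n))) (tail x) by rewrite [RHS](@hsubmxK R 1 1 n).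
rewrite {1}/tail row_mxKr /extend0.
have -> : row_mx (lsubmx (x : 'rV[R]_(1 + n))) (tail x) *m (block_mx (1%:M : 'M[R]_1) 0 0 V)
    = row_mx (lsubmx (x : 'rV[R]_(1 + n))) (tail x *m V).
  apply: etrans (@mul_row_block R 1 1 n 1 n _ _ _ _ _ _) _.
  by rewrite mulmx1 !mulmx0 addr0 add0r.
by rewrite /tail !row_mxKr.
Qed.

Lemma tlvol_shadow n i (K : set 'rV[R]_n.+1) U V :
  tlvol i (shadow U K) V = tlvol i.+1 K (U *m extend0 V).
Proof.
rewrite /tlvol; congr (lebesgue_rV R _ _); apply/seteqP.
split => [_ [_ [x Kx <-] <-]|_ [x Kx <-]].
  by exists x => //; rewrite tlS mulmxA -tail_mulmx.
by exists (tail (x *m U)); [exists x|rewrite tlS mulmxA -tail_mulmx].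
Qed.

(** A Haar rotation of R^(n+1) followed by one of the last [n] coordinates is again Haar
    distributed, so averaging the projections of shadows averages the projections of [K]. *)
Lemma mean_kubota_shadow n i (K : set 'rV[R]_n.+1) : compact K ->
  (\int[haar R n.+1]_(U in On R n.+1) (kubota (shadow U K) i)%:E =
   (omega R n / omega R n.+1 * kubota K i.+1)%:E)%E.
Proof.
move=> cK; have mt := @measurable_tlvol n.+1 i.+1 K cK.
have t0 U : (0 <= tlvol i.+1 K U)%E by exact: measure_ge0.
have mi := measurable_haar_inner (@measurable_extend0 R n) mt t0.
transitivity ((omega R n / omega R (n - i))%:E * \int[haar R n.+1]_U \int[haar R n]_V tlvol i.+1 K (U *m extend0 V))%E.
  rewrite [in RHS]haar_integral_On//; last by move=> U; exact: integral_ge0.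
  rewrite -ge0_integralZl//; last 4 first.
  - exact: measurable_On.
  - exact: measurable_funTS.
  - by move=> U _; exact: integral_ge0.
  - by rewrite lee_fin divr_ge0// ltW// omega_gt0.
  apply: eq_integral => U _; rewrite EFinM -tlvolE; last exact: shadow_compact.
  by congr (_ * _)%E; apply: eq_integral => V _; rewrite tlvol_shadow.
rewrite (haar_integral_mul (@measurable_extend0 R n) (@extend0_orthogonal R n) mt t0).
rewrite tlvolE// -EFinM /kubota subSS; congr EFin.
by field; rewrite !gt_eqF// omega_gt0.
Qed.

Lemma measurable_kubota_shadow n i (K : set 'rV[R]_n.+1) : compact K ->
  measurable_fun setT (fun U => kubota (shadow U K) i).
Proof.
move=> cK; have mt := @measurable_tlvol n.+1 i.+1 K cK.
have t0 U : (0 <= tlvol i.+1 K U)%E by exact: measure_ge0.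
have mi := measurable_haar_inner (@measurable_extend0 R n) mt t0.
apply: measurable_funM; first exact: measurable_cst.
apply: measurableT_comp; first by [].
rewrite (_ : (fun U => _) = (fun U => \int[haar R n]_V tlvol i.+1 K (U *m extend0 V))%E)//.
by apply/funext => U; apply: eq_integral => V _; rewrite tlvol_shadow.
Qed.

Lemma kubota0 n (K : set 'rV[R]_n) : compact K -> kubota K 0 = vol K.
Proof.
move=> cK; have ew : omega R n / omega R (n - 0) = 1 by rewrite subn0 divff// gt_eqF// omega_gt0.
rewrite /kubota ew mul1r haar_integral_On; [|exact: measurable_tlvol|by move=> U; exact: measure_ge0].
rewrite (eq_integral (fun=> lebesgue_rV R n K)) ?haar_integral_cst// => U.
rewrite inE => oU; rewrite -(lebesgue_rot oU (compact_mx_measurable cK)) /tlvol.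
by case: n K U {cK ew oU}.
Qed.

Lemma kubota_point n i : (i <= n)%N -> kubota [set (0 : 'rV[R]_n)] i = omega R n * (i == n)%:R.
Proof.
move=> ni; have c0 : compact [set (0 : 'rV[R]_n)].
  by apply: closed_ebounded_compact; [exact: (@closed_set1_mx R 1 n)|exists 0 => // x ->; rewrite /rball/= dot0l expr0n].
have tl0 m k : tl k (0 : 'rV[R]_m) = 0.
  elim: m k => [|m IH] [|k] //=; rewrite (_ : tail 0 = 0) ?IH//.
  by apply/rowP => j; rewrite !mxE.
have -> : kubota [set (0 : 'rV[R]_n)] i =
    omega R n / omega R (n - i) * fine (lebesgue_rV R (n - i) [set 0]).
  congr (_ * fine _); rewrite haar_integral_On; [|exact: measurable_tlvol|by move=> U; exact: measure_ge0].
  rewrite (eq_integral (fun=> lebesgue_rV R (n - i) [set 0])) ?haar_integral_cst// => U _.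
  congr (lebesgue_rV R _ _); apply/seteqP; split => [_ [_ -> <-]|_ ->]; first by rewrite mul0mx tl0.
  by exists 0 => //; rewrite mul0mx tl0.
have [->|ni'] := eqVneq i n; last first.
  have : (0 < n - i)%N by rewrite subn_gt0 ltn_neqAle ni' ni.
  by case: (n - i)%N => // m _; rewrite lebesgue_rV_set0 /= !mulr0.
have H1 : lebesgue_rV R 0 [set 0] = 1%E by rewrite /= diracE mem_set.
have -> : fine (lebesgue_rV R (n - n) [set 0]) = 1 by rewrite subnn H1.
have -> : omega R (n - n) = 1.
  rewrite subnn /omega (_ : eball (n:=0) = [set 0]) ?H1//.
  apply/seteqP; split => x _; first by rewrite /= [x]thinmx0.
  by rewrite /eball/= /dot big_ord0.
by rewrite divr1.
Qed.

Definition steiner_poly n (W : nat -> R) (s : R) := \sum_(i < n.+1) 'C(n, i)%:R * W i * s ^+ i.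

Lemma steiner_poly_ge0 n W s : 0 <= s -> (forall i, 0 <= W i) -> 0 <= steiner_poly n W s.
Proof. by move=> s0 W0; rewrite sumr_ge0// => i _; rewrite !mulr_ge0// exprn_ge0. Qed.

Lemma steiner_poly_le n W s t : 0 <= s -> s <= t -> (forall i, 0 <= W i) ->
  steiner_poly n W s <= steiner_poly n W t.
Proof.
move=> s0 st W0; apply: ler_sum => i _; rewrite ler_wpM2l ?mulr_ge0// lerXn2r ?nnegrE//.
exact: le_trans st.
Qed.

(** Taking shadows commutes with taking parallel bodies, so Steiner's formula one dimension lower
    applies to every shadow and is then averaged term by term. *)
Lemma mean_shadow_steiner n (K : set 'rV[R]_n.+1) s : compact K -> cvx K -> K !=set0 -> 0 <= s ->
  (forall L : set 'rV[R]_n, compact L -> cvx L -> L !=set0 -> forall s, 0 <= s ->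
    vol (minkowski_sum L (dilate s (@eball R n))) = steiner_poly n (kubota L) s) ->
  mean_shadow (minkowski_sum K (dilate s (@eball R n.+1))) =
  omega R n / omega R n.+1 * steiner_poly n (fun i => kubota K i.+1) s.
Proof.
move=> cK vK K0 s0 IH; apply: EFin_inj; rewrite -mean_shadowE; last first.
  by apply: minkowski_compact => //; exact: dilate_eball_compact.
transitivity (\int[haar R n.+1]_(U in On R n.+1)
   \sum_(i < n.+1) ('C(n, i)%:R * s ^+ i)%:E * (kubota (shadow U K) i)%:E)%E.
  apply: eq_integral => U; rewrite inE => oU; rewrite shadowD//.
  rewrite IH//; last 3 first.
  - exact: shadow_compact.
  - by rewrite shadowE; apply: tail_cvx; exact: rotate_cvx.
  - exact: image_neq0.
  rewrite /steiner_poly -sumEFin; apply: eq_bigr => i _; rewrite -EFinM; congr EFin; ring.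
rewrite ge0_integral_sum//; last 3 first.
- exact: measurable_On.
- move=> i; apply: measurable_funTS; apply: emeasurable_funM; first exact: measurable_cst.
  by apply/measurable_EFinP; exact: measurable_kubota_shadow.
- move=> i U _; rewrite -EFinM lee_fin; apply: mulr_ge0; last exact: kubota_ge0.
  by rewrite mulr_ge0// exprn_ge0.
rewrite /steiner_poly mulr_sumr -sumEFin; apply: eq_bigr => i _.
rewrite ge0_integralZl//; last 4 first.
- exact: measurable_On.
- by apply: measurable_funTS; apply/measurable_EFinP; exact: measurable_kubota_shadow.
- by move=> U _; rewrite lee_fin kubota_ge0.
- by rewrite lee_fin mulr_ge0// exprn_ge0.
by rewrite mean_kubota_shadow// -EFinM; congr EFin; ring.
Qed.

Lemma minkowski_ball0 n (K : set 'rV[R]_n) : minkowski_sum K (dilate 0 (@eball R n)) = K.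
Proof.
rewrite -[RHS]minkowski0; congr minkowski_sum.
apply/seteqP; split => [_ [x _ <-]|_ ->]; first by rewrite scale0r.
exact: dilate_eball0.
Qed.

(** Cauchy's formula bounds the increments of the parallel volume by values of the polynomial [phi];
    its termwise primitive [G] obeys the same bounds, so [eq_primitive] identifies the two. *)
Lemma vol_steiner_step n (K : set 'rV[R]_n.+1) T : compact K -> cvx K -> K !=set0 -> 0 <= T ->
  (forall L : set 'rV[R]_n, compact L -> cvx L -> L !=set0 -> forall s, 0 <= s ->
    vol (minkowski_sum L (dilate s (@eball R n))) = steiner_poly n (kubota L) s) ->
  vol (minkowski_sum K (dilate T (@eball R n.+1))) = vol K +
   2 * omega R n / (kappa R n * omega R n.+1) *
    \sum_(i < n.+1) 'C(n, i)%:R * kubota K i.+1 * T ^+ i.+1 / i.+1%:R.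
Proof.
move=> cK vK K0 T0 IH.
have k0 := kappa_gt0 R n; have o0 := omega_gt0 R n; have o1 := omega_gt0 R n.+1.
pose c := 2 * omega R n / (kappa R n * omega R n.+1).
have c0 : 0 <= c by rewrite divr_ge0 ?mulr_ge0// ltW.
pose v t := vol (minkowski_sum K (dilate t (@eball R n.+1))).
pose phi t := c * steiner_poly n (fun i => kubota K i.+1) t.
pose G t := c * \sum_(i < n.+1) 'C(n, i)%:R * kubota K i.+1 * t ^+ i.+1 / i.+1%:R.
have W0 i : 0 <= kubota K i.+1 by exact: kubota_ge0.
have cKs s : compact (minkowski_sum K (dilate s (@eball R n.+1))).
  by apply: minkowski_compact => //; exact: dilate_eball_compact.
have vKs s : cvx (minkowski_sum K (dilate s (@eball R n.+1))).
  by apply: minkowski_cvx => //; exact: dilate_eball_cvx.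
have phiE s h : 0 <= s -> h * phi s = 2 * h * mean_shadow (minkowski_sum K (dilate s (@eball R n.+1))) / kappa R n.
  move=> s0; rewrite (mean_shadow_steiner cK vK K0 s0 IH) /phi /c.
  by field; rewrite !gt_eqF.
have phi0 s : 0 <= s -> 0 <= phi s by move=> s0; rewrite mulr_ge0// steiner_poly_ge0.
have phim s t : 0 <= s -> s <= t -> phi s <= phi t.
  by move=> s0 st; rewrite ler_wpM2l// steiner_poly_le.
have := @eq_primitive R v G phi T T0 _ _ phi0 phim.
have -> : v 0 = vol K by rewrite /v minkowski_ball0.
have -> : G 0 = 0.
  by rewrite /G big1 ?mulr0// => i _; rewrite expr0n/= mulr0 mul0r.
rewrite subr0 => H; apply/eqP; rewrite -/(v T) addrC -subr_eq; apply/eqP; apply: H.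
- move=> s h s0 h0; rewrite !phiE//; last by rewrite addr_ge0// mulr_ge0.
  have Ks : minkowski_sum (minkowski_sum K (dilate s (@eball R n.+1))) (dilate h (@eball R n.+1)) =
      minkowski_sum K (dilate (s + h) (@eball R n.+1)) by rewrite -minkowskiA dilateD_eball.
  have Ks2 : minkowski_sum (minkowski_sum K (dilate s (@eball R n.+1))) (dilate (2 * h) (@eball R n.+1)) =
      minkowski_sum K (dilate (s + 2 * h) (@eball R n.+1)) by rewrite -minkowskiA dilateD_eball// mulr_ge0.
  have := vol_add_ball_ge (cKs s) (vKs s) h0; have := vol_add_ball_le (cKs s) (vKs s) h0.
  rewrite Ks Ks2 -/(v s) -/(v (s + h)) => H1 H2; apply/andP; split.
    by rewrite ler_pdivrMr// [leRHS]mulrC.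
  by rewrite ler_pdivlMr// [leLHS]mulrC.
- move=> s h s0 h0; rewrite /G /phi -mulrBr -sumrB ![h * (c * _)]mulrCA.
  apply/andP; split; rewrite ler_wpM2l// /steiner_poly mulr_sumr; apply: ler_sum => i _.
    have /andP[+ _] := subrX_bounds i s0 h0.
    rewrite -mulrBl -mulrBr ler_pdivlMr// => H1.
    have := ler_wpM2l (_ : 0 <= 'C(n, i)%:R * kubota K i.+1) H1; rewrite mulr_ge0//.
    by move=> /(_ isT); apply: le_trans; rewrite le_eqVlt; apply/orP; left; apply/eqP; ring.
  have /andP[_] := subrX_bounds i s0 h0.
  rewrite -mulrBl -mulrBr ler_pdivrMr// => H1.
  have := ler_wpM2l (_ : 0 <= 'C(n, i)%:R * kubota K i.+1) H1; rewrite mulr_ge0//.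
  move=> /(_ isT)/le_trans; apply.
  rewrite [leLHS](_ : _ = 'C(n, i)%:R * kubota K i.+1 * (i.+1%:R * h) * (s + h) ^+ i); last by ring.
  rewrite [leRHS](_ : _ = 'C(n, i)%:R * kubota K i.+1 * (i.+1%:R * h) * (s + 2 * h) ^+ i); last by ring.
  apply: ler_wpM2l; first by apply: mulr_ge0; [apply: mulr_ge0; [exact: ler0n|exact: kubota_ge0]|rewrite mulr_ge0].
  by rewrite lerXn2r ?nnegrE ?addr_ge0 ?mulr_ge0// lerD2l ler_peMl// ler1n.
Qed.

(* The Steiner formula for a point determines the constant of the recursion. *)
Lemma kappa_const n :
  (forall L : set 'rV[R]_n, compact L -> cvx L -> L !=set0 -> forall s, 0 <= s ->
    vol (minkowski_sum L (dilate s (@eball R n))) = steiner_poly n (kubota L) s) ->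
  2 * omega R n / (kappa R n * omega R n.+1) = n.+1%:R.
Proof.
move=> IH; have o1 := omega_gt0 R n.+1.
have c0 : compact [set (0 : 'rV[R]_n.+1)].
  by apply: closed_ebounded_compact; [exact: (@closed_set1_mx R 1 n.+1)|exists 0 => // x ->; rewrite /rball/= dot0l expr0n].
have v0 : cvx [set (0 : 'rV[R]_n.+1)] by move=> x y t -> -> _ _; rewrite !scaler0 addr0.
have := vol_steiner_step c0 v0 (ex_intro _ 0 erefl) ler01 IH.
have -> : minkowski_sum [set 0] (dilate 1 (@eball R n.+1)) = @eball R n.+1.
  apply/seteqP; split => [_ [_ -> [_ [y By <-] <-]]|x Bx]; first by rewrite scale1r add0r.
  by exists 0 => //; exists x; rewrite ?add0r//; exists x => //; rewrite scale1r.
have -> : vol [set (0 : 'rV[R]_n.+1)] = 0 by rewrite /vol lebesgue_rV_set0.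
rewrite add0r -omega_vol big_ord_recr/= big1 ?add0r => [|i _]; last first.
  have -> : kubota [set (0 : 'rV[R]_n.+1)] i.+1 = 0.
    by rewrite kubota_point ?eqSS ?ltn_eqF ?mulr0// ltnS ltnW.
  by rewrite mulr0 !mul0r.
rewrite kubota_point// eqxx binn expr1n mul1r !mulr1; set c := (2 * _ / _) => H.
have : omega R n.+1 * n.+1%:R = omega R n.+1 * c.
  by rewrite {1}H mulrA divfK ?pnatr_eq0// mulrC.
by move/mulfI => ->//; rewrite gt_eqF.
Qed.

Theorem steiner_kubota n (K : set 'rV[R]_n) s : compact K -> cvx K -> K !=set0 -> 0 <= s ->
  vol (minkowski_sum K (dilate s (@eball R n))) = steiner_poly n (kubota K) s.
Proof.
elim: n K s => [|n IH] K s cK vK K0 s0.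
  rewrite /steiner_poly big_ord1 expr0 mulr1 bin0 mul1r kubota0// /vol; congr (fine (lebesgue_rV R 0 _)).
  have [x Kx] := K0.
  apply/seteqP; split => y _; first by rewrite [y]thinmx0 -[0](thinmx0 x).
  by rewrite [y]thinmx0 -[0]addr0; exists 0; [rewrite -(thinmx0 x)|exists 0 => //; exact: dilate_eball0].
have IH' L : compact L -> cvx L -> L !=set0 -> forall s, 0 <= s ->
    vol (minkowski_sum L (dilate s (@eball R n))) = steiner_poly n (kubota L) s.
  by move=> cL vL L0 t t0; exact: IH.
rewrite (vol_steiner_step cK vK K0 s0 IH') (kappa_const IH') /steiner_poly [RHS]big_ord_recl.
rewrite bin0 mul1r expr0 mulr1 kubota0//; congr (_ + _).
rewrite mulr_sumr; apply: eq_bigr => i _; rewrite !lift0.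
have : n.+1%:R * 'C(n, i)%:R = i.+1%:R * 'C(n.+1, i.+1)%:R :> R by rewrite -!natrM mul_bin_diag.
have i0 : i.+1%:R != 0 :> R by rewrite pnatr_eq0.
move=> H; apply: (mulfI i0); rewrite [RHS]mulrA [in RHS]mulrA -H; field.
by rewrite addrC natr1.
Qed.

Lemma steiner_compact n (K : set 'rV[R]_n) : compact K -> cvx K -> K !=set0 ->
  steiner K (kubota K).
Proof.
move=> cK vK K0 a a0; rewrite volE; first by rewrite steiner_kubota.
by apply: minkowski_compact => //; exact: dilate_eball_compact.
Qed.

Lemma poly_eq_nonneg (p : {poly R}) : (forall a, 0 <= a -> p.[a] = 0) -> p = 0.
Proof.
move=> H; apply/eqP; apply: contraT => p0.
have := @max_poly_roots R p [seq i%:R | i <- iota 0 (size p)] p0.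
have -> : all (root p) [seq i%:R | i <- iota 0 (size p)].
  by apply/allP => _ /mapP[i _ ->]; rewrite /root H.
have -> : uniq [seq i%:R : R | i <- iota 0 (size p)].
  by rewrite map_inj_uniq ?iota_uniq// => i j /eqP; rewrite eqr_nat => /eqP.
by rewrite size_map size_iota ltnn => /(_ isT isT).
Qed.

Lemma steiner_uniq n (K : set 'rV[R]_n) W W' i : steiner K W -> steiner K W' -> (i <= n)%N ->
  W i = W' i.
Proof.
move=> HW HW' ni.
pose p := \poly_(i < n.+1) ('C(n, i)%:R * (W i - W' i)).
have p0 : p = 0.
  apply: poly_eq_nonneg => a a0; rewrite horner_poly.
  have : (\sum_(i < n.+1) 'C(n, i)%:R * W i * a ^+ i)%:E =
         (\sum_(i < n.+1) 'C(n, i)%:R * W' i * a ^+ i)%:E by rewrite -HW// -HW'.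
  move=> [] /eqP; rewrite -subr_eq0 -sumrB => /eqP S0; rewrite -[RHS]S0; apply: eq_bigr => j _; ring.
have := congr1 (fun q : {poly R} => q`_i) p0; rewrite coef_poly ltnS ni coef0 => /eqP.
by rewrite mulf_eq0 pnatr_eq0 -leqn0 leqNgt bin_gt0 ni/= subr_eq0 => /eqP.
Qed.

(** [xget] returns an unspecified solution of Steiner's formula, but its values at indices up to [n]
    are forced. *)
Lemma quermass_kubota n (K : set 'rV[R]_n) i : compact K -> cvx K -> K !=set0 -> (i <= n)%N ->
  quermass K i = kubota K i.
Proof.
move=> cK vK K0 ni; apply: (steiner_uniq (K := K)) => //; last exact: steiner_compact.
by rewrite /quermass; case: xgetP => [W -> //|/(_ (kubota K))]; case; exact: steiner_compact.
Qed.

(** The two projections are the same map, with values in types indexed by [j + d - j] and [d];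
    comparing only volumes avoids a cast between them. *)
Lemma tl_rsubmx j d (A : set 'rV[R]_(j + d)) :
  lebesgue_rV R (j + d - j) [set tl j x | x in A] = lebesgue_rV R d [set rsubmx x | x in A].
Proof.
elim: j A => [|j IH] A.
  have E (f g : 'rV[R]_d -> 'rV[R]_d) (B : set 'rV[R]_d) : f =1 g -> f @` B = g @` B by move=> /funext ->.
  have r0 : (fun x : 'rV[R]_(0 + d) => rsubmx x : 'rV[R]_d) =1 id.
    by move=> x; apply/rowP => i; rewrite mxE; congr (x _ _); apply/val_inj.
  transitivity (lebesgue_rV R d A); last by congr (lebesgue_rV R d _); rewrite (E _ _ A r0) image_id.
  by case: d A {E r0} => [|d] A; rewrite image_id.
transitivity (lebesgue_rV R (j + d - j) [set tl j x | x in (@tail R (j + d)) @` A]).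
  congr (lebesgue_rV R _ _); apply/seteqP; split => [_ [x Ax <-]|_ [_ [x Ax <-] <-]].
    by exists (tail x) => //; exists x.
  by exists x.
rewrite IH; congr (lebesgue_rV R d _).
have r x : rsubmx (tail (x : 'rV[R]_(j + d).+1)) = rsubmx (x : 'rV[R]_(j.+1 + d)).
  by apply/rowP => i; rewrite !mxE; congr (x _ _); apply/val_inj.
apply/seteqP; split => [_ [_ [x Ax <-] <-]|_ [x Ax <-]]; first by exists x; rewrite ?r.
by exists (tail (x : 'rV[R]_(j + d).+1)); [exists x|rewrite r].
Qed.

End Kubota.

(** * Inequalities for sections and projections *)

Section Berwald.
Variables (R : realType) (m : nat).
Notation mu := (lebesgue_rV R m).
Implicit Types (C : set 'rV[R]_m) (z : 'rV[R]_m).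

Definition homothety z (t : R) (x : 'rV[R]_m) : 'rV[R]_m := (1 - t) *: z + t *: x.

Lemma measurable_homothety z t : measurable_fun setT (homothety z t).
Proof.
apply: continuous_measurable_mx; apply: continuous_addmx; first exact: cst_continuous.
rewrite (_ : *:%R t = (fun x : 'rV[R]_m => x *m t%:M)); first exact: continuous_mulmxr.
by apply/funext => x; rewrite mul_mx_scalar.
Qed.

(** The contraction has Jacobian [t ^+ m] and maps [C] into itself, and [h] is nonnegative. *)
Lemma homothety_integral_le C z t (h : 'rV[R]_m -> \bar R) :
  measurable C -> cvx C -> C z -> 0 < t -> t <= 1 ->
  measurable_fun setT h -> (forall x, (0 <= h x)%E) ->
  ((t ^+ m)%:E * \int[mu]_(x in C) h (homothety z t x) <= \int[mu]_(x in C) h x)%E.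
Proof.
move=> mC vC Cz t0 t1 mh h0.
have tm : 0 <= t ^- m by rewrite invr_ge0 exprn_ge0// ltW.
have P : preserves mu (mscale (NngNum tm) mu) (homothety z t).
  split => [|A mA]; first exact: measurable_homothety.
  have mA' := measurable_translate ((1 - t) *: z) mA.
  have := lebesgue_scale t0 mA'.
  have -> : mu [set x | A (x + (1 - t) *: z)] = mu A by have /= := (preserves_translate ((1 - t) *: z)).2 A mA.
  by move=> E; rewrite /mscale /= -E; congr (mu _); apply/seteqP; split => x; rewrite /homothety /= addrC.
have mT : measurable_fun setT (fun x => h (homothety z t x)).
  by apply: measurableT_comp mh _; exact: measurable_homothety.
have E : (\int[mu]_(x in homothety z t @^-1` C) h (homothety z t x) =
    (t ^- m)%:E * \int[mu]_(x in C) h x)%E.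
  rewrite (preserves_integral_in P)//; last exact: measurable_funTS.
  by rewrite ge0_integral_mscale//; exact: measurable_funTS.
have tE : (\int[mu]_(x in C) h x = (t ^+ m)%:E * ((t ^- m)%:E * \int[mu]_(x in C) h x))%E.
  by rewrite muleA -EFinM divff ?mul1e// gt_eqF// exprn_gt0.
rewrite [leRHS]tE -E lee_wpmul2l ?lee_fin ?exprn_ge0 ?(ltW t0)//.
apply: ge0_subset_integral => //.
- exact: (measurable_preim (measurable_homothety z t) mC).
- exact: measurable_funTS.
- by move=> x Cx; apply: vC => //; exact: ltW.
Qed.

Section ineq.
Variables (C : set 'rV[R]_m) (a : 'rV[R]_m -> R) (M : R).
Hypotheses (mC : measurable C) (vC : cvx C) (bC : ebounded C).
Hypotheses (ma : measurable_fun setT a) (a0 : forall x, 0 <= a x) (aM : forall x, C x -> a x <= M).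
Hypothesis a_concave : forall x y t, C x -> C y -> 0 <= t -> t <= 1 ->
  (1 - t) * a x + t * a y <= a ((1 - t) *: x + t *: y).

Definition moment p : R := fine (\int[mu]_(x in C) (a x ^+ p)%:E)%E.

Let ma' p : measurable_fun setT (fun x => (a x ^+ p)%:E).
Proof. by apply/measurable_EFinP; exact: measurable_funX. Qed.

Lemma momentE p : (\int[mu]_(x in C) (a x ^+ p)%:E = (moment p)%:E)%E.
Proof.
have C0 := ebounded_lty mC bC.
rewrite /moment fineK// ge0_fin_numE; last by apply: integral_ge0 => x _; rewrite lee_fin exprn_ge0.
have [[x Cx]|/nonemptyPn ->] := pselect (C !=set0); last by rewrite integral_set0 ltry.
have M0 : 0 <= M by apply: le_trans (aM Cx).
apply: (@le_lt_trans _ _ (\int[mu]_(x in C) (M ^+ p)%:E)%E).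
  apply: ge0_le_integral => //.
  - by move=> y _; rewrite lee_fin exprn_ge0.
  - exact: measurable_funTS.
  - by move=> y Cy; rewrite lee_fin lerXn2r ?nnegrE//; exact: aM.
by rewrite integral_cst// lte_mul_pinfty// lee_fin exprn_ge0.
Qed.

Lemma moment_ge0 p : 0 <= moment p.
Proof. by apply/fine_ge0/integral_ge0 => x _; rewrite lee_fin exprn_ge0. Qed.

Lemma bernoulli_add (u s : R) p : 0 <= u -> 0 <= s ->
  u ^+ p.+1 + p.+1%:R * u ^+ p * s <= (u + s) ^+ p.+1.
Proof.
move=> u0 s0; elim: p => [|p IH]; first by rewrite expr0 !expr1 !mul1r.
rewrite [leRHS]exprS; apply: le_trans (ler_wpM2l (addr_ge0 u0 s0) IH).
rewrite -[p.+2%:R]natr1 !exprS.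
have H : 0 <= s * (p.+1%:R * u ^+ p * s) by rewrite !mulr_ge0// exprn_ge0.
by rewrite -subr_ge0; apply: le_trans H _; rewrite le_eqVlt; apply/orP; left; apply/eqP; ring.
Qed.

(* [C] is contracted towards [z] by the factor [t], which multiplies integrals by
   [t ^ m]; concavity bounds [a] from below along the contraction. *)
Lemma berwald_step z p t : C z -> 0 < t -> t < 1 ->
  p.+1%:R * t ^+ (m + p) * a z * moment p <= (m + p.+1)%:R * moment p.+1.
Proof.
move=> Cz t0 t1; have t1' := ltW t1; have s0 : 0 <= 1 - t by rewrite subr_ge0.
have H1 := homothety_integral_le mC vC Cz t0 t1' (@ma' p.+1) (fun x => exprn_ge0 _ (a0 x)).
have H2 : ((t ^+ p.+1 * moment p.+1 + p.+1%:R * t ^+ p * ((1 - t) * a z) * moment p)%:E <=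
    \int[mu]_(x in C) (a (homothety z t x) ^+ p.+1)%:E)%E.
  rewrite EFinD !EFinM -!momentE -!EFinM.
  rewrite -ge0_integralZl//; last 3 first.
  - exact: measurable_funTS.
  - by move=> x _; rewrite lee_fin exprn_ge0.
  - by rewrite lee_fin exprn_ge0// ltW.
  rewrite -ge0_integralZl//; last 3 first.
  - exact: measurable_funTS.
  - by move=> x _; rewrite lee_fin exprn_ge0.
  - by rewrite lee_fin !mulr_ge0// ?exprn_ge0// ltW.
  rewrite -ge0_integralD//; last 4 first.
  - by move=> x _; rewrite -EFinM lee_fin mulr_ge0// exprn_ge0// ltW.
  - by apply: emeasurable_funM; [exact: measurable_cst|exact: measurable_funTS].
  - by move=> x _; rewrite -EFinM lee_fin !mulr_ge0// ?exprn_ge0// ltW.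
  - by apply: emeasurable_funM; [exact: measurable_cst|exact: measurable_funTS].
  apply: ge0_le_integral => //.
  - move=> x _; rewrite -!EFinM -EFinD lee_fin addr_ge0//.
      by rewrite mulr_ge0// exprn_ge0// ltW.
    by rewrite !mulr_ge0// ?exprn_ge0// ltW.
  - by apply: emeasurable_funD; apply: emeasurable_funM; (exact: measurable_cst || exact: measurable_funTS).
  - apply: measurable_funTS; apply/measurable_EFinP; apply: measurable_funX.
    by apply: measurableT_comp ma _; exact: measurable_homothety.
  move=> x Cx; rewrite -!EFinM -EFinD lee_fin.
  have ta : 0 <= t * a x by rewrite mulr_ge0// ltW.
  have sa : 0 <= (1 - t) * a z by rewrite mulr_ge0.
  apply: (@le_trans _ _ ((t * a x + (1 - t) * a z) ^+ p.+1)); last first.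
    rewrite lerXn2r ?nnegrE ?addr_ge0// addrC; apply: a_concave => //; exact: ltW.
  apply: le_trans (bernoulli_add p ta sa).
  by rewrite !exprMn le_eqVlt; apply/orP; left; apply/eqP; ring.
have tm0 : (0 <= (t ^+ m)%:E)%E by rewrite lee_fin exprn_ge0// ltW.
have := le_trans (lee_wpmul2l tm0 H2) H1.
rewrite momentE -EFinM lee_fin.
move: (moment_ge0 p.+1) (moment_ge0 p) (a0 z); move: (moment p.+1) (moment p) (a z) => A B u A0 B0 u0 H.
have : p.+1%:R * t ^+ (m + p) * u * B * (1 - t) <= (1 - t ^+ (m + p.+1)) * A.
  rewrite mulrBl mul1r lerBrDl; apply: le_trans H.
  by rewrite addnS exprS exprD le_eqVlt; apply/orP; left; apply/eqP; rewrite exprS; ring.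
move=> {}H; rewrite -(@ler_pM2r _ (1 - t)) ?subr_gt0//; apply: le_trans H _.
(* The common factor [1 - t] is cancelled, and the geometric sum that remains is bounded by its
   number of terms. *)
have -> : 1 - t ^+ (m + p.+1) = (1 - t) * \sum_(i < m + p.+1) t ^+ i.
  by rewrite -{1}(expr1n _ (m + p.+1)) subrXX; congr (_ * _); apply: eq_bigr => i _; rewrite expr1n mul1r.
have S : \sum_(i < m + p.+1) t ^+ i <= (m + p.+1)%:R.
  rewrite -[X in _ <= X%:R]card_ord -sumr_const; apply: ler_sum => i _.
  by rewrite exprn_ile1// ltW.
rewrite -[leLHS]mulrA [leLHS]mulrC; apply: ler_wpM2r; first by rewrite subr_ge0.
exact: ler_wpM2r.
Qed.

(** The limit of [berwald_step] as [t] tends to 1; with [t = 1 - e], Bernoulli's inequality makes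
    the error linear in [e]. *)
Lemma berwald z p : C z -> p.+1%:R * a z * moment p <= (m + p.+1)%:R * moment p.+1.
Proof.
move=> Cz; set A := (leRHS); set B := (leLHS).
have B0 : 0 <= B by rewrite !mulr_ge0// moment_ge0.
suff H e : 0 < e -> e < 1 -> B <= A + e * ((m + p)%:R * B).
  exact: (@le_of_forall_scaled R B A ((m + p)%:R * B) 1).
move=> e0 e1; have := @berwald_step z p (1 - e) Cz; rewrite subr_gt0 e1 gtrBl e0 => /(_ isT isT).
rewrite -/A; have -> : p.+1%:R * (1 - e) ^+ (m + p) * a z * moment p = (1 - e) ^+ (m + p) * B.
  by rewrite /B; ring.
have : 1 - e * (m + p)%:R <= (1 - e) ^+ (m + p).
  elim: (m + p)%N => [|q IH]; first by rewrite mulr0 subr0 expr0.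
  have e1' : 0 <= 1 - e by rewrite subr_ge0 ltW.
  rewrite exprS; apply: le_trans (ler_wpM2l e1' IH); rewrite -natr1.
  have : 0 <= e * e * q%:R by rewrite !mulr_ge0// ltW.
  by move=> H; rewrite -subr_ge0; apply: le_trans H _; rewrite le_eqVlt; apply/orP; left; apply/eqP; ring.
move=> /(ler_wpM2r B0) H1 H2; have := le_trans H1 H2; rewrite mulrBl mul1r lerBlDr.
by rewrite -[_ * _ * B]mulrA.
Qed.

(** The factors [(m + i) / i] of the successive steps multiply to the binomial coefficient. *)
Lemma berwald_iter z p : C z -> a z ^+ p * moment 0 <= 'C(m + p, m)%:R * moment p.
Proof.
move=> Cz; elim: p => [|p IH]; first by rewrite addn0 binn expr0.
have := ler_wpM2l (ler0n R 'C(m + p, m)) (berwald p Cz).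
have : p.+1%:R * a z * (a z ^+ p * moment 0) <= p.+1%:R * a z * ('C(m + p, m)%:R * moment p).
  by rewrite ler_wpM2l// mulr_ge0.
move=> H1 H2; rewrite -(@ler_pM2l _ p.+1%:R) ?ltr0n//.
have -> : p.+1%:R * (a z ^+ p.+1 * moment 0) = p.+1%:R * a z * (a z ^+ p * moment 0).
  by rewrite exprS; ring.
apply: le_trans H1 _; rewrite [leLHS]mulrCA; apply: le_trans H2 _.
rewrite !mulrA -!natrM.
have -> // : ('C(m + p, m) * (m + p.+1) = p.+1 * 'C(m + p.+1, m))%N.
by rewrite addnS mulnC mul_bin_down subSn ?leq_addr// addKn.
Qed.

End ineq.

End Berwald.

(** * Fibres over a coordinate projection; the Rogers-Shephard and Jensen inequalities *)

Section Fibers.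
Variable R : realType.
Notation mu := (lebesgue_rV R).

Definition fiber m k (A : set 'rV[R]_(m + k)) (y : 'rV[R]_k) : set 'rV[R]_m :=
  [set e | A (row_mx e y)].

Definition base m k (A : set 'rV[R]_(m + k)) : set 'rV[R]_k := [set rsubmx z | z in A].

Lemma dot_row_mx m k (x x' : 'rV[R]_m) (y y' : 'rV[R]_k) :
  dot (row_mx x y) (row_mx x' y') = dot x x' + dot y y'.
Proof.
rewrite /dot big_split_ord/=; congr (_ + _); apply: eq_bigr => i _.
  by rewrite !row_mxEl.
by rewrite !row_mxEr.
Qed.

Lemma measurable_fiber m k (A : set 'rV[R]_(m + k)) y : measurable A -> measurable (fiber A y).
Proof. exact: measurable_row_slicel. Qed.

Lemma fiber_ebounded m k (A : set 'rV[R]_(m + k)) y : ebounded A -> ebounded (fiber A y).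
Proof.
move=> [r r0 Ar]; exists r => // e /Ar; rewrite /rball/= dot_row_mx; apply: le_trans.
by rewrite lerDl dot_ge0.
Qed.

Lemma fiberE m k (A : set 'rV[R]_(m + k)) y : measurable A -> ebounded A ->
  mu m (fiber A y) = (vol (fiber A y))%:E.
Proof.
move=> mA bA; rewrite /vol fineK// ebounded_fin//; first exact: measurable_fiber.
exact: fiber_ebounded.
Qed.

Lemma comb_row_mx m k (x x' : 'rV[R]_m) (y y' : 'rV[R]_k) (s t : R) :
  row_mx (s *: x + t *: x') (s *: y + t *: y') = s *: row_mx x y + t *: row_mx x' y'.
Proof. by rewrite !scale_row_mx add_row_mx. Qed.

Lemma fiber_cvx m k (A : set 'rV[R]_(m + k)) y : cvx A -> cvx (fiber A y).
Proof.
move=> cA e e' t Ae Ae' t0 t1; rewrite /fiber/=.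
have -> : y = (1 - t) *: y + t *: y by rewrite -scalerDl subrK scale1r.
by rewrite comb_row_mx; exact: cA.
Qed.

Lemma fiber_brunn_minkowski m k (A : set 'rV[R]_(m + k)) y y' (t a b : R) :
  measurable A -> cvx A -> ebounded A -> fiber A y !=set0 -> fiber A y' !=set0 ->
  0 <= t -> t <= 1 -> 0 <= a -> 0 <= b ->
  a ^+ m <= vol (fiber A y) -> b ^+ m <= vol (fiber A y') ->
  ((1 - t) * a + t * b) ^+ m <= vol (fiber A ((1 - t) *: y + t *: y')).
Proof.
move=> mA cA bA y0 y'0 t0 t1 a0 b0 ya yb; rewrite -lee_fin -fiberE//.
apply: (brunn_minkowski (A := fiber A y) (B := fiber A y')) => //.
- exact: measurable_fiber.
- exact: measurable_fiber.
- exact: measurable_fiber.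
- exact: fiber_cvx.
- exact: fiber_cvx.
- exact: fiber_ebounded.
- exact: fiber_ebounded.
- by move=> e e' Ae Ae'; rewrite /fiber/= comb_row_mx; exact: cA.
- by rewrite fiberE// lee_fin.
- by rewrite fiberE// lee_fin.
Qed.

Lemma vol_nonempty m (A : set 'rV[R]_m) : 0 < vol A -> A !=set0.
Proof. by apply: contraPP => /nonemptyPn ->; rewrite /vol measure0 ltxx. Qed.

Lemma rt_ge m (x v : R) : 0 <= x -> x ^+ m.+1 <= v -> x <= rt m.+1 v.
Proof.
move=> x0 xv; have v0 : 0 <= v by apply: le_trans xv; rewrite exprn_ge0.
by rewrite -(ler_pXn2r (_ : (0 < m.+1)%N)) ?nnegrE ?rt_ge0// rtK.
Qed.

Lemma rt0 m : rt m.+1 (0 : R) = 0.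
Proof.
apply/eqP; have := rtK m (lexx (0 : R)).
by move=> /eqP; rewrite expf_eq0.
Qed.

Definition fiber_root m k (A : set 'rV[R]_(m.+1 + k)) y := rt m.+1 (vol (fiber A y)).

Lemma fiber_root_concave m k (A : set 'rV[R]_(m.+1 + k)) y y' t :
  measurable A -> cvx A -> ebounded A -> fiber A y !=set0 -> fiber A y' !=set0 ->
  0 <= t -> t <= 1 ->
  (1 - t) * fiber_root A y + t * fiber_root A y' <= fiber_root A ((1 - t) *: y + t *: y').
Proof.
move=> mA cA bA y0 y'0 t0 t1.
have r0 z : 0 <= fiber_root A z by exact: rt_ge0.
apply: rt_ge; first by rewrite addr_ge0// mulr_ge0// subr_ge0.
by apply: fiber_brunn_minkowski => //; rewrite rtK// vol_ge0.
Qed.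

Lemma measurable_fiber_vol m k (A : set 'rV[R]_(m + k)) : measurable A ->
  measurable_fun setT (fun y => vol (fiber A y)).
Proof. by move=> mA; apply: measurableT_comp (measurable_row_voll mA). Qed.

Lemma measurable_rt m : measurable_fun setT (@rt R m.+1).
Proof. by rewrite /rt; exact: measurable_powR. Qed.

Lemma measurable_fiber_root m k (A : set 'rV[R]_(m.+1 + k)) : measurable A ->
  measurable_fun setT (fiber_root A).
Proof.
by move=> mA; exact: measurableT_comp (@measurable_rt m) (measurable_fiber_vol mA).
Qed.

Lemma fiber_rootK m k (A : set 'rV[R]_(m.+1 + k)) y : fiber_root A y ^+ m.+1 = vol (fiber A y).
Proof. by rewrite rtK// vol_ge0. Qed.

Lemma fiber_root_bounded m k (A : set 'rV[R]_(m.+1 + k)) : measurable A -> ebounded A ->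
  exists M, forall y, fiber_root A y <= M.
Proof.
move=> mA [r r0 Ar]; exists (rt m.+1 (vol (@rball R m.+1 r))) => y.
apply: rt_le; first exact: vol_ge0.
rewrite -lee_fin -fiberE//; last by exists r.
have fr : fiber A y `<=` rball r.
  move=> e /Ar; rewrite /rball/= dot_row_mx; apply: le_trans.
  by rewrite lerDl dot_ge0.
rewrite /vol fineK; last by apply: ebounded_fin; [exact: measurable_rball|exists r].
by apply: le_measure; rewrite ?inE//; [exact: measurable_fiber|exact: measurable_rball].
Qed.

Lemma integral_rsubmx m k (A : set 'rV[R]_(m + k)) (h : 'rV[R]_k -> \bar R) :
  measurable A -> measurable_fun setT h -> (forall y, (0 <= h y)%E) ->
  (\int[mu (m + k)]_(x in A) h (rsubmx x) = \int[mu k]_y (h y * mu m (fiber A y)))%E.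
Proof.
move=> mA mh h0.
have mr : measurable_fun setT (fun x : 'rV[R]_(m + k) => rsubmx x).
  by apply: continuous_measurable_mx; apply: continuous_rsubmx => x; exact: cvg_id.
rewrite integral_mkcond integral_row_mxl; last 2 first.
- apply/(measurable_restrict _ mA measurableT).
  by rewrite setTI; apply: measurable_funTS; exact: measurableT_comp mh mr.
- by move=> x; rewrite patchE; case: ifP.
apply: eq_integral => y _.
transitivity (\int[mu m]_(x in fiber A y) h y)%E.
  rewrite [RHS]integral_mkcond; apply: eq_integral => x _; rewrite !patchE row_mxKr.
  by congr (if _ then _ else _); apply/idP/idP; rewrite !inE.
by rewrite integral_cst//; exact: measurable_fiber.
Qed.

Lemma lebesgue_fiber m k (A : set 'rV[R]_(m + k)) : measurable A ->
  mu (m + k) A = (\int[mu k]_y mu m (fiber A y))%E.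
Proof. exact: lebesgue_row_mxl. Qed.

Lemma base_compact m k (A : set 'rV[R]_(m + k)) : compact A -> compact (base A).
Proof.
by apply: image_compact; apply: continuous_rsubmx => x; exact: cvg_id.
Qed.

Lemma base_cvx m k (A : set 'rV[R]_(m + k)) : cvx A -> cvx (base A).
Proof.
move=> cA _ _ t [x Ax <-] [y Ay <-] t0 t1; exists ((1 - t) *: x + t *: y); first exact: cA.
by rewrite linearD !linearZ.
Qed.

Lemma fiber_nonempty m k (A : set 'rV[R]_(m + k)) y : base A y <-> fiber A y !=set0.
Proof.
split => [[x Ax <-]|[e Ae]]; first by exists (lsubmx x); rewrite /fiber/= hsubmxK.
by exists (row_mx e y) => //; rewrite row_mxKr.
Qed.

Lemma fiber_empty m k (A : set 'rV[R]_(m + k)) y : ~ base A y -> fiber A y = set0.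
Proof. by move=> nA; apply/nonemptyPn => /fiber_nonempty. Qed.

(** On the base, in dimension [k], the root of the fibre volume is concave: its moment of order 0 is
    the volume of the base and its moment of order [d] that of [L]. For [d = 0] there is no root to
    take; nonempty fibres are points and equality holds. *)
Theorem rogers_shephard_section d k (L : set 'rV[R]_(d + k)) y : compact L -> cvx L ->
  vol (base L) * vol (fiber L y) <= 'C(k + d, k)%:R * vol L.
Proof.
move=> cL vL; have [yb|/fiber_empty ->] := pselect (base L y); last first.
  by rewrite /vol measure0 mulr0 mulr_ge0// vol_ge0.
case: d L cL vL yb => [|d'] L cL vL yb;
  have mL := compact_mx_measurable cL; have bL := compact_ebounded cL.
  rewrite addn0 binn mul1r.
  have f1 z : base L z -> vol (fiber L z) = 1 by move=> /fiber_nonempty fz; rewrite /vol lebesgue_rV0.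
  rewrite f1// mulr1 -lee_fin -volE; last exact: base_compact.
  rewrite -volE// lebesgue_fiber// -[leLHS]mul1e -integral_cst; last by apply: compact_mx_measurable; exact: base_compact.
  rewrite integral_mkcond; apply: ge0_le_integral => //.
  - by move=> z _; rewrite patchE; case: ifP.
  - apply/(measurable_restrict _ (compact_mx_measurable (base_compact cL)) measurableT).
    exact: measurable_cst.
  - exact: measurable_row_voll.
  move=> z _; rewrite patchE; case: ifPn => [zb|_]; last exact: measure_ge0.
  move: zb; rewrite inE => zb.
  by rewrite lebesgue_rV0//; exact/fiber_nonempty.
have mb := compact_mx_measurable (base_compact cL).
have [M HM] := fiber_root_bounded mL bL.
have conc x x' t : base L x -> base L x' -> 0 <= t -> t <= 1 ->
    (1 - t) * fiber_root L x + t * fiber_root L x' <= fiber_root L ((1 - t) *: x + t *: x').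
  by move=> /fiber_nonempty ? /fiber_nonempty ? t0 t1; exact: fiber_root_concave.
have := berwald_iter mb (base_cvx vL) (compact_ebounded (base_compact cL)) (measurable_fiber_root mL)
  (fun x => rt_ge0 _ _) (fun x _ => HM x) conc d'.+1 yb.
rewrite fiber_rootK.
have -> : moment (base L) (fiber_root L) 0 = vol (base L).
  by rewrite /moment; under eq_integral do rewrite expr0; rewrite integral_cst// mul1e.
have -> : moment (base L) (fiber_root L) d'.+1 = vol L.
  rewrite /moment /vol lebesgue_fiber//; congr fine.
  under eq_integral do rewrite fiber_rootK.
  rewrite integral_mkcond; apply: eq_integral => x _; rewrite patchE.
  case: ifPn; first by rewrite fiberE.
  by rewrite notin_setE => /fiber_empty ->; rewrite measure0.
by rewrite mulrC.
Qed.

(** The unions [F i] of the fibres over shrinking closed balls around [y0] decrease to the fibre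
    over [y0], as [L] is closed, and measure is continuous from above. This is what closes the
    hypograph. *)
Lemma fiber_vol_usc d k (L : set 'rV[R]_(d + k)) y0 (c : R) : compact L -> vol (fiber L y0) < c ->
  \forall y \near y0, vol (fiber L y) < c.
Proof.
move=> cL; have mL := compact_mx_measurable cL; have bL := compact_ebounded cL.
move=> yc; pose F i : set 'rV[R]_d := [set e | exists2 y, base L y &
  `|y - y0| <= i.+1%:R^-1 /\ L (row_mx e y)].
have cF i : closed (F i).
  pose E : set ('rV[R]_d * 'rV[R]_k) := [set z | `|z.2 - y0| <= i.+1%:R^-1 /\ L (row_mx z.1 z.2)].
  apply: (@closed_exists_compact _ _ _ E (base_compact cL)).
  apply: closedI.
    have cn : continuous (fun z : 'rV[R]_d * 'rV[R]_k => `|z.2 - y0|).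
      move=> z; apply: (@continuous_comp _ _ _ (fun z : 'rV[R]_d * 'rV[R]_k => z.2 - y0) (fun x => `|x|)).
        by apply: continuous_submx => [w|]; [exact: cvg_snd|exact: cst_continuous].
      exact: norm_continuous.
    exact: (closed_comp (fun z _ => cn z) (@closed_le R i.+1%:R^-1)).
  have cr : continuous (fun z : 'rV[R]_d * 'rV[R]_k => row_mx z.1 z.2).
    by apply: continuous_row_mx => z; [exact: cvg_fst|exact: cvg_snd].
  exact: (closed_comp (fun z _ => cr z) (compact_closed_rV cL)).
have mF i : measurable (F i) by apply: closed_measurable_mx.
have F0 : \bigcap_i F i = fiber L y0.
  apply/seteqP; split => [e Fe|e Le i _]; last first.
    exists y0; last by rewrite subrr normr0.
    by apply/fiber_nonempty; exists e.
  apply: contrapT => nLe.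
  have cL' : closed (L : set 'rV[R]_(d + k)) := compact_closed_rV cL.
  have cr : continuous (fun y : 'rV[R]_k => row_mx e y).
    by apply: continuous_row_mx; [exact: cst_continuous|move=> z; exact: cvg_id].
  have : nbhs y0 (~` [set y | L (row_mx e y)]).
    apply: open_nbhs_nbhs; split => //; apply: closed_openC.
    exact: (closed_comp (fun z _ => cr z) cL').
  move=> /nbhs_ballP[r /= r0 rL].
  have [i ir] : exists i : nat, i.+1%:R^-1 < r.
    by have [i] := @ltr_add_invr R 0 _ r0; rewrite add0r => ?; exists i.
  have [y _ [yi Ly]] := Fe i I; apply: (rL y) => //.
  by rewrite -ball_normE /ball_/= distrC; exact: le_lt_trans ir.
have Fdec : nonincreasing_seq F.
  move=> i j ij; apply/subsetPset => e [y yb [yj Ly]]; exists y => //; split => //.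
  by apply: le_trans yj _; rewrite lef_pV2 ?posrE ?ltr0n// ler_nat.
have bF : ebounded (F 0%N).
  have [r r0 Lr] := bL; exists r => // e [y _ [_ /Lr]]; rewrite /rball/= dot_row_mx; apply: le_trans.
  by rewrite lerDl dot_ge0.
have := nonincreasing_cvg_mu (ebounded_lty (mF 0%N) bF) mF _ Fdec.
rewrite F0 => /(_ (measurable_fiber _ mL)) Fcvg.
have [i Fi] : exists i, (mu d (F i) < c%:E)%E.
  apply: contrapT => /forallNP H.
  have : (c%:E <= mu d (fiber L y0))%E.
    rewrite -(cvg_lim _ Fcvg)//; apply: lime_ge; first by apply/cvg_ex; exists (mu d (fiber L y0)).
    by apply: nearW => i /=; rewrite leNgt; apply/negP; exact: H.
  by rewrite fiberE// lee_fin leNgt yc.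
have i0 : 0 < i.+1%:R^-1 :> R by rewrite invr_gt0.
apply: filterS (nbhsx_ballx y0 _ i0) => y; rewrite -ball_normE /ball_/= => yi; rewrite -lte_fin -fiberE//; apply: le_lt_trans Fi.
apply: le_measure; rewrite ?inE//; first exact: measurable_fiber.
move=> e Le; exists y; first by apply/fiber_nonempty; exists e.
by split => //; rewrite distrC ltW.
Qed.

Section Hypograph.
Variables (d k : nat) (L : set 'rV[R]_(d.+1 + k)).
Hypotheses (cL : compact L) (vL : cvx L).

Let mL := compact_mx_measurable cL.
Let bL := compact_ebounded cL.
Let P := base L.
Let cP := base_compact cL.
Let vP := base_cvx vL.

(** The nonnegative region under the graph of [fiber_root] over the base, the height being the first
    coordinate. Bounding a power of the height rather than the height puts it in the form of
    [fiber_brunn_minkowski]. *)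
Definition hypograph : set 'rV[R]_k.+1 := [set h : 'rV[R]_k.+1 |
  [/\ 0 <= h ord0 ord0, base L (tail h) & h ord0 ord0 ^+ d.+1 <= vol (fiber L (tail h))]].

Lemma hypograph_cvx : cvx hypograph.
Proof.
move=> h h' t [h0 hP hv] [h'0 h'P h'v] t0 t1.
have E : ((1 - t) *: h + t *: h') ord0 ord0 = (1 - t) * h ord0 ord0 + t * h' ord0 ord0.
  by rewrite !mxE.
split; rewrite ?E ?tailD ?tailZ.
- by rewrite addr_ge0// mulr_ge0// subr_ge0.
- exact: vP.
- by apply: fiber_brunn_minkowski => //; exact/fiber_nonempty.
Qed.

Lemma hypograph_compact : compact hypograph.
Proof.
have [M HM] := fiber_root_bounded mL bL.
have [r r0 Pr] := compact_ebounded cP.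
apply: closed_ebounded_compact; last first.
  exists (r + Num.max M 0); first by rewrite addr_ge0// le_max lexx orbT.
  move=> h [h0 /Pr hP hv]; rewrite /rball/= -(cons_tail h) dot_cons/= addrC.
  have hM : h ord0 ord0 <= Num.max M 0.
    by apply: le_trans (rt_ge h0 hv) _; rewrite le_max HM.
  have M0 : 0 <= Num.max M 0 by rewrite le_max lexx orbT.
  rewrite sqrrD -addrA lerD// -expr2 addrC -[leLHS]addr0 lerD//.
    by rewrite lerXn2r ?nnegrE.
  by rewrite mulrn_wge0// mulr_ge0.
have c0 : continuous (fun h : 'rV[R]_k.+1 => h ord0 ord0) by exact: coord_continuous.
have ct := @continuous_tail R k.
have -> : hypograph = [set h : 'rV[R]_k.+1 | 0 <= h ord0 ord0] `&` ((@tail R k) @^-1` P `&`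
     ~` [set h : 'rV[R]_k.+1 | vol (fiber L (tail h)) < h ord0 ord0 ^+ d.+1]).
  apply/seteqP; split => h; first by move=> [? ? ?]; split => //; split => //=; rewrite ltNge; apply/negP; rewrite negbK.
  by move=> [? [? /= H]]; split => //; rewrite leNgt; exact/negP.
apply: closedI; first exact: (closed_comp (fun z _ => c0 z) (@closed_ge R 0)).
apply: closedI; first exact: (closed_comp (fun z _ => ct z) (compact_closed_rV cP)).
apply: open_closedC; rewrite openE => h /= hv; rewrite /interior.
pose c := (vol (fiber L (tail h)) + h ord0 ord0 ^+ d.+1) / 2.
have vc : vol (fiber L (tail h)) < c by rewrite /c; lra.
have ch : c < h ord0 ord0 ^+ d.+1 by rewrite /c; lra.
have cX : continuous (fun h : 'rV[R]_k.+1 => h ord0 ord0 ^+ d.+1).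
  by move=> z; apply: (@continuous_comp _ _ _ (fun h : 'rV[R]_k.+1 => h ord0 ord0) (fun x : R => x ^+ d.+1)); [exact: c0|exact: exprn_continuous].
near=> h'; apply: (@lt_trans _ _ c).
  near: h'; exact: (ct h _ (fiber_vol_usc cL vc)).
by near: h'; apply: (cvgr_gt _ (cX h)).
Unshelve. all: by end_near.
Qed.

End Hypograph.

Section Centered.
Variables (n : nat) (Q : set 'rV[R]_n).
Hypotheses (cQ : compact Q) (pQ : 0 < vol Q) (Q0 : centered Q).

Let mQ := compact_mx_measurable cQ.
Let bQ := compact_ebounded cQ.

Lemma integrable_bounded (f : 'rV[R]_n -> R) M :
  measurable_fun setT f -> (forall x, Q x -> `|f x| <= M) -> (mu n).-integrable Q (EFin \o f).
Proof.
move=> mf fM; apply: measurable_bounded_integrable => //.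
- exact: ebounded_lty.
- exact: measurable_funTS.
- by exists M; split; [exact: num_real|move=> M' /ltW MM' x Qx; exact: le_trans (fM x Qx) MM'].
Qed.

Lemma integrable_dot u : (mu n).-integrable Q (EFin \o dot u).
Proof.
have [r r0 Qr] := compact_sub_ball cQ.
apply: (@integrable_bounded _ (enorm u * r)).
  by apply: measurable_dot; [exact: measurable_cst|exact: measurable_id].
move=> x /Qr/dilate_eballE -/(_ r0) xr; apply: le_trans (dot_le _ _) _.
by rewrite ler_wpM2l ?enorm_ge0.
Qed.

Lemma integral_coord_centered i : \int[mu n]_(x in Q) x ord0 i = 0.
Proof.
have := congr1 (fun M : 'rV[R]_n => M ord0 i) Q0; rewrite !mxE => /eqP.
by rewrite mulf_eq0 invr_eq0 gt_eqF//= => /eqP.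
Qed.

Lemma integrable_coord i : (mu n).-integrable Q (EFin \o (fun x : 'rV[R]_n => x ord0 i)).
Proof.
have := integrable_dot (delta_mx ord0 i); congr (_.-integrable _ _).
apply/funext => x /=; rewrite /dot (bigD1 i)//= big1 => [|j ji].
  by rewrite mxE !eqxx mul1r addr0.
by rewrite mxE (negPf ji) andbF mul0r.
Qed.

Lemma integral_dot_centered u : \int[mu n]_(x in Q) dot u x = 0.
Proof.
suff H (s : seq 'I_n) : (mu n).-integrable Q (EFin \o (fun x : 'rV[R]_n => \sum_(i <- s) u ord0 i * x ord0 i)) /\
    \int[mu n]_(x in Q) (\sum_(i <- s) u ord0 i * x ord0 i) = 0.
  by have [_] := H (index_enum _).
elim: s => [|i s [Is IH]].
  have E : (fun x : 'rV[R]_n => \sum_(i <- [::]) u ord0 i * x ord0 i) = cst 0 by apply/funext => x; rewrite big_nil.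
  rewrite E; split; last by rewrite Rintegral_cst// mul0r.
  by apply: (@integrable_bounded _ 0) => // x _; rewrite normr0.
have E : (fun x : 'rV[R]_n => \sum_(i <- i :: s) u ord0 i * x ord0 i) =
    (fun x => u ord0 i * x ord0 i + \sum_(i <- s) u ord0 i * x ord0 i).
  by apply/funext => x; rewrite big_cons.
have Ii : (mu n).-integrable Q (EFin \o (fun x : 'rV[R]_n => u ord0 i * x ord0 i)).
  exact: (integrableZl mQ (u ord0 i) (integrable_coord i)).
rewrite E; split; first exact: (integrableD mQ Ii Is).
rewrite RintegralD// IH addr0 RintegralZl//; last exact: integrable_coord.
by rewrite integral_coord_centered mulr0.
Qed.

(** Otherwise some linear functional would be bounded above by a negative constant on [Q], while its
    integral over the centered set [Q] is zero. *)
Lemma centered_mem0 : cvx Q -> Q 0.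
Proof.
move=> vQ; apply: contrapT => nQ.
have [v [c [Qc c0]]] := separation cQ vQ (vol_nonempty pQ) nQ.
have : \int[mu n]_(x in Q) dot v x <= \int[mu n]_(x in Q) c.
  apply: le_Rintegral => //; first exact: integrable_dot.
  by apply: (@integrable_bounded (cst c) `|c|).
rewrite integral_dot_centered Rintegral_cst//; apply/negP; rewrite -ltNge.
by rewrite dot0r in c0; rewrite pmulr_llt0.
Qed.

End Centered.

(* The point above the barycenter whose height is the average of the fibre root
   lies in the hypograph, which is compact and convex: no hyperplane separates them. *)
Lemma jensen_fiber_root m d k (Q : set 'rV[R]_(m + (d.+1 + k))) :
  compact Q -> cvx Q -> 0 < vol Q -> centered Q ->
  \int[mu _]_(x in Q) fiber_root (base Q) (rsubmx (rsubmx x)) <= vol Q * fiber_root (base Q) 0.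
Proof.
move=> cQ vQ pQ Q0; have mQ := compact_mx_measurable cQ.
set L := base Q; have cL := base_compact cQ; have vL := base_cvx vQ.
have mL := compact_mx_measurable cL; have bL := compact_ebounded cL.
pose Y (x : 'rV[R]_(m + (d.+1 + k))) : 'rV[R]_k := rsubmx (rsubmx x).
have mY : measurable_fun setT Y.
  have c1 : continuous (@id 'rV[R]_(m + (d.+1 + k))) by move=> x; exact: cvg_id.
  have c2 : continuous (fun x : 'rV[R]_(m + (d.+1 + k)) => rsubmx x) by exact: continuous_comp_rsubmx.
  by apply: continuous_measurable_mx; exact: continuous_comp_rsubmx.
have [M HM] := fiber_root_bounded mL bL.
have Ia : (mu _).-integrable Q (EFin \o (fun x => fiber_root L (Y x))).
  apply: (integrable_bounded cQ (M := M)); first exact: measurableT_comp (measurable_fiber_root mL) mY.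
  by move=> x _; rewrite ger0_norm ?rt_ge0.
set I := Rintegral _ _ _.
have hypo x : Q x -> hypograph L (rV_cons (fiber_root L (Y x), Y x)).
  move=> Qx; split; rewrite ?rV_cons0 ?tail_cons/= ?rt_ge0 ?fiber_rootK//.
  by exists (rsubmx x) => //; exists x.
suff [_ _] : hypograph L (rV_cons (I / vol Q, 0)).
  rewrite rV_cons0 tail_cons /= => H; rewrite mulrC -ler_pdivrMr//; apply: rt_ge => //.
  by rewrite divr_ge0 ?vol_ge0//; apply: Rintegral_ge0 => x _; exact: rt_ge0.
apply: contrapT => nH.
have [x0 Qx0] := vol_nonempty pQ.
have [v [c [Hc cv]]] := separation (hypograph_compact cL) (hypograph_cvx cL vL) (ex_intro _ _ (hypo x0 Qx0)) nH.
(* The horizontal part of the separating functional, pulled back to the whole space, where centering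
   makes its integral vanish; only the height is left. *)
pose u : 'rV[R]_(m + (d.+1 + k)) := row_mx 0 (row_mx 0 (tail v)).
have uE x : dot u x = dot (tail v) (Y x).
  by rewrite -(hsubmxK x) -(hsubmxK (rsubmx x)) /u !dot_row_mx !dot0l !add0r /Y !row_mxKr.
have vE s y : dot v (rV_cons (s, y)) = v ord0 ord0 * s + dot (tail v) y.
  by rewrite -{1}(cons_tail v) dot_cons.
have Iva := integrableZl mQ (v ord0 ord0) Ia.
have Iu := integrable_dot cQ u.
have : \int[mu _]_(x in Q) (v ord0 ord0 * fiber_root L (Y x) + dot u x) <= \int[mu _]_(x in Q) c.
  apply: le_Rintegral => //; first exact: (integrableD mQ Iva Iu).
    exact: (integrable_bounded cQ (f := cst c) (M := `|c|)).
  by move=> x Qx; rewrite uE -vE; apply: Hc; exact: hypo.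
rewrite RintegralD// RintegralZl// (integral_dot_centered cQ pQ Q0) addr0 Rintegral_cst// -/I.
move: cv; rewrite vE dot0r addr0 mulrA ltr_pdivlMr// => H1 H2.
by have := lt_le_trans H1 H2; rewrite ltxx.
Qed.

End Fibers.

(** * Replacing fibres by cubes, and the lower bound *)

Section Rearrangement.
Variable R : realType.
Notation mu := (lebesgue_rV R).

(** It allows the [d] coordinates to stand in front, where [fiber] takes its sections, once the [m]
    coordinates have been turned into cubes. *)
Definition swap3 m d k (x : 'rV[R]_(d + (m + k))) : 'rV[R]_(m + (d + k)) :=
  row_mx (lsubmx (rsubmx x)) (row_mx (lsubmx x) (rsubmx (rsubmx x))).

Lemma swap3E m d k (e : 'rV[R]_d) (w : 'rV[R]_m) (y : 'rV[R]_k) :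
  swap3 (row_mx e (row_mx w y)) = row_mx w (row_mx e y).
Proof. by rewrite /swap3 !(row_mxKl, row_mxKr). Qed.

Lemma measurable_swap3 m d k : measurable_fun setT (@swap3 m d k).
Proof.
have c1 : continuous (@id 'rV[R]_(d + (m + k))) by move=> x; exact: cvg_id.
have c2 : continuous (fun x : 'rV[R]_(d + (m + k)) => rsubmx x) by exact: continuous_comp_rsubmx.
apply: continuous_measurable_mx; apply: continuous_row_mx; first exact: continuous_comp_lsubmx.
by apply: continuous_row_mx; [exact: continuous_comp_lsubmx|exact: continuous_comp_rsubmx].
Qed.

Lemma preserves_swap3 m d k : preserves (mu (d + (m + k))) (mu (m + (d + k))) (@swap3 m d k).
Proof.
split => [|A mA]; first exact: measurable_swap3.
have mB := measurable_preim (@measurable_swap3 m d k) mA.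
rewrite lebesgue_row_mxl// integral_row_mxr; last 2 first.
- exact: measurable_row_voll.
- by move=> x; exact: measure_ge0.
rewrite [RHS]lebesgue_row_mxr//; apply: eq_integral => w _.
rewrite [RHS]lebesgue_row_mxl; last exact: measurable_row_slicer.
by apply: eq_integral => y _; congr (mu d _); apply/seteqP; split => e /=; rewrite swap3E.
Qed.

Lemma swap3_comb m d k (x y : 'rV[R]_(d + (m + k))) s t :
  swap3 (s *: x + t *: y) = s *: swap3 x + t *: swap3 y.
Proof. by rewrite /swap3 !linearD !linearZ /= comb_row_mx comb_row_mx. Qed.

Lemma dot_swap3 m d k (x : 'rV[R]_(d + (m + k))) : dot (swap3 x) (swap3 x) = dot x x.
Proof.
rewrite -[x]hsubmxK -[rsubmx x]hsubmxK swap3E !dot_row_mx; ring.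
Qed.

(* The fibres of [Q] over the last coordinates are replaced by cubes of the same
   volume; by the Brunn-Minkowski inequality the result is again convex. *)
Definition fiber_cube m p (Q : set 'rV[R]_(m + p)) : set 'rV[R]_(m + p) :=
  [set x | base Q (rsubmx x) /\ forall i, 0 <= lsubmx x ord0 i /\
     lsubmx x ord0 i ^+ m <= vol (fiber Q (rsubmx x))].

Section FiberCube.
Variables (m p : nat) (Q : set 'rV[R]_(m + p)).
Hypotheses (cQ : compact Q) (vQ : cvx Q).

Let mQ := compact_mx_measurable cQ.
Let bQ := compact_ebounded cQ.

Lemma fiber_fiber_cube z : base Q z ->
  fiber (fiber_cube Q) z = [set w | forall i, 0 <= w ord0 i /\ w ord0 i ^+ m <= vol (fiber Q z)].
Proof.
move=> zQ; apply/seteqP; split => w; rewrite /fiber /fiber_cube/= row_mxKr row_mxKl => H.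
  by have [] := H.
by split.
Qed.

Lemma measurable_fiber_cube : measurable (fiber_cube Q).
Proof.
have mr : measurable_fun setT (fun x : 'rV[R]_(m + p) => rsubmx x).
  by apply: continuous_measurable_mx; apply: continuous_comp_rsubmx => x; exact: cvg_id.
have ml : measurable_fun setT (fun x : 'rV[R]_(m + p) => lsubmx x).
  by apply: continuous_measurable_mx; apply: continuous_comp_lsubmx => x; exact: cvg_id.
have -> : fiber_cube Q = (fun x => rsubmx x) @^-1` base Q `&`
    \bigcap_(i in [set: 'I_m]) ([set x : 'rV[R]_(m + p) | 0 <= lsubmx x ord0 i] `&`
       [set x | 0 <= vol (fiber Q (rsubmx x)) - lsubmx x ord0 i ^+ m]).
  apply/seteqP; split => x.
    move=> [xQ H]; split => // i _; have [h1 h2] := H i; split => //=.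
    by rewrite subr_ge0.
  by move=> [xQ H]; split => // i; have [/= h1] := H i I; rewrite subr_ge0.
apply: measurableI.
  apply: (measurable_preim mr); apply: compact_mx_measurable; exact: base_compact.
apply: fin_bigcap_measurable => [|i _]; first exact: finite_finset.
have mli := measurable_mx_coordfun ord0 i ml.
have ge0 (f : 'rV[R]_(m + p) -> R) : measurable_fun setT f -> measurable [set x | 0 <= f x].
  move=> mf; rewrite (_ : [set x | _] = f @^-1` `[0, +oo[%classic).
    by apply: measurable_preim => //; exact: measurable_itv.
  by apply/seteqP; split => x /=; rewrite in_itv/= andbT.
apply: measurableI; apply: ge0 => //; apply: measurable_funB; last exact: measurable_funX.
exact: (measurableT_comp (measurable_fiber_vol mQ) mr).
Qed.

Lemma fiber_cube_cvx : cvx (fiber_cube Q).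
Proof.
move=> x y t [xQ Hx] [yQ Hy] t0 t1; split.
  by rewrite linearD !linearZ; exact: base_cvx.
move=> i; have [hx1 hx2] := Hx i; have [hy1 hy2] := Hy i.
rewrite !linearD !linearZ/= !mxE in hx1 hx2 hy1 hy2 *.
split; first by rewrite addr_ge0// mulr_ge0// subr_ge0.
by apply: fiber_brunn_minkowski => //; exact/fiber_nonempty.
Qed.

Lemma le_expn_bound (w V : R) : 0 <= w -> 0 <= V -> (0 < m)%N -> w ^+ m <= V -> w <= 1 + V.
Proof.
move=> w0 V0 m0 wV; have [w1|/ltW w1] := leP w 1; first by rewrite -[w]addr0 lerD.
by apply: le_trans (ler_eXnr m0 w1) (le_trans wV _); rewrite lerDr.
Qed.

Lemma fiber_cube_ebounded : ebounded (fiber_cube Q).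
Proof.
have [r r0 Qr] := bQ.
pose V := vol (@rball R m r); have V0 : 0 <= V by exact: vol_ge0.
have r1 : 0 <= m%:R * (1 + V) + r by rewrite addr_ge0// mulr_ge0// addr_ge0.
exists (m%:R * (1 + V) + r) => // x [[q qQ qx] Hx].
rewrite /rball/= -(hsubmxK x) dot_row_mx sqrrD.
have H1 : dot (lsubmx x) (lsubmx x) <= (m%:R * (1 + V)) ^+ 2.
  apply: (@le_trans _ _ (\sum_(i < m) (1 + V) ^+ 2)).
    apply: ler_sum => i _; have [h1 h2] := Hx i.
    have : lsubmx x ord0 i <= 1 + V.
      apply: le_expn_bound => //; first exact: leq_ltn_trans (ltn_ord i).
      apply: le_trans h2 _; rewrite -lee_fin -fiberE// /V /vol fineK; last first.
        by apply: ebounded_fin; [exact: measurable_rball|exists r].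
      apply: le_measure; rewrite ?inE; [exact: measurable_fiber|exact: measurable_rball|].
      move=> e /Qr; rewrite /rball/= dot_row_mx; apply: le_trans.
      by rewrite lerDl dot_ge0.
    by move=> h; rewrite -expr2 lerXn2r ?nnegrE// addr_ge0.
  rewrite sumr_const card_ord -[leLHS]mulr_natl exprMn; apply: ler_wpM2r; first exact: sqr_ge0.
  by case: (m) => [|m']; rewrite ?expr0n// expr2 ler_peMr// ler1n.
have H2 : dot (rsubmx x) (rsubmx x) <= r ^+ 2.
  rewrite -qx; apply: le_trans (Qr _ qQ); rewrite -{3 4}(hsubmxK q) dot_row_mx.
  by rewrite lerDr dot_ge0.
have H3 : 0 <= m%:R * (1 + V) * r *+ 2 by rewrite mulrn_wge0// mulr_ge0// mulr_ge0// addr_ge0.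
by rewrite -addrA [_ *+ 2 + _]addrC addrA -[leLHS]addr0; apply: lerD H3; exact: lerD.
Qed.

Lemma vol_fiber_cube z : mu m (fiber (fiber_cube Q) z) = mu m (fiber Q z).
Proof.
have [zQ|zQ] := pselect (base Q z); last first.
  rewrite (fiber_empty zQ) (_ : fiber (fiber_cube Q) z = set0)//.
  by apply/nonemptyPn => -[w []]; rewrite row_mxKr.
rewrite fiber_fiber_cube// fiberE//.
have f0 := vol_ge0 (fiber Q z).
case: m Q mQ bQ zQ f0 => [|m'] Q' mQ' bQ' zQ f0.
  by rewrite -fiberE// !lebesgue_rV0//; [exact/fiber_nonempty|exists 0 => -[]].
rewrite [X in mu _ X](_ : _ = cube (rt m'.+1 (vol (fiber Q' z)))); last first.
  apply/seteqP; split => w H i; have := H i; rewrite /= in_itv/=.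
    by move=> [h1 h2]; rewrite h1 rt_ge.
  by move=> /andP[h1 h2]; split => //; rewrite -[leRHS](@rtK R m')// lerXn2r ?nnegrE// rt_ge0.
by rewrite lebesgue_cube ?rt_ge0// rtK.
Qed.

End FiberCube.

Lemma fiber_root_eq0 m k (A : set 'rV[R]_(m.+1 + k)) y :
  ~ 0 < vol (fiber A y) -> fiber_root A y = 0.
Proof.
move=> /negP; rewrite -leNgt => v0; have vE : vol (fiber A y) = 0.
  by apply: le_anti; rewrite v0 vol_ge0.
by rewrite /fiber_root vE rt0.
Qed.

Lemma measurable_rsubmx m k : measurable_fun setT (fun y : 'rV[R]_(m + k) => rsubmx y).
Proof. by apply: continuous_measurable_mx; apply: continuous_comp_rsubmx => x; exact: cvg_id. Qed.

(** The integrand depends only on the last coordinates, so the integral sees [Q] through its fibre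
    volumes, which the cubes preserve; Fubini is then applied with the [d] coordinates innermost. *)
Lemma integral_fiber_cube m d k (Q : set 'rV[R]_(m + (d + k))) (h : 'rV[R]_k -> \bar R) :
  compact Q -> measurable_fun setT h -> (forall y, (0 <= h y)%E) ->
  (\int[mu (m + (d + k))]_(x in Q) h (rsubmx (rsubmx x)) =
   \int[mu (m + k)]_z (h (rsubmx z) * mu d (fiber ((@swap3 m d k) @^-1` fiber_cube Q) z)))%E.
Proof.
move=> cQ mh h0; have mQ := compact_mx_measurable cQ; have mC := measurable_fiber_cube cQ.
have mD := measurable_preim (@measurable_swap3 m d k) mC.
have mh1 p : measurable_fun setT (fun z : 'rV[R]_(p + k) => h (rsubmx z)).
  exact: measurableT_comp mh (@measurable_rsubmx p k).
have h1 p (z : 'rV[R]_(p + k)) : (0 <= h (rsubmx z))%E by [].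
transitivity (\int[mu (m + (d + k))]_(x in fiber_cube Q) h (rsubmx (rsubmx x)))%E.
  rewrite (integral_rsubmx mQ (mh1 d) (h1 d)) (integral_rsubmx mC (mh1 d) (h1 d)).
  by apply: eq_integral => z _; rewrite vol_fiber_cube.
have mh2 : measurable_fun setT (fun x : 'rV[R]_(m + (d + k)) => h (rsubmx (rsubmx x))).
  exact: measurableT_comp (mh1 d) (@measurable_rsubmx m (d + k)).
rewrite -(preserves_integral_in (preserves_swap3 m d k) mC (measurable_funTS mh2) (fun x _ => h0 _)).
rewrite -(integral_rsubmx mD (mh1 m) (h1 m)).
by apply: eq_integral => x _; rewrite /swap3 !row_mxKr.
Qed.

Lemma comb_gt0 (a b t : R) : 0 < a -> 0 < b -> 0 <= t -> t <= 1 -> 0 < (1 - t) * a + t * b.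
Proof. by move=> a0 b0 t0 t1; nra. Qed.

(** Let [a] be the root of order [d.+1] of the fibre volume of the rearranged body, a function on
    R^(m+k). One step of [berwald] compares the integrals of its powers [d.+1] and [d.+2]. The
    former is [vol Q], since rearranging preserves volume. The latter is at most the integral over
    [Q] of the root for [base Q], because each fibre of the rearranged body lies in a fibre of
    [base Q]. *)
Lemma fiber_root_average m d k (Q : set 'rV[R]_(m + (d.+1 + k))) y0 :
  compact Q -> cvx Q -> 0 < vol (fiber (base Q) y0) ->
  d.+2%:R * fiber_root (base Q) y0 * vol Q <=
  (m + (d.+1 + k)).+1%:R * \int[mu _]_(x in Q) fiber_root (base Q) (rsubmx (rsubmx x)).
Proof.
move=> cQ vQ gy0; have mQ := compact_mx_measurable cQ; have bQ := compact_ebounded cQ.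
set L := base Q; have cL := base_compact cQ; have vL := base_cvx vQ.
have mL := compact_mx_measurable cL; have bL := compact_ebounded cL.
pose C := fiber_cube Q; have mC : measurable C by exact: measurable_fiber_cube.
pose D := (@swap3 m d.+1 k) @^-1` C.
have mD : measurable D := measurable_preim (@measurable_swap3 m d.+1 k) mC.
have vD : cvx D.
  by move=> x y t Dx Dy t0 t1; rewrite /D /= swap3_comb; exact: fiber_cube_cvx.
have bD : ebounded D.
  have [r r0 Cr] := fiber_cube_ebounded cQ; exists r; first exact: r0.
  by move=> x Dx; have := Cr _ Dx; rewrite /rball/= dot_swap3.
pose a := fiber_root D.
(* Concavity of the root is available between nonempty fibres. Positive fibre volume ensures this
   and loses nothing, since the positive powers of [a] vanish elsewhere. *)
pose S := [set z : 'rV[R]_(m + k) | 0 < vol (fiber D z)].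
have mS : measurable S.
  rewrite (_ : S = (fun z => vol (fiber D z)) @^-1` `]0, +oo[%classic); last first.
    by apply/seteqP; split => z /=; rewrite in_itv/= andbT.
  by apply: measurable_preim; [exact: measurable_fiber_vol|exact: measurable_itv].
have vS : cvx S.
  move=> x y t Sx Sy t0 t1; rewrite /S/= -fiber_rootK exprn_gt0//.
  apply: lt_le_trans (fiber_root_concave mD vD bD (vol_nonempty Sx) (vol_nonempty Sy) t0 t1).
  have ax : 0 < fiber_root D x := rt_gt0 d.+1 Sx.
  have ay : 0 < fiber_root D y := rt_gt0 d.+1 Sy.
  exact: comb_gt0.
have bS : ebounded S.
  have [r r0 Dr] := bD; exists r => // z /vol_nonempty[e /Dr].
  by rewrite /rball/= dot_row_mx; apply: le_trans; rewrite lerDr dot_ge0.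
have [M HM] := fiber_root_bounded mD bD.
have conc x y t : S x -> S y -> 0 <= t -> t <= 1 ->
    (1 - t) * a x + t * a y <= a ((1 - t) *: x + t *: y).
  by move=> /vol_nonempty ? /vol_nonempty ? t0 t1; exact: fiber_root_concave.
have fD (w : 'rV[R]_m) (y : 'rV[R]_k) :
    fiber D (row_mx w y) = [set e | C (row_mx w (row_mx e y))].
  by apply/seteqP; split => e; rewrite /fiber /D/= swap3E.
(* All cubes have a corner at the origin, so above [0] the cube condition is void and the fibre is
   the whole fibre of the base. *)
have fD0 : fiber D (row_mx 0 y0) = fiber L y0.
  rewrite fD; apply/seteqP; split => e; rewrite /C /fiber_cube/= row_mxKr row_mxKl => H.
    by have [] := H.
  split => // i; rewrite mxE; split => //; rewrite expr0n gtn_eqF; first exact: vol_ge0.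
  exact: leq_ltn_trans (ltn_ord i).
have Sz0 : S (row_mx 0 y0) by rewrite /S/= fD0.
have := @berwald R (m + k) S a M mS vS bS (measurable_fiber_root mD) (fun x => rt_ge0 _ _)
   (fun x _ => HM x) conc (row_mx 0 y0) d.+1 Sz0.
have -> : a (row_mx 0 y0) = fiber_root L y0 by rewrite /a /fiber_root fD0.
have aS z : ~ S z -> a z = 0.
  exact: fiber_root_eq0.
have fibCQ := vol_fiber_cube cQ.
have momentS q : (0 < q)%N -> (\int[mu (m + k)]_(x in S) (a x ^+ q)%:E = \int[mu (m + k)]_x (a x ^+ q)%:E)%E.
  move=> q0; rewrite integral_mkcond; apply: eq_integral => x _; rewrite patchE.
  by case: ifPn => //; rewrite notin_setE => /aS ->; rewrite expr0n gtn_eqF.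
have -> : moment S a d.+1 = vol Q.
  rewrite /moment momentS//; congr fine.
  transitivity (mu (d.+1 + (m + k)) D).
    rewrite lebesgue_fiber//; apply: eq_integral => x _.
    by rewrite fiber_rootK fiberE.
  rewrite (preserves_swap3 m d.+1 k).2// !lebesgue_fiber//.
  by apply: eq_integral => x _; exact: fibCQ.
have -> : (m + k + d.+2)%:R = (m + (d.+1 + k)).+1%:R :> R by congr (_%:R); rewrite !addSn; lia.
move=> H; apply: le_trans H _; rewrite ler_wpM2l//.
pose h (y : 'rV[R]_k) : \bar R := (fiber_root L y)%:E.
have mh : measurable_fun setT h by apply/measurable_EFinP; exact: measurable_fiber_root.
have h0 y : (0 <= h y)%E by rewrite lee_fin rt_ge0.
have EQ := integral_fiber_cube cQ mh h0.
rewrite -lee_fin -(momentE (M := M) mS bS (measurable_fiber_root mD) (fun x => rt_ge0 _ _) (fun x _ => HM x)) momentS//.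
have IQ : ((\int[mu (m + (d.+1 + k))]_(x in Q) fiber_root L (rsubmx (rsubmx x)))%:E =
    \int[mu (m + (d.+1 + k))]_(x in Q) h (rsubmx (rsubmx x)))%E.
  have [ML HML] := fiber_root_bounded mL bL.
  rewrite /Rintegral fineK//; apply: integrable_fin_num => //.
  apply: (integrable_bounded cQ (f := fun x => fiber_root L (rsubmx (rsubmx x))) (M := ML)).
    by apply: measurableT_comp (measurable_fiber_root mL) _; exact: measurableT_comp (@measurable_rsubmx _ _) (@measurable_rsubmx _ _).
  by move=> x _; rewrite ger0_norm ?rt_ge0.
rewrite [leRHS]IQ EQ; apply: ge0_le_integral => //.
- by move=> x _; rewrite lee_fin exprn_ge0// rt_ge0.
- by apply/measurable_EFinP; apply: measurable_funX; exact: measurable_fiber_root.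
- apply: emeasurable_funM; first exact: measurableT_comp mh (@measurable_rsubmx _ _).
  exact: measurable_row_voll.
move=> z _; rewrite (fiberE z mD bD) -EFinM lee_fin exprS fiber_rootK.
apply: ler_wpM2r; first exact: vol_ge0.
apply: rt_le; first exact: vol_ge0.
rewrite -lee_fin -!fiberE//; apply: le_measure; rewrite ?inE; [exact: measurable_fiber|exact: measurable_fiber|].
move=> e; rewrite -{1}(hsubmxK z) fD /C /fiber_cube/= row_mxKr => -[].
by [].
Qed.

(** The mean of the root over [Q] is at least the ratio times its value at any [y], and at most its
    value at 0. Raising to the power [d] compares each fibre with the central one; integration over
    the base then gives the claim. *)
Theorem fiber_average_lower m d k (Q : set 'rV[R]_(m + (d + k))) : (0 < d)%N ->
  compact Q -> cvx Q -> 0 < vol Q -> centered Q ->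
  (d.+1%:R / (m + (d + k)).+1%:R) ^+ d * vol (base Q) <=
  vol (base (base Q)) * vol (fiber (base Q) 0).
Proof.
case: d Q => // d Q _ cQ vQ pQ Q0.
set L := base Q; have cL := base_compact cQ; have vL := base_cvx vQ.
have mL := compact_mx_measurable cL; have bL := compact_ebounded cL.
set c := (_ / _); have c0 : 0 <= c by rewrite divr_ge0.
have H y : c ^+ d.+1 * vol (fiber L y) <= vol (fiber L 0).
  have [gy|] := ltP 0 (vol (fiber L y)); last first.
    rewrite le_eqVlt ltNge vol_ge0 orbF => /eqP ->; rewrite mulr0; exact: vol_ge0.
  have := le_trans (fiber_root_average cQ vQ gy) (ler_wpM2l _ (jensen_fiber_root cQ vQ pQ Q0)).
  move=> /(_ (ler0n _ _)); rewrite -/L mulrCA [leRHS]mulrC ler_pM2r// => H.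
  rewrite -!(@fiber_rootK R d) -exprMn lerXn2r ?nnegrE ?mulr_ge0// ?rt_ge0//.
  by rewrite /c mulrAC ler_pdivrMr ?ltr0n// [leRHS]mulrC.
have cP := base_compact cL.
rewrite -lee_fin EFinM [X in (_ * X)%E](_ : _ = mu _ L); last by rewrite volE.
rewrite lebesgue_fiber// -ge0_integralZl//; last 2 first.
- exact: measurable_row_voll.
- by rewrite lee_fin exprn_ge0.
apply: (@le_trans _ _ (\int[mu k]_(y in base L) (vol (fiber L 0))%:E)%E); last first.
  rewrite integral_cst; last exact: compact_mx_measurable.
  by rewrite [X in (_ * X)%E]volE// -EFinM mulrC.
rewrite [leRHS]integral_mkcond; apply: ge0_le_integral => //.
- by move=> y _; rewrite mule_ge0// lee_fin exprn_ge0.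
- by apply: emeasurable_funM; [exact: measurable_cst|exact: measurable_row_voll].
- apply/(measurable_restrict _ (compact_mx_measurable cP) measurableT).
  exact: measurable_cst.
move=> y _; rewrite patchE; case: ifPn => [_|].
  by rewrite fiberE// -EFinM lee_fin.
by rewrite notin_setE => /fiber_empty ->; rewrite measure0 mule0.
Qed.

End Rearrangement.

(** * Integration over the Grassmannian *)

Section Frames.
Variables (R : realType).
Notation mu := (lebesgue_rV R).

(** An orthonormal basis, by rows, of the range of the projection [F]. Indexing by [p] instead of
    [\rank F] lets frames of different subspaces share one type. *)
Definition frame p n (B : 'M[R]_(p, n)) (F : 'M[R]_n) := B *m B^T = 1%:M /\ B^T *m B = F.

Lemma frame_proj p n (B : 'M[R]_(p, n)) F : frame B F ->
  [/\ F^T = F, F *m F = F, B *m F = B & F *m B^T = B^T].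
Proof.
move=> [BB BF]; have BFB : B *m F = B by rewrite -BF mulmxA BB mul1mx.
have FT : F^T = F by rewrite -BF trmx_mul trmxK.
by split => //; [rewrite -{1}BF -mulmxA BFB|rewrite -FT -trmx_mul BFB].
Qed.

Lemma frame_eqmx p n (B : 'M[R]_(p, n)) F : frame B F -> (B == F)%MS.
Proof.
move=> fB; have [_ _ BF _] := frame_proj fB.
by apply/andP; split; [rewrite -{1}BF; exact: submxMl|rewrite -fB.2; exact: submxMl].
Qed.

Lemma frame_rank p n (B : 'M[R]_(p, n)) F : frame B F -> \rank F = p.
Proof.
move=> fB; rewrite -(eqmxP (frame_eqmx fB)); apply/eqP; change (row_free B).
by apply/row_freeP; exists B^T; exact: fB.1.
Qed.

Lemma eqmx_frame p n (B : 'M[R]_(p, n)) F : F^T = F -> F *m F = F ->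
  B *m B^T = 1%:M -> (B == F)%MS -> frame B F.
Proof.
move=> FT FF BB /andP[BF FB]; split => //.
have BFB : B *m F = B by have /submxP[D ->] := BF; rewrite -mulmxA FF.
have FBB : F *m (B^T *m B) = F.
  by have /submxP[D ->] := FB; rewrite -mulmxA [B *m _]mulmxA BB mul1mx.
by rewrite -[RHS]FT -FBB !trmx_mul trmxK FT -mulmxA BFB.
Qed.

Lemma dot_row_unit n (x : 'rV[R]_n) : x *m x^T = (dot x x)%:M.
Proof. by rewrite dotE [LHS]mx11_scalar. Qed.

(** Deflation: a normalised nonzero row [x] of [F] is split off, and [F - x^T *m x] is a projection
    of smaller rank. The number of rows is existential during the induction and identified with the
    rank at the end. *)
Lemma frame_exists n (F : 'M[R]_n) : F^T = F -> F *m F = F ->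
  exists B : 'M[R]_(\rank F, n), frame B F.
Proof.
suff H r : forall F : 'M[R]_n, (\rank F <= r)%N -> F^T = F -> F *m F = F ->
    exists p (B : 'M[R]_(p, n)), frame B F.
  move=> FT FF; have [p [B fB]] := H _ F (leqnn _) FT FF.
  by have rp := frame_rank fB; case: _ / (esym rp) B fB => B fB; exists B.
elim: r => [|r IH] {}F rF FT FF.
  have F0 : F = 0 by apply/eqP; rewrite -mxrank_eq0 -leqn0.
  exists 0%N, 0; split; first by apply/matrixP => -[].
  by rewrite mulmx0 F0.
have [/eqP F0|F0] := eqVneq F 0; first by apply: IH => //; rewrite (eqP F0) mxrank0.
have [i Fi0] : exists i, row i F != 0.
  by apply/existsP; apply: contraNT F0 => /existsPn H; apply/eqP/row_matrixP => i; rewrite row0; apply/eqP; have := H i; rewrite negbK.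
pose x := (Num.sqrt (dot (row i F) (row i F)))^-1 *: row i F.
have d0 : 0 < dot (row i F) (row i F) by apply: dot_gt0.
have xx : dot x x = 1.
  rewrite /x dotZl dotZr mulrA -expr2 exprVn sqr_sqrtr ?ltW// mulVf//.
  exact: lt0r_neq0.
have xF : x *m F = x by rewrite /x -scalemxAl -row_mul FF.
have FxT : F *m x^T = x^T by rewrite -FT -trmx_mul xF.
pose G := F - x^T *m x.
have xG : x *m G = 0 by rewrite /G mulmxBr xF mulmxA dot_row_unit xx mul1mx subrr.
have GT : G^T = G by rewrite /G linearB/= FT trmx_mul trmxK.
have GxT : G *m x^T = 0 by rewrite -GT -trmx_mul xG trmx0.
have GF : G *m F = G by rewrite /G mulmxBl FF -mulmxA xF.
have GG : G *m G = G by rewrite {2}/G mulmxBr GF mulmxA GxT mul0mx subr0.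
have rG : (\rank G < \rank F)%N.
  apply: rank_ltmx; rewrite /ltmx -{1}GF submxMl /=.
  apply/negP => FG; have : (x <= G)%MS by apply: submx_trans FG; rewrite -{1}xF submxMl.
  move=> /submxP[D xD]; have : x = 0 by rewrite xD -GG mulmxA -xD xG.
  by move=> x0; move: xx; rewrite x0 dot0l => /eqP; rewrite eq_sym oner_eq0.
have [p [B [BB BG]]] := IH G (leq_trans rG rF : (\rank G <= r)%N) GT GG.
have Bx : B *m x^T = 0.
  have -> : B = B *m G by rewrite -BG mulmxA BB mul1mx.
  by rewrite -mulmxA GxT mulmx0.
exists (1 + p)%N, (col_mx x B); split.
  rewrite tr_col_mx mul_col_row dot_row_unit xx Bx BB.
  have -> : x *m B^T = 0 by rewrite -[x]trmxK -trmx_mul Bx trmx0.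
  by rewrite -scalar_mx_block.
by rewrite tr_col_mx mul_row_col BG /G addrC subrK.
Qed.

Lemma onb_frame n (F : 'M[R]_n) : F^T = F -> F *m F = F -> frame (onb F) F.
Proof.
move=> FT FF; have [B fB] := frame_exists FT FF.
have [h1 h2] : onb F *m (onb F)^T = 1%:M /\ (onb F == F)%MS.
  by rewrite /onb; case: xgetP => [B' -> []//|/(_ B)]; case; split; [exact: fB.1|exact: frame_eqmx].
exact: eqmx_frame.
Qed.

Lemma frame_dot p n (B : 'M[R]_(p, n)) F x y : frame B F -> dot (x *m B) (y *m B) = dot x y.
Proof. by move=> [BB _]; rewrite !dotE trmx_mul mulmxA -(mulmxA x) BB mulmx1. Qed.

Lemma frame_change p n (B B' : 'M[R]_(p, n)) F : frame B F -> frame B' F ->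
  ortho_mx (B' *m B^T) /\ B' = (B' *m B^T) *m B.
Proof.
move=> fB fB'; have [_ _ _ _] := frame_proj fB; have [_ _ B'F _] := frame_proj fB'.
split; last by rewrite -mulmxA fB.2 B'F.
rewrite /ortho_mx trmx_mul trmxK mulmxA -(mulmxA B') fB.2 B'F; exact: fB'.1.
Qed.

Lemma frame_rotate p n (B : 'M[R]_(p, n)) F W : ortho_mx W -> frame B F ->
  frame (B *m W) (W^T *m F *m W).
Proof.
move=> oW [BB BF]; split; rewrite trmx_mul.
  by rewrite mulmxA -(mulmxA B) oW mulmx1.
by rewrite -!mulmxA (mulmxA B^T) BF.
Qed.

Lemma frame_orthogonal p q n (B : 'M[R]_(p, n)) (C : 'M[R]_(q, n)) F :
  frame B F -> frame C (orthocompl F) -> B *m C^T = 0.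
Proof.
move=> fB fC; have [_ _ BF _] := frame_proj fB; have [_ _ _ CF] := frame_proj fC.
by rewrite -CF mulmxA mulmxBr mulmx1 BF subrr mul0mx.
Qed.

Lemma frame_dim p q n (B : 'M[R]_(p, n)) (C : 'M[R]_(q, n)) F :
  frame B F -> frame C (orthocompl F) -> (p + q)%N = n.
Proof.
move=> fB fC; have BC := frame_orthogonal fB fC.
have M1 : col_mx B C *m (col_mx B C)^T = 1%:M.
  rewrite tr_col_mx mul_col_row fB.1 fC.1 BC.
  have -> : C *m B^T = 0 by rewrite -[C]trmxK -trmx_mul BC trmx0.
  by rewrite -scalar_mx_block.
have M2 : (col_mx B C)^T *m col_mx B C = 1%:M.
  by rewrite tr_col_mx mul_row_col fB.2 fC.2 /orthocompl addrC subrK.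
have /eqP <- : row_free (col_mx B C) by apply/row_freeP; exists (col_mx B C)^T.
by apply/eqP; change (row_full (col_mx B C)); apply/row_fullP; exists (col_mx B C)^T.
Qed.

(** Stacking the two frames gives an orthogonal matrix, in whose coordinates the set is a
    product. *)
Lemma lebesgue_frame p q n (B : 'M[R]_(p, n)) (C : 'M[R]_(q, n)) F
    (A : set 'rV[R]_p) (A' : set 'rV[R]_q) :
  frame B F -> frame C (orthocompl F) -> measurable A -> measurable A' ->
  mu n [set x | A (x *m B^T) /\ A' (x *m C^T)] = (mu p A * mu q A')%E.
Proof.
move=> fB fC mA mA'; have E := frame_dim fB fC.
have BC := frame_orthogonal fB fC.
case: _ / E B C F fB fC BC => B C F fB fC BC.
have oM : ortho_mx (col_mx B C)^T.
  rewrite /ortho_mx trmxK tr_col_mx mul_row_col fB.2 fC.2 /orthocompl addrC subrK//.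
pose D : set 'rV[R]_(p + q) := [set x | A (lsubmx x) /\ A' (rsubmx x)].
have cl : continuous (fun x : 'rV[R]_(p + q) => lsubmx x).
  by apply: continuous_comp_lsubmx => x; exact: cvg_id.
have mD : measurable D.
  apply: measurableI.
    exact: (measurable_preim (continuous_measurable_mx cl) mA).
  exact: (measurable_preim (@measurable_rsubmx R p q) mA').
transitivity (mu (p + q) D).
  have /= <- := (preserves_orthogonal oM).2 _ mD.
  have -> // : [set x | A (x *m B^T) /\ A' (x *m C^T)] = (mulmx^~ (col_mx B C)^T) @^-1` D.
  by apply/seteqP; split => x; rewrite /D /= tr_col_mx mul_mx_row row_mxKl row_mxKr.
rewrite lebesgue_row_mxl//.
transitivity (\int[mu q]_(y in A') mu p A)%E; last by rewrite integral_cst.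
rewrite [RHS]integral_mkcond; apply: eq_integral => y _; rewrite patchE.
case: ifPn; rewrite ?inE ?notin_setE => Ay.
  by congr (mu p _); apply/seteqP; split => x; rewrite /D /= row_mxKl row_mxKr => //; case.
by rewrite (_ : [set x | _] = set0) ?measure0//; apply/nonemptyPn => -[x []]; rewrite row_mxKr.
Qed.

Lemma orthocompl_proj n (F : 'M[R]_n) : F^T = F -> F *m F = F ->
  (orthocompl F)^T = orthocompl F /\ orthocompl F *m orthocompl F = orthocompl F.
Proof.
move=> FT FF; split; first by rewrite /orthocompl linearB/= trmx1 FT.
by rewrite /orthocompl mulmxBl mul1mx mulmxBr mulmx1 FF subrr subr0.
Qed.

Definition project p n (C : 'M[R]_(p, n)) (K : set 'rV[R]_n) : set 'rV[R]_p :=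
  [set x *m C^T | x in K].

Lemma project_compact p n (C : 'M[R]_(p, n)) K : compact K -> compact (project C K).
Proof. by apply: image_compact; exact: continuous_mulmxr. Qed.

(** The basis chosen by [onb] and any other frame differ by an orthogonal matrix, which preserves
    volume. *)
Lemma vol_in_frame p n (C : 'M[R]_(p, n)) E K : compact K -> frame C E ->
  vol_in E (orthoproj E K) = mu p (project C K).
Proof.
move=> cK fC; have [ET EE CE _] := frame_proj fC; have fO := onb_frame ET EE.
have rE := frame_rank fC; rewrite /vol_in.
have -> : coords E (orthoproj E K) = project (onb E) K.
  have [_ _ _ OE] := frame_proj fO.
  apply/seteqP; split => [x [z Kz zx]|_ [z Kz <-]].
    by exists z => //; rewrite -OE mulmxA zx -mulmxA fO.1 mulmx1.
  by exists z => //; rewrite -mulmxA fO.2.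
move: (onb E) fO; case: _ / (esym rE) => O fO.
have [oU OU] := frame_change fC fO.
have oU' := ortho_mxT oU.
transitivity (mu p (rotate (O *m C^T)^T (project C K))); last first.
  by apply: lebesgue_rot => //; apply: compact_mx_measurable; exact: project_compact.
have zO z : z *m C^T *m (O *m C^T)^T = z *m O^T.
  by have [_ _ _ OE] := frame_proj fO; rewrite trmx_mul trmxK !mulmxA -(mulmxA z) fC.2 -mulmxA OE.
congr (mu p _); apply/seteqP; split => [_ [z Kz <-]|_ [_ [z Kz <-] <-]].
  by exists (z *m C^T); [exists z|rewrite zO].
by exists z => //; rewrite zO.
Qed.

Lemma steiner_rotate n (U : 'M[R]_n) S W : compact S -> ortho_mx U ->
  steiner (rotate U S) W <-> steiner S W.
Proof.
move=> cS oU.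
have E a : mu n (minkowski_sum (rotate U S) (dilate a (@eball R n))) =
    mu n (minkowski_sum S (dilate a (@eball R n))).
  rewrite -{1}(rotate_eball oU) -rotate_dilate -rotate_minkowski lebesgue_rot//.
  by apply: compact_mx_measurable; apply: minkowski_compact => //; exact: dilate_eball_compact.
by split => H a a0; [rewrite -E|rewrite E]; exact: H.
Qed.

(** Both sets have the same solutions of Steiner's formula, so [xget] chooses the same function,
    including at the indices that the formula does not determine. *)
Lemma quermass_rotate n (U : 'M[R]_n) S : compact S -> ortho_mx U ->
  quermass (rotate U S) = quermass S.
Proof.
move=> cS oU; rewrite /quermass; congr (xget _ _).
by apply/funext => W; apply/propext; exact: steiner_rotate.
Qed.

Definition section p n (B : 'M[R]_(p, n)) (K : set 'rV[R]_n) : set 'rV[R]_p :=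
  [set x | K (x *m B)].

Lemma section_compact p n (B : 'M[R]_(p, n)) F K : frame B F -> compact K -> compact (section B K).
Proof.
move=> fB cK; apply: closed_ebounded_compact.
  have cB : continuous (fun x : 'rV[R]_p => x *m B) by exact: continuous_mulmxr.
  exact: (closed_comp (fun z _ => cB z) (compact_closed_rV cK)).
have [r r0 Kr] := compact_ebounded cK; exists r => // x /Kr.
by rewrite /rball/= (frame_dot _ _ fB).
Qed.

Lemma section_cvx p n (B : 'M[R]_(p, n)) K : cvx K -> cvx (section B K).
Proof.
by move=> vK x y t Kx Ky t0 t1; rewrite /section/= mulmxDl -!scalemxAl; exact: vK.
Qed.

Lemma quermass_in_frame p n (B : 'M[R]_(p, n)) F K : compact K -> frame B F ->
  quermass_in F (K `&` rowspace F) = quermass (section B K).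
Proof.
move=> cK fB; have [FT FF BF _] := frame_proj fB; have fO := onb_frame FT FF.
have rE := frame_rank fB; rewrite /quermass_in.
have -> : coords F (K `&` rowspace F) = section (onb F) K.
  apply/seteqP; split => [x []//|x Kx]; split => //.
  by have [_ _ OF _] := frame_proj fO; rewrite /rowspace/= -OF mulmxA submxMl.
move: (onb F) fO; case: _ / (esym rE) => O fO.
have [oU OU] := frame_change fB fO.
rewrite -(quermass_rotate (section_compact fO cK) oU); congr quermass.
have xO x : x *m (O *m B^T)^T *m O = x *m B.
  by rewrite trmx_mul trmxK -!mulmxA fO.2 BF.
by rewrite rotate_preimage//; apply/seteqP; split => x; rewrite /section/= xO.
Qed.

End Frames.

(** * Measurability on the Grassmannian *)

Section GrassmannMeasurability.
Variables (R : realType) (n : nat).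
Notation mu := (lebesgue_rV R).
Implicit Types (F : 'M[R]_n) (K : set 'rV[R]_n).

Lemma grassmannian_frame p F : grassmannian p F -> exists B : 'M[R]_(p, n), frame B F.
Proof. by move=> [FT FF <-]; exact: frame_exists. Qed.

Lemma frame_grassmannian p F (B : 'M[R]_(p, n)) : frame B F -> grassmannian p F.
Proof. by move=> fB; have [FT FF _ _] := frame_proj fB; split => //; exact: frame_rank fB. Qed.

Lemma grassmannian_compl p F : (p <= n)%N -> grassmannian p F ->
  grassmannian (n - p) (orthocompl F).
Proof.
move=> pn GF; have [B fB] := grassmannian_frame GF; have [FT FF _] := GF.
have [CT CC] := orthocompl_proj FT FF.
have [C fC] := frame_exists CT CC.
split => //; apply: (@addnI p); rewrite subnKC//; exact: frame_dim fB fC.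
Qed.

Lemma frame_trace p F (B : 'M[R]_(p, n)) : frame B F -> \tr F = p%:R.
Proof. by move=> [BB <-]; rewrite mxtrace_mulC BB mxtrace1. Qed.

Lemma measurable_mxtrace : measurable_fun setT (fun F : 'M[R]_n => \tr F).
Proof. by apply: measurable_sum => i; exact: measurable_mx_coord. Qed.

(** For a projection the rank equals the trace, which is measurable as a sum of entries. *)
Lemma measurable_grassmannian p : measurable (@grassmannian R n p).
Proof.
have idc : continuous (@id 'M[R]_n) by move=> x; exact: cvg_id.
have cT : continuous (fun F : 'M[R]_n => F^T - F) := continuous_submx (continuous_trmx idc) idc.
have cM : continuous (fun F : 'M[R]_n => F *m F - F) := continuous_submx (continuous_mulmx idc idc) idc.
have -> : @grassmannian R n p = (fun F : 'M[R]_n => F^T - F) @^-1` [set 0] `&`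
    (fun F : 'M[R]_n => F *m F - F) @^-1` [set 0] `&` (fun F : 'M[R]_n => \tr F) @^-1` [set p%:R].
  apply/seteqP; split => [F GF|F [[/= /subr0_eq FT /subr0_eq FF] Fp]].
    have [B fB] := grassmannian_frame GF; have [FT FF _] := GF.
    by split; [split; rewrite /= ?FT ?FF subrr|exact: frame_trace fB].
  have [B fB] := frame_exists FT FF; split => //.
  by have := frame_trace fB; rewrite Fp => /eqP; rewrite eqr_nat => /eqP.
apply: measurableI; last exact: (measurable_preim measurable_mxtrace (measurable_set1 _)).
by apply: measurableI; [apply: (measurable_preim (continuous_measurable_mx cT))|
  apply: (measurable_preim (continuous_measurable_mx cM))]; apply: closed_measurable_mx; exact: closed_set1_mx.
Qed.

(* The volumes of the projection and of the parallel bodies of the section, which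
   live in spaces depending on [F], are expressed through volumes in [R^n] of
   cylinders over them, whose measurability in [F] follows from compactness. *)
Definition proj_cylinder K F : set 'rV[R]_n := [set x | exists2 z, K z &
  (x - z) *m orthocompl F = 0 /\ dot (x *m F) (x *m F) <= 1].

Definition sect_cylinder s K F : set 'rV[R]_n := [set x | exists2 z, K z &
  [/\ z *m orthocompl F = 0, dot (x *m F - z) (x *m F - z) <= s ^+ 2 &
   dot (x *m orthocompl F) (x *m orthocompl F) <= 1]].

Let X := ('M[R]_n * 'rV[R]_n * 'rV[R]_n)%type.
Let cF : continuous (fun w : X => w.1.1).
Proof. by move=> w; apply: (@continuous_comp _ _ _ fst fst); exact: cvg_fst. Qed.
Let cx : continuous (fun w : X => w.1.2).
Proof. by move=> w; apply: (@continuous_comp _ _ _ fst snd); [exact: cvg_fst|exact: cvg_snd]. Qed.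
Let cz : continuous (fun w : X => w.2).
Proof. by move=> w; exact: cvg_snd. Qed.
Let cC : continuous (fun w : X => orthocompl w.1.1).
Proof. by apply: continuous_submx => //; exact: cst_continuous. Qed.

Let closed0 (f : X -> 'rV[R]_n) : continuous f -> closed [set w | f w = 0].
Proof.
by move=> cf; exact: (closed_comp (fun w _ => cf w) (@closed_set1_mx R 1 n 0)).
Qed.

Let closed_le_dot (f : X -> 'rV[R]_n) c : continuous f -> closed [set w | dot (f w) (f w) <= c].
Proof.
move=> cf; have cd := continuous_dot cf cf.
exact: (closed_comp (fun w _ => cd w) (@closed_le R c)).
Qed.

Lemma measurable_proj_cylinder K : compact K ->
  measurable_fun setT (fun F => mu n (proj_cylinder K F)).
Proof.
move=> cK; apply: (@measurable_exists_vol R _ _ _ _ K [set w : X |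
  (w.1.2 - w.2) *m orthocompl w.1.1 = 0 /\ dot (w.1.2 *m w.1.1) (w.1.2 *m w.1.1) <= 1] cK).
apply: closedI.
  by apply: closed0; apply: continuous_mulmx => //; exact: continuous_submx.
by apply: closed_le_dot; exact: continuous_mulmx.
Qed.

Lemma measurable_sect_cylinder s K : compact K ->
  measurable_fun setT (fun F => mu n (sect_cylinder s K F)).
Proof.
move=> cK; pose E1 := [set w : X | w.2 *m orthocompl w.1.1 = 0].
pose E2 := [set w : X | dot (w.1.2 *m w.1.1 - w.2) (w.1.2 *m w.1.1 - w.2) <= s ^+ 2].
pose E3 := [set w : X | dot (w.1.2 *m orthocompl w.1.1) (w.1.2 *m orthocompl w.1.1) <= 1].
have cE : closed (E1 `&` (E2 `&` E3)).
  apply: closedI; first by apply: closed0; exact: continuous_mulmx.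
  apply: closedI; apply: closed_le_dot; last exact: continuous_mulmx.
  by apply: continuous_submx => //; exact: continuous_mulmx.
have := measurable_exists_vol cK cE; congr (measurable_fun _ _).
apply/funext => F; congr (mu n _); apply/seteqP; split => x [z Kz].
  by move=> [? [? ?]]; exists z.
by move=> [? ? ?]; exists z.
Qed.

Lemma proj_cylinder_vol p q (B : 'M[R]_(p, n)) (C : 'M[R]_(q, n)) F K :
  compact K -> frame B F -> frame C (orthocompl F) ->
  mu n (proj_cylinder K F) = ((omega R p)%:E * mu q (project C K))%E.
Proof.
move=> cK fB fC; rewrite -omegaE.
have mC := compact_mx_measurable (@project_compact R q n C K cK).
rewrite -(lebesgue_frame fB fC (@measurable_eball R p) mC); congr (mu n _).
have [_ _ _ CC] := frame_proj fC.
have dB x : dot (x *m F) (x *m F) = dot (x *m B^T) (x *m B^T).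
  by rewrite -{1 2}fB.2 mulmxA (frame_dot _ _ fB).
apply/seteqP; split => [x [z Kz [xz xF]]|x [xB [z Kz zx]]].
  split; first by rewrite /eball/= -dB.
  exists z => //; apply/eqP; rewrite eq_sym -subr_eq0 -mulmxBl -CC mulmxA xz mul0mx//.
exists z => //; split; last by rewrite dB.
by rewrite -fC.2 mulmxA mulmxBl zx subrr mul0mx.
Qed.

Lemma sect_cylinder_vol p q (B : 'M[R]_(p, n)) (C : 'M[R]_(q, n)) F K s :
  compact K -> frame B F -> frame C (orthocompl F) -> 0 <= s ->
  mu n (sect_cylinder s K F) =
  (mu p (minkowski_sum (section B K) (dilate s (@eball R p))) * (omega R q)%:E)%E.
Proof.
move=> cK fB fC s0; rewrite -omegaE.
have cS := section_compact fB cK.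
have mS : measurable (minkowski_sum (section B K) (dilate s (@eball R p))).
  by apply: compact_mx_measurable; apply: minkowski_compact => //; exact: dilate_eball_compact.
rewrite -(lebesgue_frame fB fC mS (@measurable_eball R q)); congr (mu n _).
have [_ _ BF FB] := frame_proj fB.
have dC x : dot (x *m orthocompl F) (x *m orthocompl F) = dot (x *m C^T) (x *m C^T).
  by rewrite -{1 2}fC.2 mulmxA (frame_dot _ _ fC).
have ball y : dilate s (@eball R p) y <-> dot (y *m B) (y *m B) <= s ^+ 2.
  rewrite (frame_dot _ _ fB) -enorm_sq ler_pXn2r ?nnegrE ?enorm_ge0//.
  exact: dilate_eballE.
apply/seteqP; split => [x [z Kz [zC xz xC]]|x [[z Kz [y yB zy]] xC]].
  have zF : z *m F = z.
    by move: zC; rewrite /orthocompl mulmxBr mulmx1 => /subr0_eq.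
  split; last by rewrite /eball/= -dC.
  exists (z *m B^T); first by rewrite /section/= -mulmxA fB.2 zF.
  exists (x *m B^T - z *m B^T); last by rewrite addrC subrK.
  by apply/ball; rewrite mulmxBl -!mulmxA fB.2 zF.
exists (z *m B) => //; split; last by rewrite dC.
  by rewrite /orthocompl mulmxBr mulmx1 -mulmxA BF subrr.
have -> : x *m F - z *m B = y *m B.
  by rewrite -fB.2 mulmxA -zy mulmxDl addrAC subrr add0r.
exact/ball.
Qed.

(** Interpolation at the nodes [0, ..., p]: the Vandermonde matrix is invertible, so [W j] is a
    fixed linear combination of volumes of parallel bodies. This reduces the measurability of
    quermassintegrals to that of volumes. *)
Lemma steiner_coefficient p j : (j <= p)%N -> exists c : 'I_p.+1 -> R,
  forall W, W j = \sum_(s < p.+1) c s * steiner_poly p W s%:R.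
Proof.
move=> jp; pose V := @Vandermonde R p.+1 p.+1 (\row_(s < p.+1) s%:R).
have uV : V \in unitmx.
  rewrite unitmxE det_Vandermonde unitfE; apply/prodf_neq0 => i _; apply/prodf_neq0 => k ik.
  by rewrite !mxE subr_eq0 eqr_nat gt_eqF.
pose j' : 'I_p.+1 := Ordinal (jp : (j < p.+1)%N).
have C0 : 'C(p, j)%:R != 0 :> R by rewrite pnatr_eq0 -lt0n bin_gt0.
exists (fun s => invmx V s j' / 'C(p, j)%:R) => W.
have -> : \sum_(s < p.+1) invmx V s j' / 'C(p, j)%:R * steiner_poly p W s%:R =
    \sum_(i < p.+1) 'C(p, i)%:R * W i / 'C(p, j)%:R * (V *m invmx V) i j'.
  under eq_bigr do rewrite /steiner_poly mulr_sumr.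
  rewrite exchange_big /=; apply: eq_bigr => i _; rewrite !mxE mulr_sumr.
  by apply: eq_bigr => s _; rewrite !mxE; ring.
rewrite mulmxV// (bigD1 j')//= big1 => [|i ij]; last by rewrite mxE (negPf ij) mulr0.
by rewrite mxE eqxx addr0 mulr1 mulrAC divff// mul1r.
Qed.

Definition grassmann_integrand j K F : \bar R :=
  (vol_in (orthocompl F) (orthoproj (orthocompl F) K)
    * (quermass_in F (K `&` rowspace F) j)%:E)%E.

Lemma measurable_integrand p j K : (p <= n)%N -> (j <= p)%N -> compact K -> cvx K -> K 0 ->
  measurable_fun (@grassmannian R n p) (grassmann_integrand j K).
Proof.
move=> pn jp cK vK K0; have [c Hc] := steiner_coefficient jp.
(* [g] is defined for every matrix [F]. Each cylinder volume is divided by the volume of the unit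
   ball in the complementary subspace. *)
pose g F := (mu n (proj_cylinder K F) * ((omega R p)^-1)%:E *
  (\sum_(s < p.+1) c s * (fine (mu n (sect_cylinder s%:R K F)) / omega R (n - p)))%:E)%E.
have mg : measurable_fun setT g.
  apply: emeasurable_funM.
    by apply: emeasurable_funM; [exact: measurable_proj_cylinder|exact: measurable_cst].
  apply/measurable_EFinP; apply: measurable_sum => s; apply: measurable_funM; first exact: measurable_cst.
  apply: measurable_funM; last exact: measurable_cst.
  by apply: measurableT_comp (measurable_sect_cylinder _ cK).
apply: (@eq_measurable_fun _ _ _ _ _ g); last exact: measurable_funTS.
move=> F; rewrite inE => GF; rewrite /g /grassmann_integrand.
have [B fB] := grassmannian_frame GF.
have [C fC] := grassmannian_frame (grassmannian_compl pn GF).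
rewrite (proj_cylinder_vol cK fB fC) (vol_in_frame cK fC) (quermass_in_frame cK fB).
have op := omega_gt0 R p; have oq := omega_gt0 R (n - p).
rewrite [X in (X * _)%E]muleAC -EFinM divff ?mul1e ?gt_eqF//.
congr (_ * _%:E)%E; rewrite Hc; apply: eq_bigr => s _; congr (_ * _).
have cS := section_compact fB cK; have vS := @section_cvx R p n B K vK.
have S0 : section B K !=set0 by exists 0; rewrite /section/= mul0mx.
rewrite (sect_cylinder_vol cK fB fC)//.
have sK := steiner_compact cS vS S0.
have -> : steiner_poly p (quermass (section B K)) s%:R = steiner_poly p (kubota (section B K)) s%:R.
  by apply: eq_bigr => i _; rewrite quermass_kubota// -ltnS.
rewrite -steiner_kubota// volE; last by apply: minkowski_compact => //; exact: dilate_eball_compact.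
by rewrite -EFinM /= mulfK// gt_eqF.
Qed.

End GrassmannMeasurability.

(** * From the Grassmannian to the orthogonal group *)

Section Transfer.
Variables (R : realType) (n : nat).
Notation haar := (haar R n).
Implicit Types (U W F : 'M[R]_n).

Definition SOn : set 'M[R]_n := [set U | ortho_mx U /\ \det U = 1].

Lemma measurable_det : measurable_fun setT (fun U : 'M[R]_n => \det U).
Proof.
apply: measurable_sum => s; apply: measurable_funM; first exact: measurable_cst.
by apply: measurable_prod => i _; exact: measurable_mx_coord.
Qed.

Lemma measurable_SOn : measurable SOn.
Proof.
apply: measurableI; first exact: measurable_On.
exact: (measurable_preim measurable_det (measurable_set1 _)).
Qed.

Lemma det_ortho_mx U : ortho_mx U -> \det U = 1 \/ \det U = -1.
Proof.
move=> oU; have := congr1 determinant oU; rewrite det_mulmx det_tr det1 -expr2 => /eqP.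
by rewrite sqrf_eq1 => /orP[] /eqP ->; [left|right].
Qed.

Lemma conj_proj m F W : ortho_mx W -> grassmannian m F -> grassmannian m (W^T *m F *m W).
Proof.
move=> oW GF; have [B fB] := grassmannian_frame GF.
exact: frame_grassmannian (frame_rotate oW fB).
Qed.

Lemma conj_projK F W : ortho_mx W -> W *m (W^T *m F *m W) *m W^T = F.
Proof. by move=> oW; rewrite !mulmxA oW mul1mx -mulmxA oW mulmx1. Qed.

Lemma conj_proj_iff m F W : ortho_mx W -> grassmannian m (W^T *m F *m W) <-> grassmannian m F.
Proof.
move=> oW; split; last exact: conj_proj.
move=> /(conj_proj (ortho_mxT oW)); rewrite trmxK conj_projK//.
Qed.

Lemma frames_conj p q (B B' : 'M[R]_(p, n)) (C C' : 'M[R]_(q, n)) F F' :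
  frame B F -> frame C (orthocompl F) -> frame B' F' -> frame C' (orthocompl F') ->
  exists2 W, ortho_mx W & F' = W^T *m F *m W.
Proof.
(* This matrix carries the rows of [B] to those of [B'] and the rows of [C] to those of [C']. *)
move=> fB fC fB' fC'; exists (B^T *m B' + C^T *m C').
  rewrite /ortho_mx linearD/= !trmx_mul !trmxK mulmxDl !mulmxDr.
  rewrite -!mulmxA (mulmxA B') (mulmxA B' C'^T) (mulmxA C' B'^T) (mulmxA C' C'^T).
  rewrite fB'.1 fC'.1 (frame_orthogonal fB' fC').
  have -> : C' *m B'^T = 0 by rewrite -[C']trmxK -trmx_mul (frame_orthogonal fB' fC') trmx0.
  by rewrite !mul1mx !mul0mx !mulmx0 addr0 add0r fB.2 fC.2 /orthocompl addrC subrK.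
have [FT FF BF FB] := frame_proj fB.
have CF : C *m F = 0.
  have [_ _ CC _] := frame_proj fC.
  by rewrite -CC -mulmxA /orthocompl mulmxBl mul1mx FF subrr mulmx0.
have FC : F *m C^T = 0 by rewrite -[F]trmxK -trmx_mul FT CF trmx0.
rewrite -mulmxA mulmxDr !mulmxA FB FC mul0mx addr0 linearD/= !trmx_mul !trmxK mulmxDl.
rewrite -!mulmxA (mulmxA B) fB.1 mul1mx (mulmxA C) .
have -> : C *m B^T = 0 by rewrite -[C]trmxK -trmx_mul (frame_orthogonal fB fC) trmx0.
by rewrite mul0mx mulmx0 addr0 fB'.2.
Qed.

Lemma grassmannian_conj m F F' : (m <= n)%N -> grassmannian m F -> grassmannian m F' ->
  exists2 W, ortho_mx W & F' = W^T *m F *m W.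
Proof.
move=> mn GF GF'; have [B fB] := grassmannian_frame GF; have [B' fB'] := grassmannian_frame GF'.
have [C fC] := grassmannian_frame (grassmannian_compl mn GF).
have [C' fC'] := grassmannian_frame (grassmannian_compl mn GF').
exact: frames_conj fB fC fB' fC'.
Qed.

Section Integral.
Variables (m : nat) (nu : probability 'M[R]_n R) (F0 R0 : 'M[R]_n).
Hypotheses (mn : (m <= n)%N) (Hnu : grassmann_haar m nu) (G0 : grassmannian m F0).
(** [grassmann_haar] gives invariance under determinant 1 only, whereas [haar] charges both
    determinant classes. The reflection [R0] fixes the reference subspace and exchanges the
    classes. *)
Hypotheses (oR0 : ortho_mx R0) (dR0 : \det R0 = -1) (R0F0 : R0^T *m F0 *m R0 = F0).
Variable f : 'M[R]_n -> \bar R.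
Hypotheses (mf : measurable_fun setT f) (f0 : forall F, (0 <= f F)%E).
Hypothesis fG : forall F, ~ grassmannian m F -> f F = 0%E.

Lemma measurable_conj U : measurable_fun setT (fun F : 'M[R]_n => U^T *m F *m U).
Proof.
apply: measurable_fun_mulmx; last exact: measurable_cst.
by apply: measurable_fun_mulmx; [exact: measurable_cst|exact: measurable_id].
Qed.

Lemma measurable_conj0 : measurable_fun setT (fun U : 'M[R]_n => U^T *m F0 *m U).
Proof.
apply: measurable_fun_mulmx; last exact: measurable_id.
by apply: measurable_fun_mulmx; [exact: measurable_trmx|exact: measurable_cst].
Qed.

Lemma grassmann_invariant U : SOn U -> (\int[nu]_F f (U^T *m F *m U) = \int[nu]_F f F)%E.
Proof.
move=> [oU dU]; apply: preserves_integral => //; split; first exact: measurable_conj.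
by move=> A mA; exact: Hnu.2.
Qed.

Local Open Scope ereal_scope.

Let S U : \bar R := (\1_SOn U : R)%:E.
Let mS : measurable_fun setT S.
Proof. by apply/measurable_EFinP; apply: measurable_indic; exact: measurable_SOn. Qed.
Let S0 U : 0 <= S U. Proof. by rewrite lee_fin. Qed.
Let S1 U : SOn U -> S U = 1. Proof. by move=> SU; rewrite /S indicE mem_set. Qed.
Let S00 U : ~ SOn U -> S U = 0. Proof. by move=> SU; rewrite /S indicE memNset. Qed.

(* Both determinant classes have the same integral since [R0] exchanges them. *)
Lemma haar_integral_SOn (h : 'M[R]_n -> \bar R) : measurable_fun setT h ->
  (forall U, 0 <= h U) -> (forall U, h (R0 *m U)%R = h U) ->
  \int[haar]_U h U = \int[haar]_U (S U * h U) + \int[haar]_U (S U * h U).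
Proof.
move=> mh h0 hR.
have mSh : measurable_fun setT (fun U => S U * h U) by exact: emeasurable_funM.
have Sh0 U : 0 <= S U * h U by exact: mule_ge0.
rewrite -{2}(haar_integral_left mSh Sh0 oR0).
have mSR : measurable_fun setT (fun U => S (R0 *m U)%R * h (R0 *m U)%R).
  by apply: measurableT_comp mSh _; apply: measurable_fun_mulmx; [exact: measurable_cst|exact: measurable_id].
rewrite -ge0_integralD//.
rewrite haar_integral_On// [RHS]haar_integral_On//; last 2 first.
- exact: emeasurable_funD.
- by move=> U; rewrite adde_ge0// mule_ge0.
apply: eq_integral => U; rewrite inE => oU; rewrite hR.
have [dU|dU] := det_ortho_mx oU.
  rewrite S1// S00 ?mul1e ?mul0e ?adde0// => -[_].
  by rewrite det_mulmx dR0 dU mulN1r => /eqP; rewrite eqNr oner_eq0.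
rewrite S00; last by move=> [_]; rewrite dU => /eqP; rewrite eqNr oner_eq0.
rewrite S1 ?mul1e ?mul0e ?add0e//; split; first exact: ortho_mxM.
by rewrite det_mulmx dR0 dU mulrNN mulr1.
Qed.

Lemma SOn_conj F : grassmannian m F -> exists2 W, SOn W & F = (W^T *m F0 *m W)%R.
Proof.
move=> GF; have [W oW FW] := grassmannian_conj mn G0 GF.
have [dW|dW] := det_ortho_mx oW; first by exists W.
exists (R0 *m W)%R; first by split; [exact: ortho_mxM|rewrite det_mulmx dR0 dW mulrNN mulr1].
by rewrite trmx_mul -!mulmxA (mulmxA F0) (mulmxA R0^T) (mulmxA R0^T) R0F0 mulmxA.
Qed.

(* Averaging [f (U^T *m F *m U)] over both [nu] and the rotations [U] gives the
   left side by the invariance of [nu], and the right side by that of [haar]. *)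
Theorem grassmann_integral :
  \int[nu]_(F in grassmannian m) f F = \int[haar]_U f (U^T *m F0 *m U)%R.
Proof.
have mG := @measurable_grassmannian R n m.
have -> : \int[nu]_(F in grassmannian m) f F = \int[nu]_F f F.
  rewrite integral_mkcond; apply: eq_integral => F _; rewrite patchE.
  by case: ifPn => //; rewrite notin_setE => /fG ->.
pose A := \int[haar]_U (S U * f (U^T *m F0 *m U)%R).
pose I := \int[nu]_F f F.
pose p := \int[haar]_U S U.
have mf0 : measurable_fun setT (fun U => f (U^T *m F0 *m U)%R) by exact: measurableT_comp mf measurable_conj0.
have mSf : measurable_fun setT (fun U => S U * f (U^T *m F0 *m U)%R) by exact: emeasurable_funM.
pose H (z : 'M[R]_n * 'M[R]_n) := S z.1 * f (z.1^T *m z.2 *m z.1)%R.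
have mH : measurable_fun setT H.
  apply: emeasurable_funM; first exact: measurableT_comp mS (@measurable_fst _ _ _ _).
  apply: measurableT_comp mf _; apply: measurable_fun_mulmx; last exact: measurable_fst.
  apply: measurable_fun_mulmx; last exact: measurable_snd.
  exact: measurableT_comp (@measurable_trmx R n n) (@measurable_fst _ _ _ _).
have H0 z : 0 <= H z by exact: mule_ge0.
have E1 : \int[haar]_U \int[nu]_F H (U, F) = p * I.
  rewrite -ge0_integralZr//; last exact: integral_ge0.
  apply: eq_integral => U _; rewrite /H/= ge0_integralZl//; last first.
    by apply: measurableT_comp mf _; exact: measurable_conj.
  have [SU|SU] := pselect (SOn U); last by rewrite S00// !mul0e.
  by rewrite grassmann_invariant.
have E2 : \int[nu]_F \int[haar]_U H (U, F) = A.
  transitivity (\int[nu]_(F in grassmannian m) A); last first.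
    rewrite integral_cst// -[RHS]mule1; congr (_ * _); exact: Hnu.1.
  rewrite [RHS]integral_mkcond; apply: eq_integral => F _; rewrite patchE.
  case: ifPn; rewrite ?inE ?notin_setE => GF; last first.
    rewrite integral0_eq// => U _; rewrite /H/=.
    have [SU|SU] := pselect (SOn U); last by rewrite S00// mul0e.
    by rewrite fG ?mule0// => /conj_proj_iff H'; apply: GF; apply: H'; have [] := SU.
  have [W [oW dW] FW] := SOn_conj GF.
  rewrite -[RHS](haar_integral_left mSf (fun U => mule_ge0 (S0 U) (f0 _)) oW).
  apply: eq_integral => U _; rewrite /H/= FW trmx_mul !mulmxA; congr (_ * _).
  have [SU|SU] := pselect (SOn U).
    rewrite !S1//; split; first by apply: ortho_mxM => //; have [] := SU.
    by rewrite det_mulmx dW mul1r; have [] := SU.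
  rewrite !S00// => -[oWU dWU]; apply: SU; split; last by rewrite -dWU det_mulmx dW mul1r.
  have := ortho_mxM (ortho_mxT oW) oWU; rewrite mulmxA (mulmx1C oW) mul1mx//.
have pI : p * I = A by rewrite -E1 -E2; exact: (fubini_tonelli (m1 := haar) (m2 := nu) H mH H0).
(* The rotations have Haar mass one half: the splitting into determinant classes is applied to the
   constant 1. *)
have pp : p + p = 1.
  have := haar_integral_SOn (@measurable_cst _ _ _ _ setT (1 : \bar R)) (fun=> lee01) (fun=> erefl).
  have -> : \int[haar]_U (cst (1 : \bar R) U) = 1.
    rewrite integral_cst// mul1e; exact: (@probability_setT _ _ _ haar).
  have -> // : \int[haar]_U (S U * cst (1 : \bar R) U) = p.
  by apply: eq_integral => U _; rewrite mule1.
have p0 : 0 <= p by exact: integral_ge0.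
rewrite -/I -[LHS]mul1e -pp ge0_muleDl// pI; apply/esym; apply: haar_integral_SOn => //.
by move=> U; rewrite trmx_mul -!mulmxA (mulmxA F0) (mulmxA R0^T) (mulmxA R0^T) R0F0 !mulmxA.
Qed.

End Integral.

End Transfer.

(** * The inequalities of the theorem *)

Section CoordinateFrames.
Variables (R : realType) (j d k : nat).
Let n := (j + (d + k))%N.

Definition first_frame : 'M[R]_(j + d, j + (d + k)) :=
  col_mx (row_mx 1%:M 0) (row_mx 0 (row_mx 1%:M 0)).

Definition last_frame : 'M[R]_(k, j + (d + k)) := row_mx 0 (row_mx 0 1%:M).

Definition first_proj : 'M[R]_(j + (d + k)) := first_frame^T *m first_frame.

Lemma mulmx_inj p q (A B : 'M[R]_(p, q)) : (forall x : 'rV[R]_p, x *m A = x *m B) -> A = B.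
Proof. by move=> H; apply/row_matrixP => i; rewrite !rowE H. Qed.

Lemma mul_first_frame (x : 'rV[R]_(j + d)) :
  x *m first_frame = row_mx (lsubmx x) (row_mx (rsubmx x) 0).
Proof.
rewrite -{1}(hsubmxK x) mul_row_col !mul_mx_row !mulmx1 !mulmx0.
by rewrite add_row_mx addr0 add0r.
Qed.

Lemma mul_first_frameT (x : 'rV[R]_(j + (d + k))) :
  x *m first_frame^T = row_mx (lsubmx x) (lsubmx (rsubmx x)).
Proof.
rewrite tr_col_mx !tr_row_mx !trmx0 !trmx1 mul_mx_row; congr row_mx.
  by rewrite -{1}(hsubmxK x) mul_row_col mulmx1 mulmx0 addr0.
rewrite -{1}(hsubmxK x) mul_row_col mulmx0 add0r.
by rewrite -{1}(hsubmxK (rsubmx x)) mul_row_col mulmx1 mulmx0 addr0.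
Qed.

Lemma mul_last_frame (y : 'rV[R]_k) : y *m last_frame = row_mx 0 (row_mx 0 y).
Proof. by rewrite !mul_mx_row !mulmx0 mulmx1. Qed.

Lemma mul_last_frameT (x : 'rV[R]_(j + (d + k))) : x *m last_frame^T = rsubmx (rsubmx x).
Proof.
rewrite !tr_row_mx !trmx0 trmx1 -{1}(hsubmxK x) mul_row_col mulmx0 add0r.
by rewrite -{1}(hsubmxK (rsubmx x)) mul_row_col mulmx1 mulmx0 add0r.
Qed.

Lemma frame_first : frame first_frame first_proj.
Proof.
split => //; apply: mulmx_inj => x; rewrite mulmxA mul_first_frame mul_first_frameT.
by rewrite mulmx1 row_mxKl row_mxKr row_mxKl hsubmxK.
Qed.

Lemma frame_last : frame last_frame (orthocompl first_proj).
Proof.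
split; apply: mulmx_inj => x.
  by rewrite mulmxA mul_last_frame mul_last_frameT !row_mxKr mulmx1.
rewrite mulmxA mul_last_frameT mul_last_frame /orthocompl mulmxBr mulmx1 /first_proj.
rewrite mulmxA mul_first_frameT mul_first_frame row_mxKl row_mxKr.
rewrite -{2}(hsubmxK x) -{2}(hsubmxK (rsubmx x)) opp_row_mx opp_row_mx !add_row_mx.
by rewrite !subrr oppr0 addr0.
Qed.

Definition flip_mx : 'M[R]_d := diag_mx (\row_i (-1) ^+ (i == 0%N :> nat)).

Lemma flip_mxK : flip_mx *m flip_mx = 1%:M.
Proof.
rewrite /flip_mx mulmx_diag; apply/matrixP => a b; rewrite !mxE.
by rewrite -expr2 sqrr_sign.
Qed.

Lemma flip_mxT : flip_mx^T = flip_mx.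
Proof. exact: tr_diag_mx. Qed.

Lemma det_flip_mx : (0 < d)%N -> \det flip_mx = -1.
Proof.
rewrite /flip_mx det_diag => d0; pose i0 : 'I_d := Ordinal d0.
rewrite (bigD1 i0)//= mxE/= big1 ?mulr1// => i ii0; rewrite mxE.
by rewrite (_ : (i == 0%N :> nat) = false)//; apply: contraNF ii0 => /eqP H; apply/eqP/val_inj.
Qed.

(** One sign is changed inside the middle block, which lies in the range of [first_proj], so that
    projection is preserved; [0 < d] makes the determinant -1. *)
Definition reflection_mx : 'M[R]_(j + (d + k)) :=
  block_mx 1%:M 0 0 (block_mx flip_mx 0 0 1%:M).

Lemma mul_reflection (x : 'rV[R]_(j + (d + k))) :
  x *m reflection_mx = row_mx (lsubmx x) (row_mx (lsubmx (rsubmx x) *m flip_mx) (rsubmx (rsubmx x))).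
Proof.
rewrite -{1}(hsubmxK x) mul_row_block !mulmx0 mulmx1 addr0 add0r; congr row_mx.
by rewrite -{1}(hsubmxK (rsubmx x)) mul_row_block !mulmx0 mulmx1 addr0 add0r.
Qed.

Lemma reflection_mxT : reflection_mx^T = reflection_mx.
Proof. by rewrite /reflection_mx !tr_block_mx !trmx0 !trmx1 flip_mxT. Qed.

Lemma reflection_orthogonal : ortho_mx reflection_mx.
Proof.
rewrite /ortho_mx reflection_mxT; apply: mulmx_inj => x.
rewrite mulmxA !mul_reflection !(row_mxKl, row_mxKr) -mulmxA flip_mxK !mulmx1.
by rewrite !hsubmxK.
Qed.

Lemma det_reflection : (0 < d)%N -> \det reflection_mx = -1.
Proof. by move=> d0; rewrite !det_ublock !det1 det_flip_mx// mul1r mulr1. Qed.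

Lemma reflection_first_proj : reflection_mx^T *m first_proj *m reflection_mx = first_proj.
Proof.
rewrite reflection_mxT; apply: mulmx_inj => x; rewrite /first_proj !mulmxA.
rewrite !(mul_reflection, mul_first_frame, mul_first_frameT, row_mxKl, row_mxKr).
by rewrite -mulmxA flip_mxK mulmx1.
Qed.

(** [V] acts on the range of [first_proj] and the identity on its complement. Frames replace a block
    matrix because [j + d] is not a block of [j + (d + k)]. *)
Definition extend_first (V : 'M[R]_(j + d)) : 'M[R]_(j + (d + k)) :=
  first_frame^T *m V *m first_frame + last_frame^T *m last_frame.

Let BC : first_frame *m last_frame^T = 0 := frame_orthogonal frame_first frame_last.
Let CB : last_frame *m first_frame^T = 0.
Proof. by rewrite -[last_frame]trmxK -trmx_mul BC trmx0. Qed.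

Lemma extend_firstT V : (extend_first V)^T = extend_first V^T.
Proof. by rewrite /extend_first linearD/= !trmx_mul !trmxK mulmxA. Qed.

Lemma first_frame_extend V : first_frame *m extend_first V = V *m first_frame.
Proof.
rewrite mulmxDr !mulmxA frame_first.1 mul1mx; set Z := _ *m last_frame; suff -> : Z = 0 by rewrite addr0.
by rewrite /Z BC mul0mx.
Qed.

Lemma last_frame_extend V : last_frame *m extend_first V = last_frame.
Proof. by rewrite mulmxDr !mulmxA CB !mul0mx add0r frame_last.1 mul1mx. Qed.

Lemma extend_first_orthogonal V : ortho_mx V -> ortho_mx (extend_first V).
Proof.
move=> oV; rewrite /ortho_mx extend_firstT {1}/extend_first mulmxDl.
rewrite -(mulmxA _ first_frame) first_frame_extend -(mulmxA _ last_frame) last_frame_extend.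
rewrite mulmxA -(mulmxA _ V) oV mulmx1 frame_last.2 /orthocompl /first_proj.
by rewrite addrC subrK.
Qed.

Lemma measurable_extend_first : measurable_fun setT extend_first.
Proof.
apply: continuous_measurable_mx; apply: continuous_addmx; last exact: cst_continuous.
apply: continuous_mulmx; last exact: cst_continuous.
by apply: continuous_mulmx; [exact: cst_continuous|move=> x; exact: cvg_id].
Qed.

End CoordinateFrames.

Section BodyLemmas.
Variable R : realType.
Notation mu := (lebesgue_rV R).

Lemma preserves_integral_sign d1 d2 (X : measurableType d1) (Y : measurableType d2)
    (m1 : {measure set X -> \bar R}) (m2 : {measure set Y -> \bar R}) (phi : X -> Y)
    (D : set Y) (f : Y -> \bar R) :
  preserves m1 m2 phi -> measurable D -> measurable_fun D f ->
  (\int[m1]_(x in phi @^-1` D) f (phi x) = \int[m2]_(y in D) f y)%E.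
Proof.
move=> P mD mf; rewrite integralE [RHS]integralE; congr (_ - _)%E.
  rewrite -(preserves_integral_in P mD (measurable_funepos mf) (fun y _ => funepos_ge0 f y)).
  by apply: eq_integral => x _; rewrite !funeposE.
rewrite -(preserves_integral_in P mD (measurable_funeneg mf) (fun y _ => funeneg_ge0 f y)).
by apply: eq_integral => x _; rewrite !funenegE.
Qed.

Lemma centered_rotate n (U : 'M[R]_n) K : ortho_mx U -> compact K -> 0 < vol K -> centered K ->
  centered (rotate U K).
Proof.
move=> oU cK pK K0; apply/rowP => i; rewrite !mxE.
have P := preserves_orthogonal (ortho_mxT oU).
suff -> : \int[mu n]_(x in rotate U K) x ord0 i = 0 by rewrite mulr0.
have mK := compact_mx_measurable cK.
rewrite rotate_preimage//; transitivity (\int[mu n]_(x in K) dot (row i U^T) x).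
  rewrite /Rintegral; congr fine.
  rewrite -(preserves_integral_sign P mK); last first.
    apply: measurable_funTS; apply/measurable_EFinP.
    by apply: measurable_dot; [exact: measurable_cst|exact: measurable_id].
  apply: eq_integral => x _; congr EFin.
  have -> : dot (row i U^T) (x *m U^T) = (x *m U^T *m U) ord0 i.
    by rewrite [RHS]mxE; apply: eq_bigr => l _; rewrite [RHS]mulrC; congr (_ * _); rewrite !mxE.
  by rewrite -mulmxA (mulmx1C oU) mulmx1.
exact: integral_dot_centered.
Qed.

Lemma interior_vol_gt0 n (K : set 'rV[R]_n) : compact K -> interior K !=set0 -> 0 < vol K.
Proof.
move=> cK [x /nbhs_ballP[e /= e0 eK]].
have e20 : 0 < e / 2 by rewrite divr_gt0.
pose A := [set y : 'rV[R]_n | cube (e / 2) (y - x)].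
have AK : A `<=` K.
  move=> y Ay; apply: eK; split => // a b; rewrite ord1 /ball/=.
  have := Ay b; rewrite /= in_itv/= !mxE => /andP[h1 h2].
  by rewrite distrC ger0_norm//; lra.
rewrite -lte_fin -volE//; apply: (@lt_le_trans _ _ (mu n A)); last first.
  apply: le_measure => //; rewrite inE; last exact: compact_mx_measurable.
  exact: (measurable_translate (- x) (@measurable_cube R n (e / 2))).
have /= -> := (preserves_translate (- x)).2 _ (@measurable_cube R n (e / 2)).
by rewrite lebesgue_cube ?ltW// lte_fin exprn_gt0.
Qed.

End BodyLemmas.

(** * The integral as an average over rotated bodies *)

Section Main.
Variables (R : realType) (j d k : nat) (K : set 'rV[R]_(j + (d + k))).
Hypotheses (d0 : (0 < d)%N) (cK : compact K) (vK : cvx K) (pK : 0 < vol K) (K0 : centered K).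
Notation mu := (lebesgue_rV R).
Notation n := (j + (d + k))%N.
Notation haarn := (haar R (j + (d + k))).
Local Notation B0 := (first_frame R j d k).
Local Notation C0 := (last_frame R j d k).
Local Notation F0 := (first_proj R j d k).
Implicit Types (U : 'M[R]_(j + (d + k))).

Let Kz : K 0 := centered_mem0 cK pK K0 vK.

(** With [L = base (rotate U K)] in the last [d + k] coordinates, this is the product of the volumes
    of P_Y L and L n E. *)
Definition shadow_section_vol U : \bar R :=
  (mu k (base (base (rotate U K))) * mu d (fiber (base (rotate U K)) 0))%E.

Lemma base_base_project U : base (base (rotate U K)) = project (last_frame R j d k *m U^T) K.
Proof.
rewrite /project trmx_mul trmxK.
apply/seteqP; split => [_ [_ [_ [x Kx <-] <-] <-]|_ [x Kx <-]].
  by exists x => //; rewrite mulmxA mul_last_frameT.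
exists (rsubmx (x *m U)); last by rewrite mulmxA mul_last_frameT.
by exists (x *m U) => //; exists x.
Qed.

Lemma fiber_section U : fiber (base (rotate U K)) 0 =
  [set rsubmx x | x in section B0 (rotate U K)].
Proof.
apply/seteqP; split => [e [x Kx xe]|_ [x Kx <-]].
  exists (row_mx (lsubmx x) e); last by rewrite row_mxKr.
  by rewrite /section/= mul_first_frame row_mxKl row_mxKr -xe hsubmxK.
exists (x *m B0) => //; by rewrite mul_first_frame row_mxKr.
Qed.

Lemma measurable_shadow_section_vol : measurable_fun setT shadow_section_vol.
Proof.
pose X := ('M[R]_(j + (d + k)) * 'rV[R]_d * 'rV[R]_(j + (d + k)))%type.
have cr : continuous (fun z : 'M[R]_(j + (d + k)) * 'rV[R]_(j + (d + k)) => rsubmx (z.2 *m z.1)).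
  by apply: continuous_comp_rsubmx; apply: continuous_mulmx => z; [exact: cvg_snd|exact: cvg_fst].
apply: emeasurable_funM.
  have := @measurable_image_vol R _ _ _ _ K (fun U x => rsubmx (rsubmx (x *m U))) cK (continuous_comp_rsubmx cr).
  congr (measurable_fun _ _); apply/funext => U; congr (mu k _); apply/seteqP.
  split => [_ [x Kx <-]|_ [_ [_ [x Kx <-] <-] <-]]; last by exists x.
  by exists (rsubmx (x *m U)) => //; exists (x *m U) => //; exists x.
pose f (w : X) : 'rV[R]_(d + k) := rsubmx (w.2 *m w.1.1) - row_mx w.1.2 0.
have cf : continuous f.
  apply: continuous_submx; last first.
    apply: continuous_row_mx; last exact: cst_continuous.
    by move=> w; apply: (@continuous_comp _ _ _ fst snd); [exact: cvg_fst|exact: cvg_snd].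
  apply: continuous_comp_rsubmx; apply: continuous_mulmx; first by move=> w; exact: cvg_snd.
  by move=> w; apply: (@continuous_comp _ _ _ fst fst); exact: cvg_fst.
have cE : closed [set w | f w = 0].
  exact: (closed_comp (fun w _ => cf w) (@closed_set1_mx R 1 (d + k) 0)).
have := measurable_exists_vol cK cE; congr (measurable_fun _ _).
apply/funext => U; congr (mu d _); apply/seteqP; split => [e [x Kx /subr0_eq/= xe]|e [_ [x Kx <-] xe]].
  by exists (x *m U) => //; exists x.
by exists x => //; rewrite /f /= xe subrr.
Qed.

Lemma section_extend U V : ortho_mx U -> ortho_mx V ->
  section B0 (rotate (U *m @extend_first R j d k V) K) = rotate V (section B0 (rotate U K)).
Proof.
move=> oU oV; have oE := @extend_first_orthogonal R j d k V oV.
rewrite rotate_preimage; last exact: ortho_mxM.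
rewrite rotate_preimage// rotate_preimage//; apply/seteqP.
by split => x; rewrite /section/= trmx_mul extend_firstT -!mulmxA (mulmxA B0) first_frame_extend -!mulmxA.
Qed.

Lemma shadow_section_extend U V : ortho_mx U -> ortho_mx V ->
  shadow_section_vol (U *m @extend_first R j d k V) =
  (mu k (base (base (rotate U K))) * tlvol j (section B0 (rotate U K)) V)%E.
Proof.
move=> oU oV; rewrite /shadow_section_vol; congr (_ * _)%E.
  rewrite !base_base_project; congr (mu k (project _ _)).
  by rewrite trmx_mul mulmxA extend_firstT last_frame_extend.
rewrite fiber_section section_extend// -tl_rsubmx /tlvol; congr (mu _ _).
by apply/seteqP; split => [_ [_ [x Kx <-] <-]|_ [x Kx <-]]; [exists x|exists (x *m V) => //; exists x].
Qed.

(** The constant of Kubota's formula for index [j] in dimension [j + d], that of the section. *)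
Definition grassmann_cst : R := omega R (j + d) / omega R d.

(* By Kubota's formula the quermassintegral of the section is an average over
   rotations [V] of its span, and such a rotation does not affect the projection
   onto the orthogonal complement. *)
Lemma shadow_section_average U : ortho_mx U ->
  (mu k (base (base (rotate U K))) * (quermass (section B0 (rotate U K)) j)%:E =
   grassmann_cst%:E * \int[haar R (j + d)]_V shadow_section_vol (U *m @extend_first R j d k V))%E.
Proof.
move=> oU; have cU := @rotate_compact R _ U K cK; have vU := @rotate_cvx R _ U K vK.
have cS := section_compact (frame_first R j d k) cU.
have vS := @section_cvx R _ _ B0 _ vU.
have S0 : section B0 (rotate U K) !=set0.
  by exists 0; rewrite /section/= mul0mx; exists 0; rewrite ?mul0mx.
rewrite quermass_kubota ?leq_addr// /kubota EFinM -tlvolE// addKn muleCA; congr (_ * _)%E.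
have mt := @measurable_tlvol R _ j _ cS.
have me : measurable_fun setT (fun V => shadow_section_vol (U *m @extend_first R j d k V)).
  apply: measurableT_comp measurable_shadow_section_vol _.
  by apply: measurable_fun_mulmx; [exact: measurable_cst|exact: measurable_extend_first].
have s0 V : (0 <= shadow_section_vol (U *m @extend_first R j d k V))%E.
  by rewrite mule_ge0//; exact: measure_ge0.
have t0 V : (0 <= tlvol j (section B0 (rotate U K)) V)%E by exact: measure_ge0.
rewrite -ge0_integralZl//.
rewrite [LHS]haar_integral_On; last 2 first.
- by apply: emeasurable_funM; [exact: measurable_cst|].
- by move=> V; rewrite mule_ge0//; exact: measure_ge0.
rewrite [RHS]haar_integral_On//; apply: eq_integral => V; rewrite inE => oV.
by rewrite shadow_section_extend.
Qed.

Lemma base_tlvol U : mu (d + k) (base (rotate U K)) = tlvol j K U.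
Proof.
rewrite /tlvol -(tl_rsubmx [set x *m U | x in K]); congr (mu _ _).
by apply/seteqP; split => [_ [_ [x Kx <-] <-]|_ [x Kx <-]]; [exists x|exists (x *m U) => //; exists x].
Qed.

Lemma shadow_section_bounds U : ortho_mx U ->
  (((d.+1%:R / n.+1%:R) ^+ d)%:E * tlvol j K U <= shadow_section_vol U <=
   'C(d + k, k)%:R%:E * tlvol j K U)%E.
Proof.
move=> oU; have cU := @rotate_compact R _ U K cK; have vU := @rotate_cvx R _ U K vK.
have cL := base_compact cU; have vL := base_cvx vU.
have pU : 0 < vol (rotate U K) by rewrite vol_rot//; exact: compact_mx_measurable.
have mL := compact_mx_measurable cL; have bL := compact_ebounded cL.
rewrite -base_tlvol volE// /shadow_section_vol volE; last exact: base_compact.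
rewrite fiberE// -!EFinM !lee_fin; apply/andP; split.
  exact: (fiber_average_lower d0 cU vU pU (centered_rotate oU cK pK K0)).
rewrite (_ : 'C(d + k, k) = 'C(k + d, k)); last by rewrite addnC.
exact: rogers_shephard_section.
Qed.

Lemma integral_tlvol : (\int[haarn]_U tlvol j K U =
  (omega R (d + k) / omega R n * quermass K j)%:E)%E.
Proof.
rewrite tlvolE// quermass_kubota ?leq_addr//; last by exists 0.
rewrite /kubota addKn; congr EFin; set I := fine _.
by field; rewrite !gt_eqF ?omega_gt0.
Qed.

(** Kubota's formula inside the subspace introduces a second average, over rotations [V] of the
    reference subspace; the product of [U] with the extension of [V] is Haar distributed, so the two
    averages collapse into one. *)
Lemma grassmann_integral_shadow (nu : probability 'M[R]_(j + (d + k)) R) :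
  grassmann_haar (j + d) nu ->
  (\int[nu]_(F in grassmannian (j + d)) grassmann_integrand j K F =
   grassmann_cst%:E * \int[haarn]_U shadow_section_vol U)%E.
Proof.
move=> Hnu; have mn : (j + d <= n)%N by rewrite addnA leq_addr.
pose f := (grassmann_integrand j K) \_ (@grassmannian R n (j + d)).
have mG := @measurable_grassmannian R n (j + d).
have mf : measurable_fun setT f.
  apply/(measurable_restrict _ mG measurableT); rewrite setTI.
  by apply: measurable_integrand => //; exact: leq_addr.
have G0 : grassmannian (j + d) F0 := frame_grassmannian (frame_first R j d k).
(* Rather than rotating the subspace by [W^T], the body is rotated by [W] and the coordinate frames
   stay fixed. *)
have f_frame W : ortho_mx W -> f (W *m F0 *m W^T) =
   (mu k (base (base (rotate W K))) * (quermass (section B0 (rotate W K)) j)%:E)%E.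
  move=> oW; have oWT := ortho_mxT oW.
  have fB := frame_rotate oWT (frame_first R j d k).
  have fC := frame_rotate oWT (frame_last R j d k).
  rewrite trmxK in fB fC.
  have E : W *m orthocompl F0 *m W^T = orthocompl (W *m F0 *m W^T).
    by rewrite /orthocompl mulmxBr mulmx1 mulmxBl oW.
  rewrite E in fC; rewrite /f patchE mem_set; last exact: frame_grassmannian fB.
  rewrite /grassmann_integrand (vol_in_frame cK fC) (quermass_in_frame cK fB) base_base_project.
  congr (_ * (quermass _ j)%:E)%E; apply/seteqP.
  by rewrite rotate_preimage//; split => x; rewrite /section/= mulmxA.
(* The sign of the quermassintegral is read off from Kubota's average, after moving the subspace to
   the reference one. *)
have f0 F : (0 <= f F)%E.
  rewrite /f patchE; case: ifPn => //; rewrite inE => GF.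
  have [W oW ->] := grassmannian_conj mn G0 GF.
  have := f_frame _ (ortho_mxT oW); rewrite trmxK /f patchE mem_set; last exact: conj_proj.
  move=> ->; apply: mule_ge0; first exact: measure_ge0.
  have cU := @rotate_compact R _ W^T K cK; have vU := @rotate_cvx R _ W^T K vK.
  rewrite lee_fin quermass_kubota ?kubota_ge0 ?leq_addr//.
  - exact: section_compact (frame_first R j d k) cU.
  - exact: section_cvx.
  - by exists 0; rewrite /section/= mul0mx; exists 0; rewrite ?mul0mx.
have fG F : ~ grassmannian (j + d) F -> f F = 0%E.
  by move=> nG; rewrite /f patchE memNset.
transitivity (\int[nu]_(F in grassmannian (j + d)) f F)%E.
  by apply: eq_integral => F FG; rewrite /f patchE FG.
rewrite (grassmann_integral mn Hnu G0 (reflection_orthogonal R j d k) (det_reflection R j k d0)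
  (reflection_first_proj R j d k) mf f0 fG).
have mh : measurable_fun setT (fun U : 'M[R]_(j + (d + k)) => f (U *m F0 *m U^T)).
  apply: measurableT_comp mf _; apply: measurable_fun_mulmx; last exact: measurable_trmx.
  by apply: measurable_fun_mulmx; [exact: measurable_id|exact: measurable_cst].
transitivity (\int[haarn]_U f (U *m F0 *m U^T))%E.
  rewrite -(haar_integral_trmx mh (fun U => f0 _)).
  by apply: eq_integral => U _; rewrite trmxK.
have ms := measurable_shadow_section_vol.
have s0 V : (0 <= shadow_section_vol V)%E by rewrite mule_ge0//; exact: measure_ge0.
have c0 : 0 <= grassmann_cst by rewrite divr_ge0// ltW// omega_gt0.
rewrite -(haar_integral_mul (@measurable_extend_first R j d k) (@extend_first_orthogonal R j d k) ms s0).
rewrite -ge0_integralZl//; last 2 first.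
- exact: (measurable_haar_inner (@measurable_extend_first R j d k) ms s0).
- by move=> U _; exact: integral_ge0.
rewrite haar_integral_On// [RHS]haar_integral_On; last 2 first.
- apply: emeasurable_funM; first exact: measurable_cst.
  exact: (measurable_haar_inner (@measurable_extend_first R j d k) ms s0).
- by move=> U; rewrite mule_ge0// integral_ge0.
apply: eq_integral => U; rewrite inE => oU.
by rewrite f_frame// shadow_section_average.
Qed.

Theorem grassmann_bounds (nu : probability 'M[R]_(j + (d + k)) R) :
  grassmann_haar (j + d) nu ->
  ((grassmann_cst * (d.+1%:R / n.+1%:R) ^+ d * (omega R (d + k) / omega R n * quermass K j))%:E
   <= \int[nu]_(F in grassmannian (j + d)) grassmann_integrand j K F
   <= (grassmann_cst * 'C(d + k, k)%:R * (omega R (d + k) / omega R n * quermass K j))%:E)%E.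
Proof.
move=> Hnu; rewrite grassmann_integral_shadow//.
have c0 : 0 <= grassmann_cst by rewrite divr_ge0// ltW// omega_gt0.
have ms := measurable_shadow_section_vol.
have s0 V : (0 <= shadow_section_vol V)%E by rewrite mule_ge0//; exact: measure_ge0.
have mt := @measurable_tlvol R _ j K cK.
have t0 V : (0 <= tlvol j K V)%E by exact: measure_ge0.
have E c : 0 <= c -> (\int[haarn]_(U in On R n) (c%:E * tlvol j K U) =
    (c * (omega R (d + k) / omega R n * quermass K j))%:E)%E.
  move=> c1; rewrite -haar_integral_On; last 2 first.
  - by apply: emeasurable_funM; [exact: measurable_cst|].
  - by move=> U; rewrite mule_ge0.
  by rewrite ge0_integralZl// integral_tlvol.
have mO := @measurable_On R n.
have l0 : 0 <= (d.+1%:R / n.+1%:R) ^+ d :> R by rewrite exprn_ge0// divr_ge0.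
rewrite haar_integral_On// -!(mulrA grassmann_cst) !(EFinM grassmann_cst).
apply/andP; split; apply: lee_wpmul2l; rewrite ?lee_fin//.
  rewrite -[leLHS]E//; apply: ge0_le_integral => //.
  - by move=> U _; rewrite mule_ge0.
  - by apply: measurable_funTS; apply: emeasurable_funM; [exact: measurable_cst|].
  - exact: measurable_funTS.
  - by move=> U oU; have /andP[] := shadow_section_bounds oU.
rewrite -[leRHS]E//; apply: ge0_le_integral => //.
- exact: measurable_funTS.
- by apply: measurable_funTS; apply: emeasurable_funM; [exact: measurable_cst|].
- by move=> U oU; have /andP[] := shadow_section_bounds oU.
Qed.

End Main.

Theorem theorem1p1 (R : realType) (n k j : nat) (K : set 'rV[R]_n)
    (nu : probability 'M[R]_n R) :
  (j + k < n)%N ->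
  convex_body K -> centered K ->
  grassmann_haar (n - k) nu ->
  ((alpha R n k j * ((n - k - j + 1)%:R / (n + 1)%:R) ^+ (n - k - j)
      * quermass K j)%:E
   <= \int[nu]_(F in grassmannian (n - k))
        (vol_in (orthocompl F) (orthoproj (orthocompl F) K)
         * (quermass_in F (K `&` rowspace F) j)%:E)
   <= (alpha R n k j * 'C(n - j, k)%:R * quermass K j)%:E)%E.
Proof.
move=> jkn [cK vK iK] K0.
(* The three blocks of coordinates: [j] are projected away to form L, [d] span E, and [k] span the
   complement of the reference subspace. *)
pose d := (n - k - j)%N; have dn : n = (j + (d + k))%N by rewrite /d; lia.
have d0 : (0 < d)%N by rewrite /d; lia.
move: d dn d0 => d dn d0; subst n.
have e1 : (j + (d + k) - k = j + d)%N by lia.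
have e2 : (j + d - j = d)%N by lia.
have e3 : (j + (d + k) - j = d + k)%N by lia.
rewrite /alpha e1 e2 e3 !addn1 => Hnu.
have pK := interior_vol_gt0 cK iK.
have := grassmann_bounds d0 cK (convex_set_cvx vK) pK K0 Hnu.
(* [alpha] is the product of the two Kubota constants, one for the section and one for [K]. *)
have E c : omega R (j + d) * omega R (d + k) / (omega R d * omega R (j + (d + k))) * c * quermass K j =
    grassmann_cst R j d * c * (omega R (d + k) / omega R (j + (d + k)) * quermass K j).
  by rewrite /grassmann_cst; field; rewrite !gt_eqF ?omega_gt0.
by rewrite !E.
Qed.
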